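(* Let $\nu$ be a (countably additive) vector measure defined on a $\sigma$-algebra $\Sigma$ and taking values in a Banach space. If $\nu$ is homogeneous and $L_1(\nu)$ is non-separable, then there is a (countably additive) vector measure $\tilde{\nu}:\Sigma\to c_0(\kappa)$ such that $L_1(\nu)=L_1(\tilde{\nu})$ with equal norms, where $\kappa$ is the density character of $L_1(\nu)$.
   Context: All Banach spaces are real; vector measures are countably additive. The density character $\mathrm{dens}(T)$ of a topological space $T$ is the minimal cardinality of a dense subset of $T$ (for a Banach space, with respect to the norm topology). A cardinal $\kappa$ is identified with the set of ordinals $\alpha<\kappa$. For a non-empty set $\Gamma$, $c_0(\Gamma)$ is the Banach space of all bounded functions $\varphi:\Gamma\to\mathbb{R}$ such that $\{\gamma\in\Gamma:|\varphi(\gamma)|>\varepsilon\}$ is finite for every $\varepsilon>0$, with the supremum norm. Let $(\Omega,\Sigma)$ be a measurable space, $X$ a Banach space and $\nu:\Sigma\to X$ a vector measure. For $A\in\Sigma$ put $\Sigma_A:=\{B\in\Sigma: B\subseteq A\}$ (a $\sigma$-algebra on $A$) and let $\nu_A$ be the restriction of $\nu$ to $\Sigma_A$. A set $A\in\Sigma$ is $\nu$-null if $\nu(B)=0$ for all $B\in\Sigma_A$; $\mathcal{N}(\nu)$ is the family of all $\nu$-null sets. $\nu$ is atomless if for every $A\in\Sigma\setminus\mathcal{N}(\nu)$ there is $B\in\Sigma_A$ such that neither $B$ nor $A\setminus B$ is $\nu$-null. For $x^*\in X^*$, $x^*\nu$ denotes the signed measure $x^*\circ\nu$ and $|x^*\nu|$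 its variation. A $\Sigma$-measurable function $f:\Omega\to\mathbb{R}$ is $\nu$-integrable if it is $|x^*\nu|$-integrable for all $x^*\in X^*$ and for each $A\in\Sigma$ there is $\int_A f\,d\nu\in X$ such that $x^*\left(\int_A f\,d\nu\right)=\int_A f\,d(x^*\nu)$ for all $x^*\in X^*$. $L_1(\nu)$ is the Banach lattice of all $\nu$-integrable functions, identifying functions that coincide $\nu$-a.e. (i.e. outside a $\nu$-null set), with the $\nu$-a.e. order and the norm $\|f\|_{L_1(\nu)}:=\sup_{x^*\in B_{X^*}}\int_\Omega |f|\,d|x^*\nu|$, where $B_{X^*}$ is the closed unit ball of $X^*$. $\nu$ is homogeneous if it is atomless and $\mathrm{dens}(L_1(\nu))=\mathrm{dens}(L_1(\nu_A))$ for every $A\in\Sigma\setminus\mathcal{N}(\nu)$. For vector measures $\nu,\tilde\nu$ on the same $\sigma$-algebra $\Sigma$ (with possibly different target spaces), ''$L_1(\nu)=L_1(\tilde\nu)$ with equal norms'' means that $\mathcal{N}(\nu)=\mathcal{N}(\tilde\nu)$, a $\Sigma$-measurable function is $\nu$-integrable if and only if it is $\tilde\nu$-integrable, and $\|f\|_{L_1(\nu)}=\|f\|_{L_1(\tilde\nu)}$ for all such $f$. *)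

(* Defs.v *)
From HB Require Import structures.
From mathcomp Require Import all_boot all_order all_algebra.
From mathcomp Require Import all_classical all_reals all_analysis.
From mathcomp Require Import measurable_realfun.

Set Implicit Arguments.
Unset Strict Implicit.
Unset Printing Implicit Defensive.

Import Order.TTheory GRing.Theory Num.Theory.
Import numFieldNormedType.Exports.

Local Open Scope classical_set_scope.
Local Open Scope card_scope.
Local Open Scope ring_scope.

Lemma card_le_well_founded (T : Type) (P : set (set T)) : P !=set0 ->
  exists D, P D /\ forall E, P E -> D #<= E.
Proof.
move=> [D0 PD0].
have [[E [PE E0]]|Pne] := pselect (exists E, P E /\ E = set0).
  by exists E; split=> // F _; rewrite E0.
have {}Pne E : P E -> E !=set0.
  by move=> PE; apply/set0P/eqP => E0; apply: Pne; exists E.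
have [t0 _] := Pne _ PD0.
pose G (S : set (set T -> T)) := (forall h E, S h -> P E -> E (h E)) /\
  (forall h k E, S h -> S k -> P E -> h E = k E -> h = k).
have [F FG Ftot|S [[S1 S2] Smax]] := @Zorn_bigcup _ G.
  split=> [h E [X FX Xh] PE|h k E [X FX Xh] [Y FY Yk] PE].
    exact: (FG _ FX).1 h E Xh PE.
  have [XY|YX] := Ftot _ _ FX FY.
    exact: (FG _ FY).2 h k E (XY _ Xh) Yk PE.
  exact: (FG _ FX).2 h k E Xh (YX _ Yk) PE.
have [D [PD Dsurj]] :
    exists D, P D /\ forall x, D x -> exists2 h, S h & h D = x.
  apply: contrapT => noD.
  have /choice[h0 h0P] : forall E, exists x, P E ->
      E x /\ ~ exists2 h, S h & h E = x.
    move=> E; have [PE|nPE] := pselect (P E); last by exists t0.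
    apply: contrapT => nx; apply: noD; exists E; split=> // x Ex.
    by apply: contrapT => nh; apply: nx; exists x.
  have nSh0 : ~ S h0.
    by move=> Sh0; have [_] := h0P _ PD0; apply; exists h0.
  have SSh0 : S `<` S `|` [set h0].
    by split=> [h|SS]; [left|apply/nSh0/SS; right].
  apply: (Smax _ SSh0).
  split=> [h E [Sh|->] PE|h k E [Sh|->] [Sk|->] PE //].
  - exact: S1 Sh PE.
  - by have [] := h0P _ PE.
  - exact: S2 Sh Sk PE.
  - by move=> hE; have [_ []] := h0P _ PE; exists h.
  - by move=> hE; have [_ []] := h0P _ PE; exists k.
exists D; split=> // E PE.
have /choice[g gP] : forall x, exists h, D x -> S h /\ h D = x.
  move=> x; have [Dx|nDx] := pselect (D x); last by exists (fun=> t0).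
  by have [h Sh hD] := Dsurj x Dx; exists h.
have ginj : set_inj D (fun x => g x E).
  move=> x y /set_mem Dx /set_mem Dy gxy.
  have [[Sx gx] [Sy gy]] := (gP x Dx, gP y Dy).
  by rewrite -gx -gy (S2 _ _ E Sx Sy PE gxy).
rewrite -(card_le_eql (inj_card_eq ginj)); apply: subset_card_le.
by move=> _ [x Dx <-]; have [Sx _] := gP x Dx; exact: S1 Sx PE.
Qed.

(* The density character of S is the cardinality of the set dens S: among the
   dense subsets of S it is one of least cardinality (see densP). Equality of
   density characters is thus equipotence #=. *)
Definition dens (S : topologicalType) : set S :=
  get [set D : set S | dense D /\ forall E : set S, dense E -> D #<= E].
Arguments dens S : clear implicits.

Lemma densP (S : topologicalType) :
  dense (dens S) /\ forall E : set S, dense E -> dens S #<= E.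
Proof.
apply: (@getPex _ [set D : set S | dense D /\ forall E, dense E -> D #<= E]).
apply: (@card_le_well_founded _ (@dense S)); exists setT => O O0 _.
by rewrite setIT.
Qed.

Definition separable (S : topologicalType) :=
  exists2 D : set S, countable D & dense D.

Section c0_space.
Context {R : realType} {G : Type}.

Definition c0_pred : {pred G -> R} := mem [set phi : G -> R |
  (exists M, forall g, `|phi g| <= M) /\
  forall e, 0 < e -> finite_set [set g | e < `|phi g|]].

Definition c0_key : pred_key c0_pred. Proof. exact. Qed.
Canonical c0_keyed := KeyedPred c0_key.

Lemma c0_submod_closed : submod_closed c0_pred.
Proof.
split=> [|a u v /[!inE] -[[Mu uM] ufin] [[Mv vM] vfin]]; rewrite ?inE; split.
- by exists 0 => g; rewrite normr0.
- move=> e e0; rewrite (_ : mkset _ = set0)//; apply/seteqP; split=> // g /=.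
  by rewrite normr0 ltNge ltW.
- exists (`|a| * Mu + Mv) => g; rewrite (le_trans (ler_normD _ _))// lerD//.
  by rewrite normrM ler_wpM2l.
- move=> e e0; have a0 : 0 < `|a| + 1 by rewrite ltr_wpDl.
  apply: (@sub_finite_set _ _
    ([set g | e / 2 / (`|a| + 1) < `|u g|] `|` [set g | e / 2 < `|v g|])).
    move=> g /= eg; apply: contrapT => /not_orP[/negP + /negP].
    rewrite -!leNgt ler_pdivlMr// => ug vg.
    move: eg; apply/negP; rewrite -leNgt (splitr e).
    rewrite (le_trans (ler_normD _ _))// lerD// normrM (le_trans _ ug)// mulrC.
    by rewrite ler_wpM2l// lerDl.
  by rewrite finite_setU; split; [apply: ufin; rewrite !divr_gt0|
    apply: vfin; rewrite divr_gt0].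
Qed.

HB.instance Definition _ := GRing.isSubmodClosed.Build _ _ c0_pred
  c0_submod_closed.

End c0_space.

Record c0 (R : realType) (G : Type) :=
  C0 { c0_fun :> G -> R ; _ : c0_fun \in c0_pred }.

Section c0_theory.
Context {R : realType} {G : Type}.

HB.instance Definition _ := [isSub for @c0_fun R G].
HB.instance Definition _ := [Choice of c0 R G by <:].
HB.instance Definition _ := [SubChoice_isSubLmodule of c0 R G by <:].

Implicit Types phi psi : c0 R G.

Definition c0_norm phi : R := sup (range (fun g => `|phi g|)).

Lemma c0_bounded phi : exists M, forall g, `|phi g| <= M.
Proof. by have := valP phi; rewrite inE => -[]. Qed.

Lemma c0_finite phi e : 0 < e -> finite_set [set g | e < `|phi g|].
Proof. by have := valP phi; rewrite inE => -[_]; apply. Qed.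

Lemma le_c0_norm phi g : `|phi g| <= c0_norm phi.
Proof.
apply: ub_le_sup; last by exists g.
by have [M phiM] := c0_bounded phi; exists M => _ [h _ <-].
Qed.

Lemma c0_norm_ge0 phi : 0 <= c0_norm phi.
Proof.
have [[g _]|G0] := pselect ([set: G] !=set0).
  by rewrite (le_trans _ (le_c0_norm phi g)).
rewrite /c0_norm [X in sup X](_ : _ = set0) ?sup0//.
by apply/seteqP; split=> // ? [g _ _]; apply: G0; exists g.
Qed.

Lemma c0_norm_le phi M : 0 <= M -> (forall g, `|phi g| <= M) -> c0_norm phi <= M.
Proof.
move=> M0 phiM; have [[g _]|G0] := pselect ([set: G] !=set0).
  by apply: ge_sup => [|_ [h _ <-]//]; exists `|phi g|; exists g.
rewrite /c0_norm [X in sup X](_ : _ = set0) ?sup0//.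
by apply/seteqP; split=> // ? [g _ _]; apply: G0; exists g.
Qed.

Let c0_normD phi psi : c0_norm (phi + psi) <= c0_norm phi + c0_norm psi.
Proof.
apply: c0_norm_le => [|g]; first by rewrite addr_ge0 ?c0_norm_ge0.
by rewrite (le_trans (ler_normD _ _))// lerD// le_c0_norm.
Qed.

Let c0_normZ (a : R) phi : c0_norm (a *: phi) = `|a| * c0_norm phi.
Proof.
have H (b : R) psi : c0_norm (b *: psi) <= `|b| * c0_norm psi.
  apply: c0_norm_le => [|g]; first by rewrite mulr_ge0 ?c0_norm_ge0.
  by rewrite normrM ler_wpM2l ?le_c0_norm.
apply/eqP; rewrite eq_le H/=; have [->|a0] := eqVneq a 0.
  by rewrite normr0 mul0r c0_norm_ge0.
rewrite -ler_pdivlMl ?normr_gt0// -normfV -[leLHS]/(c0_norm phi).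
by rewrite -{1}(scalerK a0 phi) H.
Qed.

Let c0_norm0_eq0 phi : c0_norm phi = 0 -> phi = 0.
Proof.
move=> phi0; apply/val_inj/funext => g /=.
by apply/eqP; rewrite -normr_eq0 eq_le normr_ge0 andbT -phi0 le_c0_norm.
Qed.

HB.instance Definition _ := Lmodule_isNormed.Build R (c0 R G)
  c0_normD c0_normZ c0_norm0_eq0.

Lemma c0_normE phi : `|phi| = sup (range (fun g => `|phi g|)).
Proof. by []. Qed.

Lemma c0_cauchy_cvg (F : set_system (c0 R G)) :
  ProperFilter F -> cauchy F -> cvg F.
Proof.
move=> FF /cauchy_ballP Fc.
have /choice[l Fl] : forall g, exists l : R,
    (fun phi : c0 R G => phi g) @ F --> l.
  move=> g; apply/cvg_ex; apply: cauchy_cvg; apply/cauchy_ballP => e e0.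
  move: (Fc e e0) => [[A B] /= [FA FB] AB].
  exists ((fun phi : c0 R G => phi g) @` A, (fun phi : c0 R G => phi g) @` B).
    by split; [apply: filterS FA|apply: filterS FB] => u ?; exists u.
  move=> [_ _] /= [[u Au <-] [v Bv <-]].
  have : ball u e v by exact: (AB (u, v)).
  rewrite -!ball_normE /ball_/=; apply: le_lt_trans.
  exact: (le_c0_norm (u - v)).
have Fu (e : R) : 0 < e ->
    F [set phi : c0 R G | forall g, `|l g - phi g| <= e].
  move=> e0; have [[A B] /= [FA FB] AB] := Fc e e0.
  apply: filterS FA => u Au g.
  have := Fl g; move=> /cvgrPdist_le lg.
  apply/ler_addgt0Pr => d d0.
  have [v [Bv lv]] : exists v, B v /\ `|l g - v g| <= d.
    by apply: (@filter_ex _ F); apply: filterI => //; exact: lg.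
  rewrite -(subrKA (v g)) (le_trans (ler_normD _ _))// (addrC e).
  rewrite lerD// distrC; apply: ltW.
  have : ball u e v by exact: (AB (u, v)).
  rewrite -!ball_normE /ball_/=; apply: le_lt_trans.
  exact: (le_c0_norm (u - v)).
have lc0 : l \in c0_pred.
  rewrite inE; split.
    have [phi lphi] := filter_ex (Fu 1 ltr01).
    exists (1 + `|phi|) => g; rewrite -(subrK (phi g) (l g)).
    by rewrite (le_trans (ler_normD _ _))// lerD// le_c0_norm.
  move=> e e0; have e20 : 0 < e / 2 by rewrite divr_gt0.
  have [phi lphi] := filter_ex (Fu _ e20).
  apply: sub_finite_set (c0_finite phi e20) => g /= eg.
  rewrite -(ltrD2l (e / 2)) -splitr (lt_le_trans eg)//.
  by rewrite -(subrK (phi g) (l g)) (le_trans (ler_normD _ _))// lerD// subrK.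
apply/cvg_ex; exists (C0 lc0); apply/cvgrPdist_le => e e0.
apply: filterS (Fu e e0) => phi lphi.
by apply: c0_norm_le (ltW e0) _ => g; exact: lphi.
Qed.

HB.instance Definition _ := Uniform_isComplete.Build (c0 R G) c0_cauchy_cvg.

End c0_theory.

Record dual (R : realType) (X : normedModType R) := Dual {
  dual_fun :> {linear X -> R^o} ;
  dual_continuous : continuous dual_fun }.

Definition dual_unit_ball (R : realType) (X : normedModType R) : set (dual X) :=
  [set x | forall v : X, `|x v| <= `|v|].

Section charge_variation.
Context d (T : measurableType d) (R : realType).
Implicit Type mu : {charge set T -> \bar R}.

Definition hahn_pos mu : set T := sval (cid (Hahn_decomposition mu)).

Definition hahn_neg mu : set T :=
  sval (cid (svalP (cid (Hahn_decomposition mu)))).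

Definition hahnP mu : hahn_decomposition mu (hahn_pos mu) (hahn_neg mu) :=
  svalP (cid (svalP (cid (Hahn_decomposition mu)))).

Definition variation mu : {measure set T -> \bar R} :=
  charge_variation (hahnP mu).

Lemma variation_null mu N : measurable N ->
  (forall B, measurable B -> B `<=` N -> mu B = 0%E) -> variation mu N = 0%E.
Proof.
move=> mN N0; have [[mP _] [mM _] _ _] := hahnP mu.
rewrite /variation/= /charge_variation jordan_posE jordan_negE/=.
rewrite cjordan_posE cjordan_negE /crestr0 mem_set// /crestr.
by rewrite !N0 ?oppe0 ?adde0//; exact: measurableI.
Qed.

(* The value does not depend on the Hahn decomposition that is chosen. *)
Definition charge_integral mu (A : set T) (f : T -> R) : R :=
  Rintegral (jordan_pos (hahnP mu)) A f - Rintegral (jordan_neg (hahnP mu)) A f.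

End charge_variation.

(* vector_measure_fun is total on set T; only its values on measurable sets
   matter. *)
Record vector_measure d (T : measurableType d) (R : realType)
    (X : completeNormedModType R) := VectorMeasure {
  vector_measure_fun :> set T -> X ;
  vector_measure_sigma_additive : forall F : (set T)^nat,
    (forall n, measurable (F n)) -> trivIset setT F ->
    (fun n => \sum_(0 <= i < n) vector_measure_fun (F i)) @ \oo -->
    vector_measure_fun (\bigcup_n F n) }.

Section vector_measure_theory.
Context d (T : measurableType d) (R : realType) (X : completeNormedModType R).
Variable nu : vector_measure T X.
Implicit Types f g h : T -> R.

Lemma vector_measure0 : nu set0 = 0.
Proof.
have cv : (fun n => \sum_(0 <= i < n) nu set0) @ \oo --> nu set0.
  have := @vector_measure_sigma_additive _ _ _ _ nu (fun=> set0)
    (fun=> measurable0).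
  by rewrite bigcup0//; apply; apply/trivIsetP => ? ? _ _ _; rewrite setI0.
have cvS : (fun n => \sum_(0 <= i < n.+1) nu set0) @ \oo --> nu set0.
  by have := cv; rewrite -(cvg_shiftS (fun n => \sum_(0 <= i < n) nu set0)).
have E : (fun n => \sum_(0 <= i < n.+1) nu set0) -
    (fun n => \sum_(0 <= i < n) nu set0) = (fun=> nu set0).
  by apply/funext => n; rewrite !fctE/= big_nat_recr//= addrAC subrr add0r.
have : (fun=> nu set0) @ \oo --> nu set0 - nu set0 by rewrite -E; exact: cvgB.
by rewrite subrr => /(cvg_lim (@norm_hausdorff _ _)) <-; rewrite lim_cst//;
  exact: norm_hausdorff.
Qed.

Lemma vector_measureU A B : measurable A -> measurable B -> A `&` B = set0 ->
  nu (A `|` B) = nu A + nu B.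
Proof.
move=> mA mB AB; have := @vector_measure_sigma_additive _ _ _ _ nu (bigcup2 A B).
rewrite bigcup2E => cvAB.
have mF n : measurable (bigcup2 A B n) by case: n => [|[|n]] //=.
have tF : trivIset setT (bigcup2 A B) by rewrite -trivIset_bigcup2.
have : (fun=> nu A + nu B) @ \oo --> nu (A `|` B).
  apply: (cvg_trans _ (cvAB mF tF)); apply: near_eq_cvg; near=> n.
  have n2 : (2 <= n)%N by near: n; exists 2%N.
  rewrite -(subnKC n2) !addSn add0n !big_nat_recl//= big1 ?addr0//.
  by move=> i _; exact: vector_measure0.
move=> /(cvg_lim (@norm_hausdorff _ _)) <-.
by rewrite lim_cst//; exact: norm_hausdorff.
Unshelve. all: by end_near. Qed.

Definition scalarization (x : dual X) (A : set T) : \bar R := (x (nu A) : R)%:E.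

Section scalarization.
Variable x : dual X.

Let scalarization0 : scalarization x set0 = 0%E.
Proof. by rewrite /scalarization vector_measure0 linear0. Qed.

Let scalarization_fin A : measurable A -> scalarization x A \is a fin_num.
Proof. by []. Qed.

Let scalarization_sigma_additive : semi_sigma_additive (scalarization x).
Proof.
move=> F mF tF mUF; rewrite /scalarization.
have -> : (fun n => (\sum_(0 <= i < n) (x (nu (F i)) : R)%:E)%E) =
    (fun n => (x (\sum_(0 <= i < n) nu (F i)) : R)%:E).
  by apply/funext => n; rewrite sumEFin linear_sum.
apply: cvg_EFin; first exact: nearW.
apply: (@continuous_cvg _ _ _ _ _ _ (x : X -> R^o)).
  exact: dual_continuous.
exact: vector_measure_sigma_additive.
Qed.

HB.instance Definition _ := isCharge.Build _ _ _ (scalarization x)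
  scalarization0 scalarization_fin scalarization_sigma_additive.

End scalarization.

Definition vnull : set (set T) := [set A | measurable A /\
  forall B, measurable B -> B `<=` A -> nu B = 0].

Definition vatomless := forall A, measurable A -> ~ vnull A ->
  exists B, [/\ measurable B, B `<=` A, ~ vnull B & ~ vnull (A `\` B)].

Definition vintegrable (f : T -> R) :=
  [/\ measurable_fun [set: T] f,
      forall x : dual X,
        (variation (scalarization x)).-integrable setT (EFin \o f)
    & forall A, measurable A -> exists v : X, forall x : dual X,
        x v = charge_integral (scalarization x) A f].

(* Extended-real valued; finite on integrable functions, by uniform
   boundedness. *)
Definition L1norm (f : T -> R) : \bar R :=
  ereal_sup [set \int[variation (scalarization x)]_(t in setT) `|f t|%:E
    | x in @dual_unit_ball R X]%E.

Definition vae_eq (f g : T -> R) :=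
  exists2 N, vnull N & forall t, ~ N t -> f t = g t.

Lemma vnull0 : vnull set0.
Proof. by split=> // B _; rewrite subset0 => ->; exact: vector_measure0. Qed.

Lemma vnullU A B : vnull A -> vnull B -> vnull (A `|` B).
Proof.
move=> [mA A0] [mB B0]; split; first exact: measurableU.
move=> C mC CAB; rewrite -(setUIDK C A) vector_measureU.
- rewrite A0 ?B0 ?addr0//; [exact: measurableD| |exact: measurableI].
  by move=> t [/CAB[]].
- exact: measurableI.
- exact: measurableD.
- by apply/seteqP; split=> // t [[_ At] [_ nAt]].
Qed.

Lemma vae_eq_refl f : vae_eq f f.
Proof. by exists set0 => //; exact: vnull0. Qed.

Lemma vae_eq_sym f g : vae_eq f g -> vae_eq g f.
Proof. by move=> [N N0 fg]; exists N => // t /fg. Qed.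

Lemma vae_eq_trans f g h : vae_eq f g -> vae_eq g h -> vae_eq f h.
Proof.
move=> [N N0 fg] [M M0 gh]; exists (N `|` M); first exact: vnullU.
by move=> t /not_orP[/fg-> /gh].
Qed.

Lemma L1norm_ae_eq f g : measurable_fun setT f -> measurable_fun setT g ->
  vae_eq f g -> L1norm f = L1norm g.
Proof.
move=> mf mg [N [mN N0] fg]; congr ereal_sup; apply: eq_imagel => x _.
apply: ge0_ae_eq_integral => //.
- by apply/measurable_EFinP; exact: measurableT_comp.
- by apply/measurable_EFinP; exact: measurableT_comp.
exists N; split=> //=.
  apply: variation_null => // B mB BN.
  by rewrite -[LHS]/((x (nu B) : R)%:E) N0// linear0.
by move=> t /=; apply: contra_notP => /fg -> _.
Qed.

Lemma L1normN f : L1norm (fun t => - f t) = L1norm f.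
Proof.
congr ereal_sup; apply: eq_imagel => x _.
by apply: eq_integral => t _; rewrite normrN.
Qed.

Lemma L1norm0 f : (forall t, f t = 0) -> (L1norm f <= 0)%E.
Proof.
move=> f0; apply: ge_ereal_sup => _ [x _ <-].
by rewrite integral0_eq// => t _; rewrite f0 normr0.
Qed.

Lemma L1normD f g : measurable_fun setT f -> measurable_fun setT g ->
  (L1norm (fun t => f t + g t)%R <= L1norm f + L1norm g)%E.
Proof.
have mnorm h : measurable_fun setT h ->
    measurable_fun setT (fun t : T => `|h t|%:E).
  by move=> mh; apply/measurable_EFinP; exact: measurableT_comp.
move=> mf mg; apply: ge_ereal_sup => _ [x x1 <-].
apply: (@le_trans _ _
  (\int[variation (scalarization x)]_(t in setT) (`|f t|%:E + `|g t|%:E))%E).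
  apply: ge0_le_integral => //.
  - by apply: mnorm; exact: measurable_funD.
  - by apply: emeasurable_funD; exact: mnorm.
  - by move=> t _; rewrite -EFinD lee_fin ler_normD.
rewrite ge0_integralD//; [|exact: mnorm..].
by apply: leeD; apply: ereal_sup_ubound; exists x.
Qed.

Record L1fun := L1Fun { L1fun_val :> T -> R ; _ : `[< vintegrable L1fun_val >] }.

HB.instance Definition _ := [isSub for L1fun_val].
HB.instance Definition _ := [Choice of L1fun by <:].

Definition L1_eq (f g : L1fun) := `[< vae_eq f g >].

Let L1_eq_refl : reflexive L1_eq.
Proof. by move=> f; apply/asboolP; exact: vae_eq_refl. Qed.

Let L1_eq_sym : symmetric L1_eq.
Proof. by move=> f g; apply/asboolP/asboolP; exact: vae_eq_sym. Qed.

Let L1_eq_trans : transitive L1_eq.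
Proof. by move=> g f h /asboolP fg /asboolP/(vae_eq_trans fg)/asboolP. Qed.

Canonical L1_eq_equiv := EquivRel L1_eq L1_eq_refl L1_eq_sym L1_eq_trans.

Local Open Scope quotient_scope.

Definition L1 : Type := {eq_quot L1_eq}.
HB.instance Definition _ := Choice.on L1.
HB.instance Definition _ := EqQuotient.on L1.

(* The balls of the norm metric of L1 nu, which define its topology below;
   L1_ballE shows that they do not depend on the representatives. *)
Definition L1_ball (f : L1) (e : R) (g : L1) : Prop :=
  (L1norm (fun t => repr f t - repr g t)%R < e%:E)%E.

Lemma L1fun_measurable (f : L1fun) : measurable_fun setT f.
Proof. by have /asboolP[] := valP f. Qed.

Lemma L1fun_integrable (f : L1fun) : vintegrable f.
Proof. exact/asboolP/(valP f). Qed.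

Lemma L1_ballE (f g : L1fun) (e : R) : L1_ball (\pi_L1 f) e (\pi_L1 g) =
  (L1norm (fun t => f t - g t)%R < e%:E)%E.
Proof.
have /asboolP[N N0 Nf] : L1_eq (repr (\pi_L1 f)) f.
  by apply/eqmodP; rewrite reprK.
have /asboolP[M M0 Mg] : L1_eq (repr (\pi_L1 g)) g.
  by apply/eqmodP; rewrite reprK.
rewrite /L1_ball; congr (is_true (_ < _)%E); apply: L1norm_ae_eq.
- by apply: measurable_funB; exact: L1fun_measurable.
- by apply: measurable_funB; exact: L1fun_measurable.
exists (N `|` M); first exact: vnullU.
by move=> t /not_orP[/Nf-> /Mg->].
Qed.

Lemma L1_ball_center (f : L1) (e : R) : 0 < e -> L1_ball f e f.
Proof.
move=> e0; rewrite /L1_ball (@le_lt_trans _ _ 0%E) ?lte_fin//.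
by apply: L1norm0 => t; rewrite subrr.
Qed.

Lemma L1_ball_sym (f g : L1) (e : R) : L1_ball f e g -> L1_ball g e f.
Proof.
rewrite /L1_ball -L1normN; congr (is_true (L1norm _ < _)%E).
by apply/funext => t; rewrite opprB.
Qed.

Lemma L1_ball_triangle (f g h : L1) (e1 e2 : R) :
  L1_ball f e1 g -> L1_ball g e2 h -> L1_ball f (e1 + e2) h.
Proof.
rewrite /L1_ball => fg gh; rewrite EFinD; apply: le_lt_trans (lteD fg gh).
rewrite [X in L1norm X](_ : _ = fun t : T =>
  (repr f t - repr g t) + (repr g t - repr h t)).
  by apply: L1normD; apply: measurable_funB; exact: L1fun_measurable.
by apply/funext => t; rewrite subrKA.
Qed.

Let L1_nbhsE :
  nbhs_ball_ L1_ball = nbhs_ (entourage_ L1_ball).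
Proof.
rewrite /nbhs_ entourage_E predeq2E => f A; split.
  move=> [e e0 sbeA]; exists [set fg | L1_ball fg.1 e fg.2]; first by exists e.
  by move=> g /xsectionP; exact: sbeA.
by move=> [E [e e0 sbeE] sEA]; exists e => // g fg; exact/sEA/xsectionP/sbeE.
Qed.

HB.instance Definition _ := hasNbhs.Build L1 (nbhs_ball_ L1_ball).
HB.instance Definition _ := @Nbhs_isPseudoMetric.Build R L1
  (entourage_ L1_ball) L1_nbhsE L1_ball
  L1_ball_center L1_ball_sym L1_ball_triangle erefl.

End vector_measure_theory.

Section restriction.
Context d (T : measurableType d) (R : realType) (X : completeNormedModType R).
Variable nu : vector_measure T X.

Lemma not_vnull_nonempty (A : set T) : ~ vnull nu A -> A !=set0.
Proof.
by move=> nA; apply/set0P/eqP => A0; apply: nA; rewrite A0; exact: vnull0.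
Qed.

End restriction.

Section subspace.
Context d (T : measurableType d).

(* The points of A, as a measurable space of its own; A is nonempty because
   measurableType extends pointedType. *)
Definition msub (A : set T) (mA : measurable A) (A0 : A !=set0) : Type :=
  set_type A.

Variables (A : set T) (mA : measurable A) (A0 : A !=set0).
Local Notation S := (msub mA A0).

Definition msub_val (a : S) : T := set_val a.

HB.instance Definition _ := Choice.on S.

HB.instance Definition _ := isPointed.Build S
  (SigSub (mem_set (svalP (cid A0)))).

Definition msub_measurable : set (set S) :=
  [set B | measurable (msub_val @` B)].

Let msub_measurable0 : msub_measurable set0.
Proof. by rewrite /msub_measurable/= image_set0. Qed.

Let msub_measurableC B : msub_measurable B -> msub_measurable (~` B).
Proof.
rewrite /msub_measurable/= => mB.
rewrite (_ : _ @` _ = A `\` (msub_val @` B)); first exact: measurableD.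
apply/seteqP; split=> [_ [b nBb <-]|t [At nBt]].
  split; first exact/set_mem/valP.
  by move=> [c Bc /val_inj cb]; apply: nBb; rewrite -cb.
exists (SigSub (mem_set At)) => // Bt; apply: nBt.
by exists (SigSub (mem_set At)).
Qed.

Let msub_bigcup (F : (set S)^nat) :
  (forall n, msub_measurable (F n)) -> msub_measurable (\bigcup_n F n).
Proof.
move=> mF; rewrite /msub_measurable/= image_bigcup.
exact: bigcupT_measurable.
Qed.

HB.instance Definition _ := @isMeasurable.Build d S msub_measurable
  msub_measurable0 msub_measurableC msub_bigcup.

Context (R : realType) (X : completeNormedModType R).
Variable nu : vector_measure T X.

Lemma vrestr_sigma_additive (F : (set S)^nat) :
  (forall n, measurable (F n)) -> trivIset setT F ->
  (fun n => \sum_(0 <= i < n) nu (msub_val @` F i)) @ \oo -->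
  nu (msub_val @` \bigcup_n F n).
Proof.
move=> mF tF; rewrite image_bigcup.
apply: (@vector_measure_sigma_additive _ _ _ _ nu (fun n => msub_val @` F n)).
  by move=> n; exact: mF.
apply/trivIsetP => i j _ _ ij; apply/seteqP; split=> // _ [[a Fa <-]].
move=> [b Fb /val_inj ba]; move/trivIsetP : tF => /(_ i j I I ij) Fij.
suff : (F i `&` F j) a by rewrite Fij.
by split=> //; rewrite -ba.
Qed.

Definition vrestr : vector_measure S X :=
  @VectorMeasure _ S R X (fun B => nu (msub_val @` B)) vrestr_sigma_additive.

End subspace.

Definition vhomogeneous d (T : measurableType d) (R : realType)
    (X : completeNormedModType R) (nu : vector_measure T X) :=
  vatomless nu /\
  forall (A : set T) (mA : measurable A) (nA : ~ vnull nu A),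
    dens (L1 nu) #= dens (L1 (vrestr mA (not_vnull_nonempty nA) nu)).

Definition same_L1 d (T : measurableType d) (R : realType)
    (X Y : completeNormedModType R)
    (nu : vector_measure T X) (nu' : vector_measure T Y) :=
  [/\ vnull nu = vnull nu',
      forall f, measurable_fun setT f -> (vintegrable nu f <-> vintegrable nu' f)
    & forall f, vintegrable nu f -> L1norm nu f = L1norm nu' f].

(* Main.v *)
Require Import Defs.
From HB Require Import structures.
From mathcomp Require Import all_boot all_order all_algebra.
From mathcomp Require Import all_classical all_reals all_analysis.
From mathcomp Require Import measurable_realfun wochoice ring lra.
(* imported again so that variation is that of a charge, not that of a function
   on an interval *)
Require Import Defs.

(** Let la be a finite measure with the same null sets as nu, for which the
    variations |x nu|, x in the unit ball of the dual, are uniformly absolutely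
    continuous (control_measure), and write |x nu| = h_x la.  A measurable
    function f has norm sup_x int |f| h_x dla, and density of a set of
    cardinality kappa in L1(nu) provides kappa functionals x_k that already
    give this supremum (norming_family).  The measure with values in c0 is

      nu'(A) = (int_A h_k e_k dla)_k,

    where each e_k takes only the values 1 and -1.  Its k-th coordinate has
    variation h_k la = |x_k nu| whatever the signs are, so that nu and nu' give
    the same norm to every measurable function.  What the signs must achieve is
    that nu'(A) belongs to c0.  By Bessel's inequality it is enough that the
    functions h_k e_k be pairwise orthogonal in L2(la), at least after h_k has
    been cut off at any given height (bessel_finite); cutting off at a large
    height changes int_A h_k e_k by little, uniformly in k, because of the
    uniform absolute continuity.

    The e_k are chosen by recursion on a well order of the index set all of
    whose initial segments have less than kappa elements.  At stage k the
    function e_k must be orthogonal to a given family of less than kappa bounded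
    functions.  Consider the convex set of the functions with values in [-1, 1]
    orthogonal to that family: an extreme point has modulus 1 almost everywhere
    as soon as every set A of positive measure carries a nonzero bounded
    function orthogonal to the family.  This holds by homogeneity
    (exists_annihilator): otherwise the lattice of functions generated over the
    rationals by the restrictions to A of the family would approximate all
    measurable subsets of A, and would be a dense subset of L1(nu_A) of
    cardinality less than kappa.  The extreme point is reached not by
    compactness but by a sequence of functions of almost maximal L2 norm, each
    in a face determined by the previous ones (sign_exists).

    Equality of the norms of all measurable functions implies the rest: the null
    sets are those with an indicator of norm zero, and f is integrable if and
    only if the truncations of f converge to f in norm (vintegrableP).  The
    difficult direction of that criterion is the countable additivity of the
    indefinite integral of f, which the definition only gives weakly; this is
    the theorem of Orlicz and Pettis (wsa_disjoint_small).  The Hahn-Banach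
    theorem enters through norming and separating functionals. *)

Set Implicit Arguments.
Unset Strict Implicit.
Unset Printing Implicit Defensive.

Import Order.TTheory GRing.Theory Num.Theory.
Import numFieldNormedType.Exports.

Local Open Scope classical_set_scope.
Local Open Scope card_scope.
Local Open Scope ring_scope.

(** * Infinite cardinals *)

Lemma inj_card_leT (T U : Type) (f : T -> U) :
  injective f -> [set: T] #<= [set: U].
Proof.
move=> fi; rewrite -(card_le_eql (inj_card_eq (in2W fi : {in setT &, injective f}))).
exact: card_leT.
Qed.

Lemma card_leT_inj (T U : Type) :
  [set: T] #<= [set: U] -> exists f : T -> U, injective f.
Proof.
elim/Ppointed: U => U; last first.
  by move=> /pcard_injP[f fi]; exists f => x y; apply: fi; rewrite inE.
rewrite !emptyE => T0.
have nT (x : T) : False by have : [set: T] x by []; rewrite T0.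
by exists (fun x => match nT x with end) => x; case: (nT x).
Qed.

Lemma card_le_set_inj (T U : Type) (A : set T) (B : set U) (u0 : U) :
  A #<= B -> exists2 f : T -> U, set_fun A B f & set_inj A f.
Proof.
move=> /card_leP[f].
pose g x := if pselect (A x) is left Ax then sval (f (SigSub (mem_set Ax))) else u0.
exists g.
  move=> x Ax; rewrite /g; case: pselect => // Ax'.
  by apply: set_mem; exact: (svalP (f _)).
move=> x y /set_mem Ax /set_mem Ay; rewrite /g.
case: pselect => // Ax'; case: pselect => // Ay' /val_inj.
by move=> /(@inj _ _ _ f _ _ (mem_set I) (mem_set I)) /(congr1 sval).
Qed.

(** Comparability of two subsets of one type is minimality of cardinality in the
    pair that they form. *)
Lemma card_le_total2 (T : Type) (A B : set T) : A #<= B \/ B #<= A.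
Proof.
have [D [DAB Dmin]] := @card_le_well_founded T [set A; B] (ex_intro _ A (or_introl erefl)).
by case: DAB => <-; [left|right]; apply: Dmin; [right|left].
Qed.

Section card_square.
Variable T : Type.
Implicit Types (G : set (T * T * T)) (B : set T).

Definition pairing_dom G : set T := [set a | exists y, G (a, a, y)].

(** Graphs of the injections of B x B into B, for B a subset of T; encoded as sets
    of triples, so that the union of a chain of them is again one. The diagonal
    suffices to recover B. *)
Definition pairing G := [/\
  forall p y z, G (p, y) -> G (p, z) -> y = z,
  forall p q y, G (p, y) -> G (q, y) -> p = q,
  forall a b y, G (a, b, y) -> [/\ pairing_dom G a, pairing_dom G b & pairing_dom G y] &
  forall a b, pairing_dom G a -> pairing_dom G b -> exists y, G (a, b, y)].

Lemma pairing_dom_sub G H : G `<=` H -> pairing_dom G `<=` pairing_dom H.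
Proof. by move=> GH a [y Gy]; exists y; exact: GH. Qed.

(** Zorn's lemma above a given pairing; starting from a pairing on an infinite set
    keeps the maximal one from being trivial. *)
Lemma pairing_maximal G0 : pairing G0 ->
  exists G, [/\ pairing G, G0 `<=` G &
    forall H, pairing H -> G `<=` H -> H `<=` G].
Proof.
move=> G0P.
have [|G [GP Gmax]] := @Zorn_bigcup _ [set G | pairing (G0 `|` G)].
  move=> F FP Ftot.
  have [[X FX]|F0] := pselect (F !=set0); last first.
    have -> : \bigcup_(X in F) X = set0.
      by rewrite bigcup0// => X FX; exfalso; apply: F0; exists X.
    by rewrite /= setU0.
  have in1 p : (G0 `|` \bigcup_(X in F) X) p -> exists2 X, F X & (G0 `|` X) p.
    by case=> [G0p|[Y FY Yp]]; [exists X => //; left|exists Y => //; right].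
  have in2 p q : (G0 `|` \bigcup_(X in F) X) p ->
      (G0 `|` \bigcup_(X in F) X) q ->
      exists2 X, F X & (G0 `|` X) p /\ (G0 `|` X) q.
    move=> /in1[Y FY Yp] /in1[Z FZ Zq].
    have [YZ|ZY] := Ftot _ _ FY FZ.
      by exists Z => //; split=> //; apply: setUS Yp.
    by exists Y => //; split=> //; apply: setUS Zq.
  have sub Y : F Y -> G0 `|` Y `<=` G0 `|` \bigcup_(X in F) X.
    by move=> FY; apply: setUS; exact: bigcup_sup.
  split.
  - move=> p y z py pz; have [Y FY [Yy Yz]] := in2 _ _ py pz.
    by have [H _ _ _] := FP _ FY; exact: H Yy Yz.
  - move=> p q y py qy; have [Y FY [Yy Yz]] := in2 _ _ py qy.
    by have [_ H _ _] := FP _ FY; exact: H Yy Yz.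
  - move=> a b y /in1[Y FY Yy]; have [_ _ H _] := FP _ FY.
    by have [? ? ?] := H _ _ _ Yy; split; apply: (pairing_dom_sub (sub _ FY)).
  - move=> a b [y ay] [z bz]; have [Y FY [Yy Yz]] := in2 _ _ ay bz.
    have [_ _ _ H] := FP _ FY.
    have [||w Yw] := H a b; [by exists y|by exists z|].
    by exists w; exact: sub Yw.
exists (G0 `|` G); split=> // H HP GH.
have HE : G0 `|` H = H by apply/setUidPr => x ?; apply: GH; left.
have [HG|nHG] := pselect (H `<=` G); first by move=> x /HG; right.
exfalso; apply: (Gmax H); last by rewrite /= HE.
by split=> // x Gx; apply: GH; right.
Qed.

Lemma pairing_fun G : pairing G -> exists f : T -> T -> T,
  (forall a b, pairing_dom G a -> pairing_dom G b -> pairing_dom G (f a b)) /\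
  (forall a b c d, pairing_dom G a -> pairing_dom G b -> pairing_dom G c -> pairing_dom G d ->
     f a b = f c d -> a = c /\ b = d) /\
  (forall a b, pairing_dom G a -> pairing_dom G b -> G (a, b, f a b)).
Proof.
move=> [G1 G2 G3 G4].
have /choice[f fP] : forall p : T * T, exists y,
    pairing_dom G p.1 -> pairing_dom G p.2 -> G (p, y).
  move=> [a b]; have [[Ga Gb]|nG] := pselect (pairing_dom G a /\ pairing_dom G b).
    by have [y Gy] := G4 a b Ga Gb; exists y.
  by exists a => /= Ga Gb; exfalso; apply: nG.
exists (fun a b => f (a, b)); split; [|split].
- by move=> a b Ga Gb; have [] := G3 _ _ _ (fP (a, b) Ga Gb).
- move=> a b c e Ga Gb Gc Ge E; have := fP (a, b) Ga Gb; rewrite E.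
  by move=> /G2 /(_ (fP (c, e) Gc Ge))[].
- by move=> a b Ga Gb; exact: (fP (a, b)).
Qed.

(** A maximal pairing lives on a set B at least as large as its complement C: if C
    contained a copy C' of B, then the pairs of elements of B and C' that are not
    pairs of elements of B could be sent injectively into C'. Hence T injects into
    B x B, and so into B. *)
Lemma card_square : infinite_set [set: T] -> [set: T * T] #<= [set: T].
Proof.
move=> /infiniteP /card_leT_inj[i iI].
pose G0 : set (T * T * T) :=
  [set p | exists m n, p = (i m, i n, i (pickle (m, n)))].
have dG0 : pairing_dom G0 = range i.
  apply/seteqP; split=> [a [y [m [n []]]] -> _ _|_ [m _ <-]]; first by exists m.
  by exists (i (pickle (m, m))), m, m.
have pI : injective (@pickle (nat * nat)%type) := pcan_inj pickleK.
have G0P : pairing G0.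
  split.
  - move=> [a b] y z [m [n []]] -> -> -> [m' [n' []]] /iI -> /iI -> -> //.
  - move=> p q y [m [n []]] -> -> [m' [n' []]] -> /iI/pI[-> ->] //.
  - by move=> a b y [m [n []]] -> -> ->; rewrite dG0; split; eexists.
  - move=> a b; rewrite dG0 => -[m _ <-] [n _ <-].
    by exists (i (pickle (m, n))), m, n.
have [G [GP G0G Gmax]] := pairing_maximal G0P.
have [f [fD [fI fG]]] := pairing_fun GP; set B := pairing_dom G in fD fI fG.
have Bi n : B (i n) by apply: (pairing_dom_sub G0G); rewrite dG0; exists n.
(* If B is the larger part, T injects into B x B by means of two elements of B. *)
have [CB|BC] := card_le_total2 (~` B) B.
  have [g gB gI] := card_le_set_inj (i 0%N) CB.
  pose h x := if pselect (B x) is left _ then f (i 0%N) x else f (i 1%N) (g x).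
  have hB x : B (h x).
    by rewrite /h; case: pselect => Bx; apply: fD => //; exact: gB.
  have hI : injective h.
    move=> x y; rewrite /h; case: pselect => Bx; case: pselect => By.
    - by move=> /fI[].
    - by move=> /fI[]//; [exact: gB|move/iI].
    - by move=> /fI[]//; [exact: gB|move/iI].
    - move=> /fI[]//; [exact: gB..|move=> _].
      by apply: gI; rewrite inE.
  apply: (@inj_card_leT _ _ (fun p => f (h p.1) (h p.2))).
  by move=> [a b] [c e] /= /fI[]// /hI -> /hI ->.
have [g gC gI] := card_le_set_inj (i 0%N) BC.
pose C := g @` B.
have CB c : C c -> ~ B c by move=> [b Bb <-]; exact: gC.
(* e codes the disjoint union of B and C into B *)
have /choice[e eP] : forall x, exists y, (B x -> y = f (i 0%N) x) /\
    (C x -> exists2 b, B b & g b = x /\ y = f (i 1%N) b).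
  move=> x; have [Bx|nBx] := pselect (B x).
    by exists (f (i 0%N) x); split=> // /CB.
  have [[b Bb gb]|nC] := pselect (C x); last by exists x.
  by exists (f (i 1%N) b); split=> // _; exists b.
have eB x : (B `|` C) x -> B (e x).
  case=> [Bx|Cx]; first by rewrite (eP x).1//; exact: fD.
  by have [b Bb [_ ->]] := (eP x).2 Cx; exact: fD.
have eI x y : (B `|` C) x -> (B `|` C) y -> e x = e y -> x = y.
  case=> [Bx|Cx] [By|Cy].
  - by rewrite (eP x).1// (eP y).1// => /fI[].
  - by have [b Bb [_ ->]] := (eP y).2 Cy; rewrite (eP x).1// => /fI[]// /iI.
  - by have [b Bb [_ ->]] := (eP x).2 Cx; rewrite (eP y).1// => /fI[]// /iI.
  - have [b Bb [<- ->]] := (eP x).2 Cx; have [b' Bb' [<- ->]] := (eP y).2 Cy.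
    by move=> /fI[]// _ ->.
pose H := G `|` [set p | [/\ (B `|` C) p.1.1, (B `|` C) p.1.2,
  ~ (B p.1.1 /\ B p.1.2) & p.2 = g (f (e p.1.1) (e p.1.2))]].
have [G1 G2 G3 G4] := GP.
have dH : pairing_dom H = B `|` C.
  apply/seteqP; split=> [a [y [Gy|[]//]]|a [[y Gy]|Ca]].
  - by have [] := G3 _ _ _ Gy; left.
  - by exists y; left.
  - exists (g (f (e a) (e a))); right; split=> //=; [by right|by right|].
    by move=> [/CB]; exact.
have HP : pairing H.
  split.
  - move=> [a b] y z [Gy|[/= _ _ nB ->]] [Gz|[/= _ _ nB' ->]] //.
    + exact: G1 Gy Gz.
    + by have [? ? _] := G3 _ _ _ Gy; exfalso; apply: nB'.
    + by have [? ? _] := G3 _ _ _ Gz; exfalso; apply: nB.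
  - move=> [a b] [a' b'] y [Gy|[/= ? ? nB yE]] [Gz|[/= ? ? nB' yE']] //.
    + exact: G2 Gy Gz.
    + have [_ _ By] := G3 _ _ _ Gy; exfalso; apply: (gC (f (e a') (e b'))).
        by apply: fD; exact: eB.
      by rewrite -yE'.
    + have [_ _ By] := G3 _ _ _ Gz; exfalso; apply: (gC (f (e a) (e b))).
        by apply: fD; exact: eB.
      by rewrite -yE.
    + have : f (e a) (e b) = f (e a') (e b').
        by apply: gI; rewrite ?inE -?yE//; apply: fD; exact: eB.
      by move=> /fI[]; try exact: eB; move=> /eI -> // /eI ->.
  - move=> a b y [Gy|[/= Ha Hb nB ->]]; rewrite dH.
      by have [? ? ?] := G3 _ _ _ Gy; split; left.
    split=> //; right; exists (f (e a) (e b)) => //.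
    by apply: fD; exact: eB.
  - move=> a b; rewrite dH => Ha Hb.
    have [[Ba Bb]|nB] := pselect (B a /\ B b).
      by have [y Gy] := G4 a b Ba Bb; exists y; left.
    by exists (g (f (e a) (e b))); right.
have HG : H `<=` G by apply: Gmax => //; exact: subsetUl.
exfalso; apply: (gC (i 0%N)) => //.
apply: (pairing_dom_sub HG); rewrite dH; right.
by exists (i 0%N).
Qed.

End card_square.

(** A sequence is coded by its length and by iterated pairing of its entries; the
    length makes the code unambiguous. *)
Lemma card_seq (T : Type) :
  infinite_set [set: T] -> [set: seq T] #<= [set: T].
Proof.
move=> Tinf; have /card_leT_inj[i iI] := (infiniteP _).1 Tinf.
have /card_leT_inj[p pI] := card_square Tinf.
pose c := fix c (s : seq T) : T := if s is x :: s' then p (x, c s') else i 0%N.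
apply: (@inj_card_leT _ _ (fun s => p (i (size s), c s))) => s t.
move=> /pI[/iI]; elim: s t => [|x s IH] [|y t]//= [st] /pI[-> cst].
by rewrite (IH t st cst).
Qed.

(** * Well orders and small index sets *)

(** If some initial segments of a well order are as large as K, the smallest of
    them is isomorphic to K by a bijection, through which its order is transported
    to K; its own initial segments are too small. *)
Lemma small_well_order (K : Type) : exists lt : K -> K -> Prop,
  [/\ well_founded lt, forall a b, a <> b -> lt a b \/ lt b a &
      forall a, ~ ([set: K] #<= [set b | lt b a])].
Proof.
elim/Pchoice: K => K; have [R Rwo] := well_ordering_principle K.
have least (A : set K) : A !=set0 -> exists2 z, A z & forall x, A x -> R z x.
  move=> [x Ax]; have [|z [[Az lz] _]] := Rwo (mem A); first by exists x; rewrite inE.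
  by exists z => [|y Ay]; [rewrite inE in Az|apply: lz; rewrite inE].
have Rtot a b : R a b \/ R b a.
  have [|z zab lz] := least [set a; b]; first by exists a; left.
  by case: zab => <-; [left|right]; apply: lz; [right|left].
have Ranti a b : R a b -> R b a -> a = b.
  move=> ab ba; have [|z [_ uz]] := Rwo (mem [set a; b]).
    by exists a; rewrite inE; left.
  have Raa : R a a by have [] := Rtot a a.
  have Rbb : R b b by have [] := Rtot b b.
  have za : minimum_of R (mem [set a; b]) a.
    by split=> [|x]; rewrite !inE; [left|case=> ->].
  have zb : minimum_of R (mem [set a; b]) b.
    by split=> [|x]; rewrite !inE; [right|case=> ->].
  by rewrite -(uz a)// -(uz b).
pose lt a b := R a b /\ a <> b.
have lt_total a b : a <> b -> lt a b \/ lt b a.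
  move=> ab; have [] := Rtot a b; [by left|right; split=> //].
  exact: nesym.
have lt_wf : well_founded lt.
  move=> a; apply: contrapT => na.
  have [|z nz lz] := least [set x | ~ Acc lt x]; first by exists a.
  apply: nz; constructor => y [Ryz yz]; apply: contrapT => ny.
  by apply: yz; apply: Ranti => //; exact: lz.
have [small|] := pselect (forall a, ~ ([set: K] #<= [set b | lt b a])).
  by exists lt.
move=> /existsNP[a0 /contrapT a0K].
have [|a aK al] := least [set a | [set: K] #<= [set b | lt b a]]; first by exists a0.
have [g ga gI] := card_le_set_inj a0 aK.
have {}gI : injective g by move=> x y; apply: gI; rewrite inE.
exists (fun x y => lt (g x) (g y)); split.
- have acc z : Acc lt z -> forall x, g x = z -> Acc (fun x y => lt (g x) (g y)) x.
    by elim=> {}z _ IH x xz; constructor => y; rewrite xz => yz; exact: (IH _ yz y erefl).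
  by move=> x; exact: acc (lt_wf (g x)) x erefl.
- by move=> x y xy; apply: lt_total => /gI.
- move=> y yK; have [Ra na] := ga y I; apply: na; apply: Ranti => //.
  apply: al => /=; apply: card_le_trans yK _.
  rewrite -(card_le_eql (inj_card_eq (in2W gI : {in [set b | lt (g b) (g y)] &, injective g}))).
  by apply: subset_card_le => _ [x xy <-].
Qed.

(** Choosing f a subject to a condition that involves the values of f below a. *)
Lemma wf_choice (K V : Type) (lt : K -> K -> Prop) (P : K -> (K -> V) -> V -> Prop)
    (v0 : V) : well_founded lt ->
  (forall a f g v, (forall b, lt b a -> f b = g b) -> P a f v -> P a g v) ->
  (forall a f, exists v, P a f v) ->
  exists f, forall a, P a f (f a).
Proof.
move=> wf Pext Pex.
have /choice[c cP] : forall p : K * (K -> V), exists v, P p.1 p.2 v.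
  by move=> [a f]; exact: Pex.
pose ext a (rec : forall b, lt b a -> V) b :=
  if pselect (lt b a) is left h then rec b h else v0.
pose F := Fix wf (fun=> V) (fun a rec => c (a, ext a rec)).
exists F => a.
rewrite {2}/F Fix_eq; last first.
  move=> x f g fg; congr (c (_, _)); apply/funext => b; rewrite /ext.
  by case: pselect => // h; rewrite fg.
apply: Pext (cP (a, _)) => b ba /=; rewrite /ext.
by case: pselect.
Qed.

(** Countably many elements for each element of J, and finite terms built from
    them, lead from J to no larger uncountable cardinality. *)
Lemma card_tree_small (K J I : Type) : ~ countable [set: K] ->
  (exists f : I -> nat + J * nat, injective f) ->
  [set: K] #<= [set: GenTree.tree I] -> [set: K] #<= [set: J].
Proof.
move=> Kunc [f fI] KI; pose Z : Type := (nat + J)%type.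
have Zinf : infinite_set [set: Z].
  by apply/infiniteP; apply: (@inj_card_leT _ _ inl) => ? ? [].
have /card_leT_inj[c cI] := card_seq Zinf.
have [g gI] : exists g : nat + I -> Z, injective g.
  pose h (x : nat + I) : seq Z := match x with
    | inl n => [:: inl n]
    | inr i => match f i with
      | inl n => [:: inl n; inl n]
      | inr (j, n) => [:: inr j; inl n] end end.
  exists (c \o h); apply: inj_comp => //.
  move=> [n|i] [m|j] /=; first by case=> ->.
  - by case: (f j) => [?|[? ?]].
  - by case: (f i) => [?|[? ?]].
  - case fi: (f i) => [n|[a n]]; case fj: (f j) => [m|[b m]] //= [].
      by move=> nm; rewrite nm -fj in fi; rewrite (fI _ _ fi).
    by move=> ab nm; rewrite ab nm -fj in fi; rewrite (fI _ _ fi).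
have KZ : [set: K] #<= [set: Z].
  apply: card_le_trans KI _.
  apply: (@inj_card_leT _ _ (fun t => c (map g (GenTree.encode t)))).
  move=> s t /cI /(inj_map gI); exact: (pcan_inj (@GenTree.codeK _)).
have [Jfin|Jinf] := pselect (finite_set [set: J]).
  exfalso; apply: Kunc; apply: sub_countable KZ _.
  have /card_leT_inj[e eI] : [set: J] #<= [set: nat] by exact: finite_set_countable.
  apply: (@inj_card_leT _ _ (fun x : Z => pickle (match x return nat + nat with
    inl n => inl n | inr j => inr (e j) end))).
  move=> x y /(pcan_inj pickleK); case: x y => [n|j] [m|k] //.
    by case=> ->.
  by case=> /eI ->.
apply: card_le_trans KZ _; apply: card_le_trans (card_seq Jinf).
have /card_leT_inj[i iI] := (infiniteP _).1 Jinf.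
apply: (@inj_card_leT _ _ (fun x => match x with inl n => [:: i n] | inr j => [:: j; j] end)).
by move=> [n|j] [m|k] //= []; [move=> /iI ->|move=> ->].
Qed.

(** * The Hahn-Banach theorem *)

Section sublinear.
Context {R : realType} {X : lmodType R}.
Implicit Types (p q : X -> R).

Definition sublinear q :=
  (forall x y, q (x + y) <= q x + q y) /\
  (forall t x, 0 < t -> q (t *: x) <= t * q x).

Lemma sublinear0 q : sublinear q -> q 0 = 0.
Proof.
move=> [qD qZ]; apply/eqP; rewrite eq_le; apply/andP; split.
  by have := qZ 2^-1 0; rewrite scaler0 invr_gt0 ltr0n => /(_ isT); lra.
by have := qD 0 0; rewrite addr0; lra.
Qed.

Lemma sublinearN q x : sublinear q -> - q (- x) <= q x.
Proof.
by move=> sq; have [qD _] := sq; have := qD x (- x); rewrite subrr sublinear0//; lra.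
Qed.

(** Zorn's lemma: the values at x of the functionals below p are bounded from below
    by - p (- x), so that the infimum of a chain is finite. *)
Lemma sublinear_minimal p : sublinear p ->
  exists q, [/\ sublinear q, forall x, q x <= p x &
    forall r, sublinear r -> (forall x, r x <= q x) -> r = q].
Proof.
move=> sp; pose S := {q : X -> R | sublinear q /\ forall x, q x <= p x}.
pose R' (u v : S) := `[< forall x, sval v x <= sval u x >].
have [| | | |[q [sq qp]] qmin] := @Zorn S R'.
- by move=> t; apply/asboolP.
- move=> r s t /asboolP rs /asboolP st; apply/asboolP => x.
  exact: le_trans (st x) (rs x).
- move=> [s Ps] [t Pt] /asboolP st /asboolP ts; apply/eq_exist/funext => x.
  by apply/eqP; rewrite eq_le st ts.
- move=> A Atot; have [[u Au]|A0] := pselect (A !=set0); last first.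
    exists (exist _ p (conj sp (fun=> lexx _))) => s As.
    by exfalso; apply: A0; exists s.
  pose V x := [set sval s x | s in A].
  have V0 x : V x !=set0 by exists (sval u x), u.
  have Vlb x : has_lbound (V x).
    exists (- p (- x)) => _ [[s [ss sp']] As <-] /=.
    by rewrite (le_trans _ (sublinearN x ss))// lerN2.
  pose r x := inf (V x).
  have rle s x : A s -> r x <= sval s x.
    by move=> As; apply: ge_inf => //; exists s.
  have sr : sublinear r.
    split=> [x y|t x t0].
      apply/ler_addgt0Pr => e e0; have e2 : 0 < e / 2 by rewrite divr_gt0.
      have [_ [s As <-] sx] := inf_adherent e2 (conj (V0 x) (Vlb x)).
      have [_ [v Av <-] vy] := inf_adherent e2 (conj (V0 y) (Vlb y)).
      have [w [Aw ws wv]] : exists w, [/\ A w, forall x, sval w x <= sval s x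
          & forall x, sval w x <= sval v x].
        by have [/asboolP sv|/asboolP vs] := Atot _ _ As Av;
          [exists v|exists s]; split.
      apply: le_trans (rle _ _ Aw) _.
      apply: le_trans ((svalP w).1.1 x y) _.
      have := ws x; have := wv y; rewrite -!/(r _) in sx vy *; lra.
    rewrite -ler_pdivrMl//; apply: lb_le_inf => // _ [s As <-].
    rewrite ler_pdivrMl//; apply: le_trans (rle _ _ As) _.
    exact: (svalP s).1.2.
  have rp x : r x <= p x by exact: le_trans (rle _ x Au) ((svalP u).2 x).
  exists (exist _ r (conj sr rp)) => s As; apply/asboolP => x /=.
  exact: rle.
exists q; split=> // r sr rq.
have rp x : r x <= p x by exact: le_trans (rq x) (qp x).
have := qmin (exist _ r (conj sr rp)).
have RR : R' (exist _ q (conj sq qp)) (exist _ r (conj sr rp)) by apply/asboolP.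
by move=> /(_ RR) /(congr1 sval).
Qed.

(** The largest sublinear functional below q whose value at - z is at most - q z.
    For a minimal q it equals q, which forces q (- z) = - q z. *)
Definition slide q z x := inf [set q (x + t *: z) - t * q z | t in [set t | 0 <= t]].

Lemma slide_lb q z x : sublinear q ->
  lbound [set q (x + t *: z) - t * q z | t in [set t | 0 <= t]] (- q (- x)).
Proof.
move=> sq _ [t /= t0 <-]; have [qD qZ] := sq.
have [->|t'] := eqVneq t 0.
  by rewrite scale0r mul0r addr0 subr0; exact: sublinearN.
have t1 : 0 < t by rewrite lt_def t'.
have tz : q z <= t^-1 * q (t *: z).
  by have := qZ t^-1 (t *: z); rewrite invr_gt0 scalerK//; exact.
have := qD (x + t *: z) (- x); rewrite addrAC subrr add0r.
rewrite ler_pdivlMl// in tz; lra.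
Qed.

Lemma slide_le q z x t : sublinear q -> 0 <= t ->
  slide q z x <= q (x + t *: z) - t * q z.
Proof.
move=> sq t0; apply: ge_inf; first by exists (- q (- x)); exact: slide_lb.
by exists t.
Qed.

Lemma slide_adherent q z x e : sublinear q -> 0 < e ->
  exists2 t, 0 <= t & q (x + t *: z) - t * q z < slide q z x + e.
Proof.
move=> sq e0; have [|_ [t t0 <-] te] := @inf_adherent _
    [set q (x + t *: z) - t * q z | t in [set t | 0 <= t]] _ e0.
  split; first by exists (q (x + 0 *: z) - 0 * q z), 0 => //=.
  by exists (- q (- x)); exact: slide_lb.
by exists t.
Qed.

Lemma slide_sublinear q z : sublinear q -> sublinear (slide q z).
Proof.
move=> sq; have [qD qZ] := sq; split=> [x y|c x c0].
  apply/ler_addgt0Pr => e e0; have e2 : 0 < e / 2 by rewrite divr_gt0.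
  have [t t0 tx] := slide_adherent z x sq e2.
  have [s s0 sy] := slide_adherent z y sq e2.
  have := @slide_le q z (x + y) (t + s) sq (addr_ge0 t0 s0).
  have := qD (x + t *: z) (y + s *: z).
  rewrite scalerDl addrACA; lra.
apply/ler_addgt0Pr => e e0; have [t t0 tx] := slide_adherent z x sq (divr_gt0 e0 c0).
apply: le_trans (@slide_le q z (c *: x) (c * t) sq (mulr_ge0 (ltW c0) t0)) _.
rewrite -scalerA -scalerDr.
have := qZ c (x + t *: z) c0.
have ce : c * (e / c) = e by rewrite mulrC divfK ?gt_eqF.
by have := tx; rewrite -(ltr_pM2l c0) !mulrDr ce mulrN mulrA; lra.
Qed.

Lemma slide_le_id q z x : sublinear q -> slide q z x <= q x.
Proof.
by move=> sq; have := slide_le z x sq (lexx 0); rewrite scale0r mul0r addr0 subr0.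
Qed.

Lemma slideN q z : sublinear q -> slide q z (- z) <= - q z.
Proof.
move=> sq; have := slide_le z (- z) sq ler01.
by rewrite scale1r mul1r addNr sublinear0// sub0r.
Qed.

(** A minimal sublinear functional q is odd, hence linear; choosing it below
    slide p y gives q y = p y. *)
Lemma Hahn_Banach_sublinear p y : sublinear p ->
  exists f : {linear X -> R^o}, (forall x, f x <= p x) /\ f y = p y.
Proof.
move=> sp; have [q [sq qs qmin]] := sublinear_minimal (slide_sublinear y sp).
have qN z : q (- z) = - q z.
  apply/eqP; rewrite eq_le; apply/andP; split.
    have {1}<- : slide q z = q.
      by apply: qmin => [|x]; [exact: slide_sublinear|exact: slide_le_id].
    exact: slideN.
  by have := sublinearN (- z) sq; rewrite opprK.
have [qD qZ] := sq.
have qDE x z : q (x + z) = q x + q z.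
  apply/eqP; rewrite eq_le qD/=.
  by have := qD (- x) (- z); rewrite -opprD !qN; lra.
have qZp t x : 0 < t -> q (t *: x) = t * q x.
  move=> t0; apply/eqP; rewrite eq_le qZ//=.
  by have := qZ t^-1 (t *: x); rewrite invr_gt0 scalerK ?gt_eqF// ler_pdivlMl//; exact.
have qlin : linear (q : X -> R^o).
  move=> a x z; rewrite qDE; congr (_ + _).
  have [a0|a0|->] := ltgtP a 0.
  - by rewrite -[a]opprK scaleNr qN qZp ?oppr_gt0// scaleNr.
  - by rewrite qZp.
  - by rewrite !scale0r sublinear0.
pose f : {linear X -> R^o} := HB.pack_for {linear X -> R^o} (q : X -> R^o)
  (GRing.isLinear.Build R X R^o *:%R q qlin).
exists f; split=> [x|].
  exact: le_trans (qs x) (slide_le_id _ _ sp).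
apply/eqP; rewrite eq_le (le_trans (qs y) (slide_le_id _ _ sp))/=.
by have := le_trans (qs (- y)) (slideN y sp); rewrite qN lerN2.
Qed.

End sublinear.

Section dual.
Context {R : realType} {X : normedModType R}.
Implicit Types (x : dual X) (u v : X).

Lemma norm_dominated_dual (f : {linear X -> R^o}) : (forall v, f v <= `|v|) ->
  exists2 x : dual X, dual_unit_ball x & forall v, x v = f v.
Proof.
move=> fle; have fb v : `|f v| <= `|v|.
  rewrite ler_norml fle andbT; have := fle (- v).
  by rewrite linearN normrN -lerN2 opprK.
have fc : continuous f.
  apply: bounded_linear_continuous; apply/linear_boundedP; exists 1; split=> // r r1 v.
  by apply: le_trans (fb v) _; rewrite ler_peMl// ltW.
by exists (Dual fc).
Qed.

Lemma norming_functional v : exists2 x : dual X, dual_unit_ball x & x v = `|v|.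
Proof.
have sn : sublinear (fun v : X => `|v|).
  split=> [u w|t w t0]; first exact: ler_normD.
  by rewrite normrZ gtr0_norm.
have [f [fle fv]] := Hahn_Banach_sublinear v sn.
by have [x x1 xf] := norm_dominated_dual fle; exists x => //; rewrite xf.
Qed.

Lemma norm_le_dual v (c : R) :
  (forall x, dual_unit_ball x -> `|x v| <= c) -> `|v| <= c.
Proof.
by move=> H; have [x x1 <-] := norming_functional v; exact: le_trans (ler_norm _) (H x x1).
Qed.

Lemma dual_eq u v : (forall x, dual_unit_ball x -> x u = x v) -> u = v.
Proof.
move=> H; apply/eqP; rewrite -subr_eq0 -normr_le0; apply: norm_le_dual => x x1.
by rewrite linearB /= H// subrr normr0.
Qed.

(** The distance to V is a sublinear functional. *)
Lemma separating_functional (V : set X) y (e : R) : V 0 ->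
  (forall u v, V u -> V v -> V (u + v)) -> (forall (t : R) u, V u -> V (t *: u)) ->
  0 < e -> (forall v, V v -> e <= `|y - v|) ->
  exists2 x : dual X, (forall v, V v -> x v = 0) & x y != 0.
Proof.
move=> V0 VD VZ e0 Ve.
pose D u := [set `|u - v| | v in V].
pose p u := inf (D u).
have lD u : has_lbound (D u) by exists 0 => _ [v _ <-].
have ple u v : V v -> p u <= `|u - v| by move=> Vv; apply: ge_inf => //; exists v.
have pad u d : 0 < d -> exists2 v, V v & `|u - v| < p u + d.
  move=> d0; have [|_ [v Vv <-] vd] := @inf_adherent _ (D u) _ d0.
    by split=> //; exists `|u - 0|, 0.
  by exists v.
have sp : sublinear p.
  split=> [u w|t w t0]; apply/ler_addgt0Pr => d d0.
    have d2 : 0 < d / 2 by rewrite divr_gt0.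
    have [v Vv uv] := pad u _ d2; have [v' Vv' wv] := pad w _ d2.
    apply: le_trans (ple _ _ (VD _ _ Vv Vv')) _.
    rewrite opprD addrACA; apply: le_trans (ler_normD _ _) _; lra.
  have [v Vv wv] := pad w _ (divr_gt0 d0 t0).
  apply: le_trans (ple _ _ (VZ t _ Vv)) _.
  rewrite -scalerBr normrZ gtr0_norm//.
  have td : t * (d / t) = d by rewrite mulrC divfK ?gt_eqF.
  by have := wv; rewrite -(ltr_pM2l t0) mulrDr td => /ltW.
have [f [fle fy]] := Hahn_Banach_sublinear y sp.
have fn v : f v <= `|v|.
  by apply: le_trans (fle v) _; have := ple v 0 V0; rewrite subr0.
have [x _ xf] := norm_dominated_dual fn.
exists x => [v Vv|].
  have fle0 w : V w -> f w <= 0.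
    by move=> Vw; apply: le_trans (fle w) _; have := ple w w Vw; rewrite subrr normr0.
  rewrite xf; apply/eqP; rewrite eq_le fle0//=.
  have := fle0 (- v); rewrite linearN -oppr_ge0 opprK; apply.
  by rewrite -scaleN1r; exact: VZ.
rewrite xf fy gt_eqF// (lt_le_trans e0)//; apply: lb_le_inf.
  by exists `|y - 0|, 0.
by move=> _ [v Vv <-]; exact: Ve.
Qed.

Lemma dual_scaled x : exists2 c : R, 0 < c &
  exists2 y : dual X, dual_unit_ball y & forall v, x v = c * y v.
Proof.
have /linear_boundedP xb : bounded_near x (nbhs (0 : X)).
  by apply: continuous_linear_bounded; exact: dual_continuous.
have [c c0 xc] := pinfty_ex_gt0 xb; exists c => //.
have fle v : (c^-1 \*: (x : {linear X -> R^o})) v <= `|v|.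
  rewrite /= -[_ *: _]/(_ * _) ler_pdivrMl//.
  exact: le_trans (ler_norm _) (xc v).
have [y y1 yx] := norm_dominated_dual fle.
exists y => // v; rewrite yx /= -[_ *: _]/(_ * _) mulrA divff ?mul1r//.
by rewrite gt_eqF.
Qed.

End dual.

(** * Weakly countably additive set functions *)

Section rational_closure.
Context {R : realType} {V : lmodType R} {I : Type} (h : V -> V) (g : I -> V).

(** Finite terms over the generators g with addition, the operation h and rational
    scaling. Being indexed by trees, their values form a set whose cardinality is
    controlled by that of I. *)
Fixpoint rat_term (t : GenTree.tree I) : V := match t with
  | GenTree.Leaf i => g i
  | GenTree.Node 0 [:: s; s'] => rat_term s + rat_term s'
  | GenTree.Node 1 [:: s] => h (rat_term s)
  | GenTree.Node k.+2 [:: s] => ratr (odflt 0 (unpickle k)) *: rat_term s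
  | _ => 0 end.

Definition rat_closure : set V := range rat_term.

Lemma rat_closure_gen i : rat_closure (g i).
Proof. by exists (GenTree.Leaf i). Qed.

Lemma rat_closure0 : rat_closure 0.
Proof. by exists (GenTree.Node 0 [::]). Qed.

Lemma rat_closureD u v : rat_closure u -> rat_closure v -> rat_closure (u + v).
Proof. by move=> [s _ <-] [t _ <-]; exists (GenTree.Node 0 [:: s; t]). Qed.

Lemma rat_closure_op u : rat_closure u -> rat_closure (h u).
Proof. by move=> [s _ <-]; exists (GenTree.Node 1 [:: s]). Qed.

Lemma rat_closureZ (q : rat) u : rat_closure u -> rat_closure (ratr q *: u).
Proof.
by move=> [s _ <-]; exists (GenTree.Node (pickle q).+2 [:: s]); rewrite //= pickleK.
Qed.

Lemma rat_closure_ind (P : V -> Prop) : P 0 -> (forall i, P (g i)) ->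
  (forall u v, P u -> P v -> P (u + v)) -> (forall u, P u -> P (h u)) ->
  (forall (c : R) u, P u -> P (c *: u)) -> forall u, rat_closure u -> P u.
Proof.
move=> P0 Pg PD Ph PZ _ [t _ <-].
move: t; fix IH 1 => -[i|[|[|k]] [|s [|s' [|s'' l]]]] /=; try exact: P0.
- exact: Pg.
- by apply: PD; exact: IH.
- by apply: Ph; exact: IH.
- by apply: PZ; exact: IH.
Qed.

End rational_closure.

Lemma ratr_near (R : realType) (c e : R) : 0 < e -> exists q : rat, `|c - ratr q| < e.
Proof.
move=> e0; have [|q] := @rat_in_itvoo R (c - e) (c + e); first lra.
rewrite in_itv/= => /andP[q1 q2]; exists q; rewrite ltr_norml; apply/andP; split; lra.
Qed.

Section weakly_sigma_additive.
Context d (T : measurableType d) (R : realType) (X : normedModType R).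
Implicit Types (m : set T -> X) (x : dual X).

(** Countable additivity after composition with every functional. The lemmas below
    show that it has the strong consequences of countable additivity in norm. *)
Definition weakly_sigma_additive m := forall x (F : (set T)^nat),
  (forall n, measurable (F n)) -> trivIset setT F ->
  (fun n => \sum_(0 <= i < n) x (m (F i))) @ \oo --> x (m (\bigcup_n F n)).

Variable m : set T -> X.
Hypothesis wm : weakly_sigma_additive m.

Lemma wsa0 : m set0 = 0.
Proof.
apply: dual_eq => x _; rewrite linear0.
have t0 : trivIset setT (fun _ : nat => @set0 T).
  by apply/trivIsetP => ? ? _ _ _; rewrite setI0.
have := @wm x (fun=> set0) (fun=> measurable0) t0.
rewrite bigcup0// => cv; have := cvg_series_cvg_0 (cvgP _ cv).
by move=> /(cvg_lim (@norm_hausdorff _ _)) <-; rewrite lim_cst//;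
  exact: norm_hausdorff.
Qed.

Lemma wsaU A B : measurable A -> measurable B -> A `&` B = set0 ->
  m (A `|` B) = m A + m B.
Proof.
move=> mA mB AB; apply: dual_eq => x _; rewrite linearD.
have mF n : measurable (bigcup2 A B n) by case: n => [|[|n]] //=.
have tF : trivIset setT (bigcup2 A B) by rewrite -trivIset_bigcup2.
have := @wm x _ mF tF; rewrite bigcup2E => cv.
have : (fun=> x (m A) + x (m B)) @ \oo --> x (m (A `|` B)).
  apply: (cvg_trans _ cv); apply: near_eq_cvg; near=> n.
  have n2 : (2 <= n)%N by near: n; exists 2%N.
  rewrite -(subnKC n2) !addSn add0n !big_nat_recl//= big1 ?addr0//.
  by move=> i _; rewrite wsa0 linear0.
move=> /(cvg_lim (@norm_hausdorff _ _)) <-.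
by rewrite lim_cst//; exact: norm_hausdorff.
Unshelve. all: by end_near. Qed.

Lemma wsaD A B : measurable A -> measurable B -> B `<=` A ->
  m (A `\` B) = m A - m B.
Proof.
move=> mA mB BA; apply/eqP; rewrite eq_sym subr_eq -wsaU ?setDUK//.
- by rewrite setUC setDUK.
- exact: measurableD.
- by rewrite setIC setDIK.
Qed.

Section disjoint_sequence.
Variable C : (set T)^nat.
Hypotheses (mC : forall n, measurable (C n)) (tC : trivIset setT C).

Let part (S : nat -> bool) i := if S i then C i else set0.
Let mpart S i : measurable (part S i).
Proof. by rewrite /part; case: ifP. Qed.
Let tpart S : trivIset setT (part S).
Proof.
move=> i j _ _ [t [it jt]]; apply: tC => //; exists t; move: it jt.
by rewrite /part; case: ifP => // _ ?; case: ifP.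
Qed.
Let mu S := m (\bigcup_i part S i).
Let cvg_mu x S : (fun n => \sum_(0 <= i < n) (if S i then x (m (C i)) else 0)) @ \oo
  --> x (mu S).
Proof.
rewrite (_ : (fun n => _) = (fun n => \sum_(0 <= i < n) x (m (part S i)))).
  exact: wm.
apply/funext => n; apply: eq_bigr => i _; rewrite /part.
by case: ifP => // _; rewrite wsa0 linear0.
Qed.

Let mu_tail x (e : R) : 0 < e -> exists N, forall S S',
  (forall i, (i < N)%N -> S i = S' i) -> `|x (mu S) - x (mu S')| <= e.
Proof.
move=> e0; pose a i : R := x (m (C i)).
(* The positive and the negative terms have sums, which are values of m. *)
have cabs : cvg (series (fun i => `|a i|) @ \oo).
  pose P i := 0 <= a i.
  have E : series (fun i => `|a i|) =
      (fun n => \sum_(0 <= i < n) (if P i then a i else 0)) -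
      (fun n => \sum_(0 <= i < n) (if ~~ P i then a i else 0)).
    apply/funext => n; rewrite /series /= fctE -sumrB; apply: eq_bigr => i _.
    rewrite /P; case: (lerP 0 (a i)) => ai /=; first by rewrite ger0_norm ?subr0.
    by rewrite ltr0_norm// sub0r.
  have cP := @cvg_mu x P; have cN := @cvg_mu x (fun i => ~~ P i).
  by rewrite E; exact: (is_cvgB (cvgP _ cP) (cvgP _ cN)).
have /cauchy_cvgP/cauchy_seriesP /(_ e e0) [[A B] /= [[N _ AN] [M _ BM]] AB] := cabs.
exists (maxn N M) => S S' SS'.
apply: (cvgr_to_le (cvg_norm (cvgB (@cvg_mu x S) (@cvg_mu x S')))).
near=> n; have Kn : (maxn N M <= n)%N by near: n; exists (maxn N M).
rewrite fctE/= -sumrB (@big_cat_nat _ _ _ (maxn N M))//= [X in X + _]big_nat big1 ?add0r.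
  apply: le_trans (ler_norm_sum _ _ _) _.
  have /ltW : `|\sum_(maxn N M <= k < n) `|a k| | < e.
    apply: (AB (maxn N M, n)); split=> /=; first by apply: AN => /=; exact: leq_maxl.
    by apply: BM => /=; apply: leq_trans Kn; exact: leq_maxr.
  rewrite ger0_norm ?sumr_ge0//; apply: le_trans; apply: ler_sum => i _.
  rewrite /a; case: (S i); case: (S' i); rewrite ?subrr ?subr0 ?sub0r ?normrN ?normr0//.
by move=> i /andP[_ iK]; rewrite SS'// subrr.
Unshelve. all: by end_near. Qed.

Let Z : set X := [set u | forall e : R, 0 < e ->
  exists2 v, rat_closure id (fun i => m (C i)) v & `|u - v| <= e].

Let ZD u v : Z u -> Z v -> Z (u + v).
Proof.
move=> Zu Zv e e0; have e2 : 0 < e / 2 by rewrite divr_gt0.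
have [u' Du uu] := Zu _ e2; have [v' Dv vv] := Zv _ e2.
exists (u' + v'); first exact: rat_closureD.
by rewrite opprD addrACA; apply: le_trans (ler_normD _ _) _; lra.
Qed.

Let ZZ (c : R) u : Z u -> Z (c *: u).
Proof.
move=> Zu e e0; have u1 : 0 < `|u| + 1 by rewrite ltr_wpDl.
have [r rD cq] : exists2 r : R, forall v, rat_closure id (fun i => m (C i)) v ->
    rat_closure id (fun i => m (C i)) (r *: v) & `|c - r| < e / 2 / (`|u| + 1).
  have [|q cq] := @ratr_near R c (e / 2 / (`|u| + 1)); first by rewrite !divr_gt0.
  by exists (ratr q) => // v; exact: rat_closureZ.
have q1 : 0 < `|r| + 1 by rewrite ltr_wpDl.
have [|v Dv uv] := Zu (e / 2 / (`|r| + 1)); first by rewrite !divr_gt0.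
exists (r *: v); first exact: rD.
rewrite -(subrKA (r *: u)) -scalerBl -scalerBr.
apply: le_trans (ler_normD _ _) _; rewrite !normrZ [leRHS](splitr e) lerD//.
  move/ltW : cq; rewrite ler_pdivlMr//; apply: le_trans.
  by rewrite ler_wpM2l// lerDl.
move: uv; rewrite ler_pdivlMr// => uv; apply: le_trans uv.
by rewrite mulrC ler_wpM2l// lerDl.
Qed.

Let Z_mu S : Z (mu S).
Proof.
apply: contrapT => nZ.
have [e e0 eD] : exists2 e : R, 0 < e & forall v, Z v -> e <= `|mu S - v|.
  move: nZ => /existsNP[e /not_implyP[e0 nv]]; exists (e / 2); first by rewrite divr_gt0.
  move=> v Zv; rewrite leNgt; apply/negP => ve; apply: nv.
  have e2 : 0 < e / 2 by rewrite divr_gt0.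
  have [v' Dv vv] := Zv _ e2; exists v' => //.
  by rewrite -(subrKA v); apply: le_trans (ler_normD _ _) _; lra.
have Z0 : Z 0.
  by move=> f f0; exists 0; [exact: rat_closure0|rewrite subrr normr0 ltW].
have [x xZ] := separating_functional Z0 ZD ZZ e0 eD.
have ZC i : Z (m (C i)).
  by move=> f f0; exists (m (C i)); [exact: rat_closure_gen|rewrite subrr normr0 ltW].
move=> /eqP; apply.
have : (fun=> 0 : R^o) @ \oo --> x (mu S).
  rewrite [X in X @ _](_ : _ = (fun n => \sum_(0 <= i < n) (if S i then x (m (C i)) else 0))).
    exact: cvg_mu.
  by apply/funext => n; rewrite big1// => i _; case: ifP => // _; exact: xZ.
move=> /(cvg_lim (@norm_hausdorff _ _)) <-; by rewrite lim_cst.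
Qed.

(** The core of the theorem of Orlicz and Pettis. Write m_S for the value of m on the
    union of the C i with i in S. All m_S lie in the closed linear span of the
    m (C i), by Hahn-Banach, and this span has a countable dense subset (y_k). If
    all m (C i) had norm larger than e, any finite part of S could be completed so
    that m_S has distance larger than e / 2 from y_k: adding one more index to S
    moves m_S by more than e. Weak continuity of S |-> m_S makes this an open
    condition, and a diagonal argument yields an m_S far from all y_k. *)
Lemma wsa_disjoint_small (e : R) : 0 < e -> exists j, `|m (C j)| <= e.
Proof.
move=> e0; apply: contrapT => /forallNP nC.
have {}nC j : e < `|m (C j)| by rewrite ltNge; apply/negP.
have e2 : 0 < e / 2 by rewrite divr_gt0.
pose st : Type := ((nat -> bool) * nat)%type.
pose y (k : nat) : X :=
  if unpickle k is Some t then rat_term id (fun i => m (C i)) t else 0.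
have /choice[nxt nxtP] : forall p : nat * st, exists q : st,
    [/\ (p.2.2 < q.2)%N, forall i, (i < p.2.2)%N -> q.1 i = p.2.1 i &
     forall S, (forall i, (i < q.2)%N -> S i = q.1 i) -> e / 2 < `|mu S - y p.1|].
  move=> [k [S N]] /=.
  (* Two sets that agree below N and differ by the index N cannot both be close to y k. *)
  have [S' SS' yS'] : exists2 S', (forall i, (i < N)%N -> S' i = S i) &
      e / 2 < `|mu S' - y k|.
    apply: contrapT => nS.
    have small S' : (forall i, (i < N)%N -> S' i = S i) -> `|mu S' - y k| <= e / 2.
      by move=> SS'; rewrite leNgt; apply/negP => ?; apply: nS; exists S'.
    pose S1 i := (i < N)%N && S i; pose S2 i := (i == N) || S1 i.
    have s1 : `|mu S1 - y k| <= e / 2 by apply: small => i iN; rewrite /S1 iN.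
    have s2 : `|mu S2 - y k| <= e / 2.
      by apply: small => i iN; rewrite /S2 /S1 iN ltn_eqF.
    have E : mu S2 = m (C N) + mu S1.
      rewrite -wsaU//; last 2 first.
      - exact: bigcupT_measurable.
      - apply/seteqP; split=> // t [CN [i _]]; rewrite /part /S1.
        case: ifP => // /andP[iN _] Ci; move: iN.
        by rewrite (tC I I (ex_intro _ t (conj Ci CN))) ltnn.
      congr m; apply/seteqP; split=> [t [i _]|t [CN|[i _]]]; rewrite /part /S2.
      - case: eqP => [->|_] /=; first by left.
        by move=> H; right; exists i.
      - by exists N => //; rewrite /part eqxx.
      - by case: ifP => // S1i Ci; exists i => //; rewrite /part /S2 S1i orbT.
    have := nC N; rewrite ltNge => /negP; apply.
    have -> : m (C N) = (mu S2 - y k) - (mu S1 - y k).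
      by rewrite E opprB addrA subrK addrK.
    by apply: le_trans (ler_normB _ _) _; lra.
  have [x x1 xy] := norming_functional (mu S' - y k).
  pose d' := `|mu S' - y k| - e / 2; have d0 : 0 < d' by rewrite subr_gt0.
  have d2 : 0 < d' / 2 by rewrite divr_gt0.
  have [N' HN'] := mu_tail x d2.
  exists (S', (maxn N.+1 N')); split=> //=; first exact: leq_maxl.
  move=> S2 S2S'; have := HN' S' S2 (fun i iN => esym (S2S' i (leq_trans iN (leq_maxr _ _)))).
  move=> /(le_trans (ler_norm _)) H.
  have := x1 (mu S2 - y k) => /(le_trans (ler_norm _)); apply: lt_le_trans.
  by move: xy H d2; rewrite /d' !linearB /=; lra.
pose s := fix s k : st := if k is k'.+1 then nxt (k', s k') else (fun=> false, 0%N).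
have sN k : ((s k).2 < (s k.+1).2)%N by have [] := nxtP (k, s k).
have sk k : (k <= (s k).2)%N by elim: k => // k IH; exact: leq_ltn_trans IH (sN k).
have sst k l i : (k <= l)%N -> (i < (s k).2)%N -> (s l).1 i = (s k).1 i.
  move=> kl ik; rewrite -(subnKC kl); elim: (l - k)%N => [|n IH]; first by rewrite addn0.
  rewrite addnS; have [_ H _] := nxtP ((k + n)%N, s (k + n)%N).
  rewrite -IH; apply: H; apply: (leq_trans ik) => /=.
  elim: n {IH} => [|n IH]; first by rewrite addn0.
  by rewrite addnS; apply: leq_trans IH _; exact: ltnW.
(* the diagonal set: the i-th decision is final from stage i.+1 on *)
pose S i := (s i.+1).1 i.
have Ss k i : (i < (s k).2)%N -> S i = (s k).1 i.
  move=> ik; have [ki|/ltnW ki] := leqP i.+1 k; last exact: sst.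
  by rewrite [RHS](sst i.+1)//; exact: sk.
have far k : e / 2 < `|mu S - y k|.
  by have [_ _] := nxtP (k, s k); apply => i; exact: (Ss k.+1).
have [_ [t _ <-]] := Z_mu S e2.
by have := far (pickle t); rewrite /y pickleK leNgt => ->.
Qed.

End disjoint_sequence.

(** Otherwise some disjoint sets B_i minus A_(n_i) would have values bounded away from
    zero. *)
Lemma wsa_tail (A : (set T)^nat) (e : R) : (forall n, measurable (A n)) ->
  (forall n, A n.+1 `<=` A n) -> \bigcap_n A n = set0 -> 0 < e ->
  exists n, forall B, measurable B -> B `<=` A n -> `|m B| <= e.
Proof.
move=> mA Asub A0 e0; apply: contrapT => /forallNP nA.
have Ale k n : (k <= n)%N -> A n `<=` A k.
  move=> kn; rewrite -(subnKC kn); elim: (n - k)%N => [|j IH]; first by rewrite addn0.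
  by rewrite addnS; apply: subset_trans IH; exact: Asub.
have /choice[p pP] : forall n, exists p : set T * nat, [/\ measurable p.1,
    p.1 `<=` A n, (n < p.2)%N & e / 2 < `|m (p.1 `\` A p.2)|].
  move=> n; have [B /not_implyP[mB /not_implyP[BA /negP]]] :
      exists B, ~ (measurable B -> B `<=` A n -> `|m B| <= e).
    by apply/existsNP; exact: nA.
  rewrite -ltNge => eB; have [x x1 xB] := norming_functional (m B).
  pose F k := B `&` (A (n + k)%N `\` A (n + k).+1).
  have mF k : measurable (F k) by apply: measurableI => //; exact: measurableD.
  have FA k : F k `<=` A (n + k)%N by move=> t [_ []].
  have tF : trivIset setT F.
    apply: ltn_trivIset => i j ji; apply/seteqP; split=> // t [[_ [_ nAj]]] [_ [Ai _]].
    by apply: nAj; apply: Ale Ai; rewrite -addnS leq_add2l.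
  have sF k : \sum_(0 <= i < k) x (m (F i)) = x (m (B `\` A (n + k)%N)).
    elim: k => [|k IH].
      rewrite big_nil addn0 (_ : _ `\` _ = set0) ?wsa0 ?linear0//.
      by apply/seteqP; split=> // t [/BA].
    rewrite big_nat_recr//= IH addnS -linearD -wsaU//.
    - congr (x (m _)); apply/seteqP; split=> [t [[Bt nAt]|[Bt [_ nAt]]]|t [Bt nAt]].
      + by split=> // /Asub.
      + by split.
      + by have [At|nAt'] := pselect (A (n + k)%N t); [right|left].
    - exact: measurableD.
    - by apply/seteqP; split=> // t [[_ nA'] [_ []]].
  have := @wm x _ mF tF; under eq_cvg do rewrite sF.
  have -> : \bigcup_k F k = B.
    apply/seteqP; split=> [t [k _ []]//|t Bt].
    apply: contrapT => nF; have : (\bigcap_n A n) t; last by rewrite A0.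
    have At k : A (n + k)%N t.
      elim: k => [|k IH]; first by rewrite addn0; exact: BA.
      by rewrite addnS; apply: contrapT => nAk; apply: nF; exists k.
    by move=> k _; apply: (Ale _ (n + k)%N) => //; exact: leq_addl.
  rewrite xB => cv; have h : e / 2 < `|m B| by apply: lt_trans eB; lra.
  have [K _ HK] := cvgr_gt _ cv _ h.
  exists (B, (n + K.+1)%N); split=> //=; first by rewrite addnS ltnS leq_addr.
  have := HK K.+1 (leqnSn _) => /= /lt_le_trans; apply.
  exact: le_trans (ler_norm _) (x1 _).
pose s := fix s k := if k is k'.+1 then (p (s k')).2 else 0%N.
have sS k : (s k < s k.+1)%N by have [] := pP (s k).
have sle k j : (k <= j)%N -> (s k <= s j)%N.
  move=> kj; rewrite -(subnKC kj); elim: (j - k)%N => [|i IH]; first by rewrite addn0.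
  by rewrite addnS; apply: leq_trans IH _; exact: ltnW.
pose C k := (p (s k)).1 `\` A (s k.+1).
have mC k : measurable (C k) by apply: measurableD => //; have [] := pP (s k).
have tC : trivIset setT C.
  apply: ltn_trivIset => i j ji; apply/seteqP; split=> // t [[_ nAj] [pi _]].
  have [_ pA _ _] := pP (s i); apply: nAj; apply: (Ale _ (s i)); last exact: pA.
  exact: sle.
have [j] := wsa_disjoint_small mC tC (divr_gt0 e0 (ltr0Sn _ 1)).
by have [_ _ _] := pP (s j); rewrite -/(s j.+1) -/(C j) ltNge => /negP.
Qed.

(** If the values were unbounded on T, T could be cut into two sets with values of
    norm larger than 1, one of which again has unbounded values; iterating gives
    disjoint sets with values of norm larger than 1. *)
Lemma wsa_bounded : exists2 M, 0 < M & forall A, measurable A -> `|m A| <= M.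
Proof.
pose bnd A := exists M, forall B, measurable B -> B `<=` A -> `|m B| <= M.
have [[M HM]|nb] := pselect (bnd setT).
  exists (`|M| + 1); first by rewrite ltr_wpDl.
  by move=> A mA; apply: le_trans (HM A mA _) _ => //; rewrite ler_wpDr// ler_norm.
exfalso.
have /choice[h hP] : forall A, exists A', measurable A -> ~ bnd A ->
    [/\ measurable A', A' `<=` A, ~ bnd A' & 1 < `|m (A `\` A')|].
  move=> A; have [mA|] := pselect (measurable A); last by exists A.
  have [|nbA] := pselect (bnd A); first by exists A.
  move: (nbA) => /forallNP/(_ (1 + `|m A|))/existsNP[B].
  move=> /not_implyP[mB /not_implyP[BA /negP]]; rewrite -ltNge => B1.
  have D1 : 1 < `|m (A `\` B)|.
    rewrite wsaD//; have := ler_normB (m A - m B) (m A).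
    by rewrite addrAC subrr add0r normrN; lra.
  have [[M1 H1]|nbB] := pselect (bnd B); last by exists B.
  exists (A `\` B) => _ _; split=> //.
  - exact: measurableD.
  - move=> [M2 H2]; apply: nbA; exists (M1 + M2) => C mC CA.
    rewrite -(setUIDK C B) wsaU; last 3 first.
    - exact: measurableI.
    - exact: measurableD.
    - by apply/seteqP; split=> // t [[_ ?] [_ ?]].
    apply: le_trans (ler_normD _ _) _; apply: lerD.
      by apply: H1 => //; exact: measurableI.
    by apply: H2; [exact: measurableD|move=> t [/CA]].
  - by rewrite setDD setIidr//; have := normr_ge0 (m A); lra.
pose A := fix A n := if n is n'.+1 then h (A n') else setT.
have AP n : measurable (A n) /\ ~ bnd (A n).
  by elim: n => //= n [mA nA]; have [] := hP _ mA nA.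
have AS n : [/\ measurable (A n.+1), A n.+1 `<=` A n, ~ bnd (A n.+1) &
    1 < `|m (A n `\` A n.+1)|].
  by have [mA nA] := AP n; exact: hP.
have Ale k n : (k <= n)%N -> A n `<=` A k.
  move=> kn; rewrite -(subnKC kn); elim: (n - k)%N => [|j IH]; first by rewrite addn0.
  by rewrite addnS; apply: subset_trans IH; have [] := AS (k + j)%N.
pose C n := A n `\` A n.+1.
have mC n : measurable (C n) by apply: measurableD; apply: (AP _).1.
have tC : trivIset setT C.
  apply: ltn_trivIset => i j ji; apply/seteqP; split=> // t [[_ nAj] [Ai _]].
  by apply: nAj; apply: Ale Ai.
have [j] := wsa_disjoint_small mC tC ltr01.
by have [_ _ _] := AS j; rewrite ltNge => /negP.
Qed.

End weakly_sigma_additive.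

(** * Charges and their variations *)

Section charge.
Context d (T : measurableType d) (R : realType).
Variable mu : {charge set T -> \bar R}.

Lemma variation_lty A : measurable A -> (variation mu A < +oo)%E.
Proof.
move=> mA; rewrite /variation /= /charge_variation lte_add_pinfty//.
  by rewrite -ge0_fin_numE// fin_num_measure.
by rewrite -ge0_fin_numE// fin_num_measure.
Qed.

Lemma hahn_posE : [/\ measurable (hahn_pos mu), measurable (hahn_neg mu) &
  hahn_neg mu = ~` hahn_pos mu].
Proof.
have [[mP _] [mN _] PN PN0] := hahnP mu; split=> //.
apply/seteqP; split=> t; first by move=> Nt Pt; have : set0 t by rewrite -PN0.
by move=> nPt; have : setT t by []; rewrite -PN => -[].
Qed.

Lemma jordan_posI A : measurable A -> jordan_pos (hahnP mu) A = mu (A `&` hahn_pos mu).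
Proof. by move=> mA; rewrite jordan_posE cjordan_posE /crestr0 mem_set. Qed.

Lemma jordan_negI A : measurable A ->
  jordan_neg (hahnP mu) A = (- mu (A `\` hahn_pos mu))%E.
Proof.
move=> mA; have [_ _ E] := hahn_posE.
by rewrite jordan_negE cjordan_negE /crestr0 mem_set// setDE -E.
Qed.

Lemma variationE A : measurable A ->
  (variation mu A = mu (A `&` hahn_pos mu) - mu (A `\` hahn_pos mu))%E.
Proof.
by move=> mA; rewrite /variation /= /charge_variation jordan_posI// jordan_negI.
Qed.

Lemma le_variation A : measurable A -> (`|mu A| <= variation mu A)%E.
Proof. exact: abse_charge_variation. Qed.

(** Variations of different charges are compared by this minimality, without relating
    their Hahn decompositions. *)
Lemma variation_min (m : {measure set T -> \bar R}) :
  (forall B, measurable B -> (`|mu B| <= m B)%E) ->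
  forall A, measurable A -> (variation mu A <= m A)%E.
Proof.
have [mP _ _] := hahn_posE.
move=> H A mA; rewrite variationE// -[in leRHS](setUIDK A (hahn_pos mu)).
rewrite measureU//; last 3 first.
- exact: measurableI.
- exact: measurableD.
- by apply/seteqP; split=> // t [[_ ?] [_ ?]].
apply: leeD.
  by apply: le_trans (lee_abs _) (H _ _); exact: measurableI.
by apply: (le_trans (lee_abs _)); rewrite abseN; apply: H; exact: measurableD.
Qed.

Lemma variation_le_sup A (c : R) : measurable A ->
  (forall B, measurable B -> B `<=` A -> (`|mu B| <= c%:E)%E) ->
  (variation mu A <= (c + c)%:E)%E.
Proof.
have [mP _ _] := hahn_posE.
move=> mA H; rewrite variationE// EFinD; apply: leeD.
  apply: (le_trans (lee_abs _)); apply: H; first exact: measurableI.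
  by move=> t [].
apply: (le_trans (lee_abs _)); rewrite abseN; apply: H.
- exact: measurableD.
- by move=> t [].
Qed.

(** The density of the charge with respect to its variation. *)
Definition charge_sgn (t : T) : R := if t \in hahn_pos mu then 1 else -1.

Lemma charge_sgn_norm t : `|charge_sgn t| = 1.
Proof. by rewrite /charge_sgn; case: ifP; rewrite ?normrN normr1. Qed.

Lemma charge_sgn_sqr t : charge_sgn t * charge_sgn t = 1.
Proof. by rewrite /charge_sgn; case: ifP; rewrite ?mulrNN mulr1. Qed.

Lemma measurable_charge_sgn : measurable_fun setT charge_sgn.
Proof.
have [mP _ _] := hahn_posE.
rewrite (_ : charge_sgn = fun t => \1_(hahn_pos mu) t - \1_(~` hahn_pos mu) t).
  by apply: measurable_funB; apply: measurable_indic => //; exact: measurableC.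
apply/funext => t; rewrite /charge_sgn !indicE in_setC.
by case: (t \in _); rewrite /= ?subr0 ?sub0r.
Qed.

Lemma integrable_sgn A f : measurable A -> (variation mu).-integrable A (EFin \o f) ->
  (variation mu).-integrable A (EFin \o (fun t => f t * charge_sgn t)).
Proof.
move=> mA fi; apply: le_integrable (fi) => //.
  apply/measurable_EFinP; apply: measurable_funM.
    exact/measurable_EFinP/(measurable_int _ fi).
  exact: measurable_funS measurable_charge_sgn.
by move=> t _ /=; rewrite lee_fin normrM charge_sgn_norm mulr1.
Qed.

Lemma integrable_jordan A f : measurable A ->
  (variation mu).-integrable A (EFin \o f) ->
  (jordan_pos (hahnP mu)).-integrable A (EFin \o f) /\
  (jordan_neg (hahnP mu)).-integrable A (EFin \o f).
Proof.
move=> mA /integrableP[mf fi].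
have E : (\int[variation mu]_(x in A) `|(EFin \o f) x| =
  \int[jordan_pos (hahnP mu)]_(x in A) `|(EFin \o f) x| +
  \int[jordan_neg (hahnP mu)]_(x in A) `|(EFin \o f) x|)%E.
  rewrite -ge0_integral_measure_add//; last exact: measurableT_comp.
  by apply: eq_measure_integral => B mB _; exact: (esym (measure_addE _ _ _)).
by split; apply/integrableP; split=> //; apply: le_lt_trans fi; rewrite E;
  [rewrite leeDl|rewrite leeDr]; rewrite ?integral_ge0.
Qed.

(** Integrals against a charge become integrals against one measure; all linearity
    and convergence properties are then those of the integral of measures. *)
Lemma charge_integralE f A : measurable A ->
  (variation mu).-integrable A (EFin \o f) ->
  charge_integral mu A f = \int[variation mu]_(t in A) (f t * charge_sgn t).
Proof.
move=> mA fi; have [mP _ _] := hahn_posE; have [p n] := integrable_jordan mA fi.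
have [ps ns] := integrable_jordan mA (integrable_sgn mA fi).
have Ep : (\int[jordan_pos (hahnP mu)]_(t in A) (f t * charge_sgn t)%:E =
    \int[jordan_pos (hahnP mu)]_(t in A) (f t)%:E)%E.
  apply: ae_eq_integral => //; [exact: (measurable_int _ ps)|exact: (measurable_int _ p)|].
  exists (~` hahn_pos mu); split; first exact: measurableC.
    apply: (etrans (jordan_posI _)); first exact: measurableC.
    by rewrite setICl charge0.
  move=> t /= nt Pt; apply: nt => _; congr EFin.
  by rewrite /charge_sgn mem_set// mulr1.
have En : (\int[jordan_neg (hahnP mu)]_(t in A) (f t * charge_sgn t)%:E =
    \int[jordan_neg (hahnP mu)]_(t in A) (- f t)%:E)%E.
  apply: ae_eq_integral => //; first exact: (measurable_int _ ns).
    apply/measurable_EFinP/measurable_funN/measurable_EFinP.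
    exact: (measurable_int _ n).
  exists (hahn_pos mu); split=> //.
    by apply: (etrans (jordan_negI _)) => //; rewrite setDv charge0 oppe0.
  move=> t /= nt; apply: contrapT => Pt; apply: nt => _; congr EFin.
  by rewrite /charge_sgn memNset// mulrN1.
rewrite /charge_integral {3}/Rintegral.
rewrite (_ : (\int[variation mu]_(t in A) (f t * charge_sgn t)%:E =
  \int[jordan_pos (hahnP mu)]_(t in A) (f t * charge_sgn t)%:E +
  \int[jordan_neg (hahnP mu)]_(t in A) (f t * charge_sgn t)%:E)%E); last first.
  rewrite -(integral_measure_add mA ps ns).
  by apply: eq_measure_integral => B mB _; exact: (esym (measure_addE _ _ _)).
rewrite Ep En (_ : (fun t => (- f t)%:E) = (fun t => (-1 * f t)%:E)); last first.
  by apply/funext => t; rewrite mulN1r.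
rewrite fineD; last 2 first.
- exact: integrable_fin_num.
- under eq_integral do rewrite EFinM.
  rewrite integralZl// mulN1e fin_numN; exact: integrable_fin_num.
congr (_ + _); rewrite -/(Rintegral _ _ (fun t => -1 * f t)) RintegralZl//.
by rewrite mulN1r.
Qed.

Lemma charge_integral_indic A : measurable A ->
  fine (mu A) = \int[variation mu]_(t in A) (charge_sgn t).
Proof.
move=> mA; transitivity (charge_integral mu A (cst 1)).
  rewrite /charge_integral !Rintegral_cst// !mul1r.
  rewrite [X in fine X - _](jordan_posI mA) [X in _ - fine X](jordan_negI mA).
  have [mP _ _] := hahn_posE.
  rewrite -[in LHS](setUIDK A (hahn_pos mu)) chargeU//.
  - by rewrite fineD ?fineN ?opprK// fin_num_measure//;
      [exact: measurableI|exact: measurableD].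
  - exact: measurableI.
  - exact: measurableD.
  - by apply/seteqP; split=> // t [[_ ?] [_ ?]].
rewrite charge_integralE//; last first.
  apply: measurable_bounded_integrable => //; first exact: variation_lty.
  by exists 1; split=> // r r1 t _ /=; rewrite normr1 ltW.
by under eq_Rintegral do rewrite mul1r.
Qed.

End charge.

(** * Control measures *)

Section vector_measure_variation.
Context d (T : measurableType d) (R : realType) (X : completeNormedModType R).
Variable nu : vector_measure T X.
Local Notation V x := (variation (scalarization nu x)).
Local Notation ball := (@dual_unit_ball R X).

Lemma vector_measure_wsa : weakly_sigma_additive (nu : set T -> X).
Proof.
move=> x F mF tF.
have -> : (fun n => \sum_(0 <= i < n) x (nu (F i))) =
    x \o (fun n => \sum_(0 <= i < n) nu (F i)).
  by apply/funext => n; rewrite /= linear_sum.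
apply: continuous_cvg; first exact: dual_continuous.
exact: vector_measure_sigma_additive.
Qed.

(** The variations are controlled by the norms of the values on subsets, up to a
    factor 2 that comes from the Hahn decomposition. *)
Lemma scalarization_variation_le A (c : R) : measurable A ->
  (forall B, measurable B -> B `<=` A -> `|nu B| <= c) ->
  forall x, ball x -> (V x A <= (c + c)%:E)%E.
Proof.
move=> mA H x x1; apply: variation_le_sup => // B mB BA.
by rewrite /scalarization lee_fin; apply: le_trans (x1 _) (H _ mB BA).
Qed.

Lemma norm_le_variation A (c : R) : measurable A ->
  (forall x, ball x -> (V x A <= c%:E)%E) -> `|nu A| <= c.
Proof.
move=> mA H; apply: norm_le_dual => x x1; rewrite -lee_fin.
exact: le_trans (le_variation (scalarization nu x) mA) (H x x1).
Qed.

Lemma semivariation_tail (A : (set T)^nat) (e : R) :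
  (forall n, measurable (A n)) -> (forall n, A n.+1 `<=` A n) ->
  \bigcap_n A n = set0 -> 0 < e ->
  exists n, forall x, ball x -> (V x (A n) <= e%:E)%E.
Proof.
move=> mA As A0 e0; have e2 : 0 < e / 2 by rewrite divr_gt0.
have [n nA] := wsa_tail vector_measure_wsa mA As A0 e2.
by exists n => x x1; rewrite [e]splitr; exact: scalarization_variation_le.
Qed.

Lemma semivariation_bounded : exists2 M : R, 0 < M &
  forall x, ball x -> forall A, measurable A -> (V x A <= M%:E)%E.
Proof.
have [M M0 HM] := wsa_bounded vector_measure_wsa.
exists (M + M); first by rewrite addr_gt0.
by move=> x x1 A mA; apply: scalarization_variation_le => // B mB _; exact: HM.
Qed.

Lemma dual_unit_ball_neq0 : exists x : dual X, ball x.
Proof. by have [x x1 _] := norming_functional (0 : X); exists x. Qed.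

(** Otherwise there would be functionals Y_k and sets A_k with |Y_k nu|(A_k) > e
    whereas |Y_i nu|(A_k) is less than 2^-(k+1) for i < k. The limit superior L of the
    A_k is then null for all Y_i, by Borel-Cantelli, and the unions of the A_k \ L
    with k >= n decrease to the empty set, so that their semivariation tends to
    zero: a contradiction. *)
Lemma semivariation_control (e : R) : 0 < e ->
  exists (xs : (dual X)^nat) n (del : R), [/\ forall i, ball (xs i), 0 < del &
    forall A, measurable A -> (forall i, (i < n)%N -> (V (xs i) A < del%:E)%E) ->
      forall x, ball x -> (V x A <= e%:E)%E].
Proof.
move=> e0; apply: contrapT => nC; have [x0 x01] := dual_unit_ball_neq0.
have /choice[c cP] : forall s : seq (dual X), exists p : set T * dual X,
    (forall i, ball (nth x0 s i)) ->
    [/\ measurable p.1, ball p.2, (e%:E < V p.2 p.1)%E & forall i, (i < size s)%N ->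
      (V (nth x0 s i) p.1 < (1 / (2 ^ (size s).+1)%:R)%:E)%E].
  move=> s; have [s1|ns] := pselect (forall i, ball (nth x0 s i)); last by exists (set0, x0).
  apply: contrapT => /forallNP H; apply: nC.
  exists (nth x0 s), (size s), (1 / (2 ^ (size s).+1)%:R); split=> //.
  move=> A mA sA x x1; rewrite leNgt; apply/negP => xA.
  by apply: (H (A, x)) => _; split.
pose s := fix s k := if k is k'.+1 then rcons (s k') (c (s k')).2 else [::].
have szs k : size (s k) = k by elim: k => //= k IH; rewrite size_rcons IH.
have sball k i : ball (nth x0 (s k) i).
  elim: k i => [|k IH] i /=; first by rewrite nth_nil.
  rewrite nth_rcons; case: ltnP => // _; case: eqP => // _.
  by have [] := cP _ IH.
pose Y k := (c (s k)).2; pose A k := (c (s k)).1.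
have sY k i : (i < k)%N -> nth x0 (s k) i = Y i.
  elim: k => // k IH; rewrite ltnS leq_eqVlt /= nth_rcons szs.
  by move=> /predU1P[->|ik]; [rewrite ltnn eqxx|rewrite ik IH].
have AP k : [/\ measurable (A k), ball (Y k), (e%:E < V (Y k) (A k))%E & forall i, (i < k)%N ->
      (V (Y i) (A k) < (1 / (2 ^ k.+1)%:R)%:E)%E].
  have [mA Y1 eA H] := cP (s k) (sball k); split=> // i ik.
  by have := H i; rewrite szs sY//; exact.
have mA k : measurable (A k) by have [] := AP k.
have [M M0 HM] := semivariation_bounded.
pose L := lim_sup_set A.
have mL : measurable L.
  by apply: bigcap_measurable => // k _; exact: bigcup_measurable.
(* For n <= i only the bound M is available; the factor 2 ^ i.+1 absorbs it. *)
have VL i : V (Y i) L = 0%E.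
  apply: lim_sup_set_cvg0 => //.
  apply: (@le_lt_trans _ _ (\sum_(n <oo) ((M * (2 ^ i.+1)%:R + 1) / (2 ^ n.+1)%:R)%:E)%E); last first.
    apply: le_lt_trans (epsilon_trick0 _ _) _; last exact: ltry.
    by rewrite addr_ge0// mulr_ge0// ltW.
  apply: lee_nneseries => // n _.
  have [ni|ni] := leqP n i.
    have [_ Y1 _ _] := AP i; apply: le_trans (HM _ Y1 _ (mA n)) _.
    rewrite lee_fin ler_pdivlMr ?ltr0n ?expn_gt0//.
    by rewrite ler_wpDr// ler_pM2l// ler_nat leq_exp2l// ltnS.
  have [_ _ _ H] := AP n; apply: (le_trans (ltW (H _ ni))).
  by rewrite lee_fin ler_wpM2r// lerDr mulr_ge0// ltW.
pose B n := \bigcup_(k >= n) A k `\` L.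
have mB n : measurable (B n).
  by apply: measurableD => //; exact: bigcup_measurable.
have [||n HB] := semivariation_tail mB _ _ e0.
- by move=> n t [[k /= nk Ak] nL]; split=> //; exists k => //=; exact: ltnW.
- apply/seteqP; split=> // t HB; have [_ nL] := HB 0%N I; apply: nL.
  by move=> n _; have [] := HB n I.
have [_ Y1 eA _] := AP n.
have := HB _ Y1; apply/negP; rewrite -ltNge; apply: lt_le_trans eA _.
have BL : A n `<=` B n `|` L.
  move=> t At; have [Lt|nL] := pselect (L t); [by right|left; split=> //].
  by exists n => /=.
apply: le_trans (le_measure _ _ _ BL) _; rewrite ?inE//; first exact: measurableU.
apply: le_trans (measureU2 _ _ _) _ => //.
rewrite -[leRHS]adde0; apply: leeD => //; by rewrite -(VL n).
Qed.

(** The sum, with summable weights, of the variations of the functionals that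
    control the semivariation up to 1 / (k + 1), for all k. *)
Lemma control_measure : exists la : {finite_measure set T -> \bar R},
  (forall A, vnull nu A -> la A = 0%E) /\
  (forall e : R, 0 < e -> exists2 del : R, 0 < del &
    forall A, measurable A -> (la A < del%:E)%E ->
      forall x, ball x -> (V x A <= e%:E)%E).
Proof.
have [M M0 HM] := semivariation_bounded.
have /choice[C CP] : forall k : nat, exists p : (dual X)^nat * nat * R,
    [/\ forall i, ball (p.1.1 i), 0 < p.2 &
    forall A, measurable A -> (forall i, (i < p.1.2)%N -> (V (p.1.1 i) A < p.2%:E)%E) ->
      forall x, ball x -> (V x A <= k.+1%:R^-1%:E)%E].
  move=> k; have [|xs [n [del H]]] := @semivariation_control k.+1%:R^-1; first by [].
  by exists (xs, n, del).
(* enumerates the functionals that occur for all k *)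
pose y j : dual X := if unpickle j is Some (k, i) then (C k).1.1 i else (C 0%N).1.1 0%N.
have yball j : ball (y j).
  rewrite /y; case: unpickle => [[k i]|]; first by have [+ _ _] := CP k; exact.
  by have [+ _ _] := CP 0%N; exact.
have w0 j : 0 <= 1 / (2 ^ j.+1)%:R :> R by [].
pose m j : {measure set T -> \bar R} := mscale (NngNum (w0 j)) (V (y j)).
pose la0 : {measure set T -> \bar R} := mseries m 0.
have la_fin : fin_num_fun la0.
  move=> A mA; rewrite ge0_fin_numE//.
  apply: (@le_lt_trans _ _ (\sum_(j <oo) (M / (2 ^ j.+1)%:R)%:E)%E).
    apply: lee_nneseries => // j _.
    have -> : m j A = ((1 / (2 ^ j.+1)%:R)%:E * V (y j) A)%E by [].
    rewrite [X in (_ <= X%:E)%E](_ : _ = 1 / (2 ^ j.+1)%:R * M); last by rewrite mul1r mulrC.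
    by rewrite [leRHS]EFinM lee_wpmul2l//; exact: HM.
  by apply: le_lt_trans (epsilon_trick0 _ (ltW M0)) _; exact: ltry.
pose la : {finite_measure set T -> \bar R} := HB.pack_for {finite_measure set T -> \bar R}
  (mseries m 0) (Measure_isFinite.Build _ _ _ (mseries m 0) la_fin).
exists la; split.
  move=> A [mA A0]; rewrite /la /= /mseries; apply: eseries0 => j _ _.
  have -> : m j A = ((1 / (2 ^ j.+1)%:R)%:E * V (y j) A)%E by [].
  have -> : V (y j) A = 0%E; last by rewrite mule0.
  apply: variation_null => // B mB BA.
  by rewrite -[LHS]/((y j (nu B) : R)%:E) A0// linear0.
have laV j A : measurable A -> ((1 / (2 ^ j.+1)%:R)%:E * V (y j) A <= la A)%E.
  move=> mA; rewrite /la /= /mseries.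
  apply: le_trans (nneseries_lim_ge j.+1 _); last by [].
  rewrite big_nat_recr//= leeDr// sume_ge0// => i _; exact: measure_ge0.
move=> e e0; have [k ke] : exists k : nat, k.+1%:R^-1 <= e.
  have [k _ H] := near_infty_natSinv_lt (PosNum e0).
  by exists k; apply: ltW; apply: H => /=.
have [xb d0 H] := CP k; set n := (C k).1.2 in H.
pose w (i : nat) : R := 1 / (2 ^ (pickle (k, i)).+1)%:R.
have w1 i : 0 < w i <= 1.
  rewrite divr_gt0 ?ltr0n ?expn_gt0//= ler_pdivrMr ?ltr0n ?expn_gt0// mul1r.
  by rewrite ler1n expn_gt0.
exists ((C k).2 * \prod_(i < n) w i).
  by rewrite mulr_gt0// prodr_gt0// => i _; have /andP[] := w1 i.
move=> A mA lad x x1; apply: (@le_trans _ _ (k.+1%:R^-1%:E)); last by rewrite lee_fin.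
apply: H => // i ilt; have /andP[wi0 _] := w1 i.
have := laV (pickle (k, i)) A mA; rewrite /y pickleK -/(w i) => /le_lt_trans/(_ lad).
rewrite (bigD1 (Ordinal ilt))//= mulrCA [ltRHS]EFinM lte_pmul2l ?lte_fin//.
move=> /lt_le_trans; apply; rewrite lee_fin ler_piMr ?(ltW d0)//.
apply: prodr_ile1 => j _; have /andP[wj0 wj1] := w1 j; by rewrite ltW.
Qed.

End vector_measure_variation.

(** * The norm of L1 and limits of integrable functions *)

Lemma Rintegral_sigma_additive d (T : measurableType d) (R : realType)
    (mu : {measure set T -> \bar R}) (f : T -> R) (F : (set T)^nat) :
  mu.-integrable setT (EFin \o f) -> (forall n, measurable (F n)) ->
  trivIset setT F ->
  (fun n => \sum_(0 <= i < n) \int[mu]_(t in F i) f t) @ \oo -->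
    \int[mu]_(t in \bigcup_n F n) f t.
Proof.
move=> fi mF tF; have mU : measurable (\bigcup_n F n) by exact: bigcupT_measurable.
have cv : (fun n => \sum_(0 <= i < n) induced_charge fi (F i))%E @ \oo -->
    induced_charge fi (\bigcup_n F n).
  exact: (@charge_semi_sigma_additive _ _ _ (induced_charge fi) F mF tF mU).
have E A : measurable A -> induced_charge fi A = (\int[mu]_(t in A) f t)%:E.
  move=> mA; rewrite /Rintegral fineK//; apply: integrable_fin_num => //.
  exact: integrableS (fi).
move: cv; rewrite E// (_ : (fun n => _) = EFin \o
  (fun n => \sum_(0 <= i < n) \int[mu]_(t in F i) f t)).
  by move/fine_cvgP => [_]; rewrite /=; under eq_cvg do rewrite /=.
by apply/funext => n /=; rewrite -sumEFin; apply: eq_bigr => i _; rewrite E.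
Qed.

Lemma integral_bound_fin d (T : measurableType d) (R : realType)
    (mu : {measure set T -> \bar R}) (f : T -> R) (A : set T) (c : R) :
  (mu setT < +oo)%E -> measurable A -> measurable_fun setT f ->
  (forall t, `|f t| <= c) -> mu.-integrable A (EFin \o f).
Proof.
move=> mufin mA mf fc; apply: (@integrableS _ _ _ _ setT) => //.
apply: measurable_bounded_integrable => //.
exists c; split; [exact: num_real|move=> r cr t _ /=]; apply: le_trans (fc t) (ltW cr).
Qed.

(** Rounding s down to a multiple of e, by counting the multiples of e that do not
    exceed s: the rounded function is a combination of indicators. *)
Lemma step_approx (R : realType) (e s : R) (N : nat) : 0 < e -> 0 <= s ->
  s <= N%:R * e ->
  `|s - e * \sum_(k < N) (k.+1%:R * e <= s)%R%:R| <= e.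
Proof.
move=> e0 s0 sN; pose S n := e * \sum_(k < n) (k.+1%:R * e <= s)%R%:R.
have H n : (n%:R * e <= s -> S n = n%:R * e) /\
    (s <= n%:R * e -> s - e <= S n /\ S n <= s).
  elim: n => [|n [IH1 IH2]].
    rewrite /S big_ord0 mulr0 mul0r; split=> // s0'; split; lra.
  have SS : S n.+1 = S n + e * (n.+1%:R * e <= s)%R%:R by rewrite /S big_ord_recr/= mulrDr.
  rewrite SS -natr1 mulrDl mul1r; split=> h.
    by rewrite IH1; [rewrite h mulr1|lra].
  have [h'|h'] := lerP (n%:R * e + e) s.
    have -> : s = n%:R * e + e by lra.
    by rewrite IH1; [rewrite mulr1; split; lra|lra].
  rewrite mulr0 addr0; have [h2|/ltW h2] := lerP (n%:R * e) s; last exact: IH2.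
  by rewrite IH1//; split; lra.
have [_ /(_ sN)[h1 h2]] := H N; rewrite ler_norml; apply/andP.
rewrite /S in h1 h2; split; lra.
Qed.

Section L1norm.
Context d (T : measurableType d) (R : realType) (X : completeNormedModType R).
Variable nu : vector_measure T X.
Implicit Types f g : T -> R.
Local Notation V x := (variation (scalarization nu x)).
Local Notation ball := (@dual_unit_ball R X).

Let mnorm f : measurable_fun setT f ->
  measurable_fun setT (fun t : T => `|f t|%:E).
Proof. by move=> mf; apply/measurable_EFinP; exact: measurableT_comp. Qed.

Lemma L1norm_leP f c : (L1norm nu f <= c)%E <->
  (forall x, ball x -> (\int[V x]_t `|f t|%:E <= c)%E).
Proof.
split=> [H x x1|H]; last by apply: ge_ereal_sup => _ [x x1 <-]; exact: H.
by apply: le_trans H; apply: ereal_sup_ubound; exists x.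
Qed.

Lemma L1norm_ge0 f : (0 <= L1norm nu f)%E.
Proof.
have [x x1] := dual_unit_ball_neq0 X; apply: le_trans (_ : (\int[V x]_t `|f t|%:E <= _)%E).
  exact: integral_ge0.
by have [+ _] := L1norm_leP f (L1norm nu f); exact.
Qed.

Lemma L1norm_mono f g : measurable_fun setT f -> measurable_fun setT g ->
  (forall t, `|f t| <= `|g t|) -> (L1norm nu f <= L1norm nu g)%E.
Proof.
move=> mf mg fg; apply/L1norm_leP => x x1.
apply: (@le_trans _ _ (\int[V x]_t `|g t|%:E)%E).
  by apply: ge0_le_integral => //; [exact: mnorm..|move=> t _; rewrite lee_fin].
by have [+ _] := L1norm_leP g (L1norm nu g); exact.
Qed.

Lemma L1normZ_le (c : R) f : measurable_fun setT f ->
  (L1norm nu (fun t => c * f t)%R <= `|c|%:E * L1norm nu f)%E.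
Proof.
move=> mf; apply/L1norm_leP => x x1.
under eq_integral do rewrite normrM EFinM.
rewrite ge0_integralZl//; last exact: mnorm.
apply: lee_wpmul2l => //.
by have [+ _] := L1norm_leP f (L1norm nu f); exact.
Qed.

Lemma L1norm_bounded : exists2 M : R, 0 < M & forall c f, 0 <= c ->
  measurable_fun setT f -> (forall t, `|f t| <= c) ->
  (L1norm nu f <= (c * M)%:E)%E.
Proof.
have [M M0 HM] := semivariation_bounded nu; exists M => // c f c0 mf fc.
apply/L1norm_leP => x x1.
apply: (@le_trans _ _ (\int[V x]_t (cst c%:E) t)%E).
  by apply: ge0_le_integral => //; [exact: mnorm|move=> t _; rewrite lee_fin].
by rewrite integral_cst// EFinM lee_wpmul2l//; exact: HM.
Qed.

(** Functionals outside of the unit ball are handled by scaling; no Hahn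
    decompositions need to be compared, since variations are minimal. *)
Lemma variation_scaled (x y : dual X) (c : R) f : 0 < c -> (forall v, x v = c * y v) ->
  measurable_fun setT f ->
  (\int[V x]_t `|f t|%:E <= c%:E * \int[V y]_t `|f t|%:E)%E.
Proof.
move=> c0 xy mf; have c0' := ltW c0.
rewrite -(@ge0_integral_mscale _ _ _ (V y) setT measurableT (NngNum c0') _ (mnorm mf))//.
apply: ge0_le_measure_integral => //; last exact: mnorm.
move=> A mA; apply: variation_min => // B mB.
suff : (`|scalarization nu x B| <= c%:E * V y B)%E by [].
have E : scalarization nu x B = (c%:E * scalarization nu y B)%E.
  by rewrite /scalarization xy.
rewrite E abseM gee0_abs//; apply: lee_wpmul2l => //.
exact: (le_variation (scalarization nu y) mB).
Qed.

Lemma L1norm_integrable f : measurable_fun setT f -> (L1norm nu f < +oo)%E ->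
  forall x, (V x).-integrable setT (EFin \o f).
Proof.
move=> mf fi x; apply/integrableP; split; first exact/measurable_EFinP.
have [c c0 [y y1 xy]] := dual_scaled x.
apply: le_lt_trans (variation_scaled c0 xy mf) _.
rewrite lte_mul_pinfty ?lee_fin ?(ltW c0)//; apply: le_lt_trans fi.
by have [+ _] := L1norm_leP f (L1norm nu f); exact.
Qed.

Lemma charge_integral_dist (x : dual X) f g A : measurable A ->
  (V x).-integrable setT (EFin \o f) -> (V x).-integrable setT (EFin \o g) ->
  (`|charge_integral (scalarization nu x) A f -
    charge_integral (scalarization nu x) A g|%:E <= \int[V x]_t `|(f t - g t)%R|%:E)%E.
Proof.
move=> mA fi gi.
have fA : (V x).-integrable A (EFin \o f) by exact: integrableS fi.
have gA : (V x).-integrable A (EFin \o g) by exact: integrableS gi.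
rewrite !charge_integralE// -RintegralB//; [|exact: integrable_sgn..].
have fgi : (V x).-integrable A (EFin \o (fun t => f t - g t)).
  by have := integrableB mA fA gA; apply: eq_integrable => // t _.
have E : (fun t => f t * charge_sgn (scalarization nu x) t -
    g t * charge_sgn (scalarization nu x) t) =
    (fun t => (f t - g t) * charge_sgn (scalarization nu x) t).
  by apply/funext => t; rewrite mulrBl.
rewrite E; have si := integrable_sgn mA fgi.
rewrite EFin_normr_Rintegral//.
apply: le_trans (le_abse_integral _ mA (measurable_int _ si)) _.
have mfg : measurable_fun setT (fun t => f t - g t).
  by apply: measurable_funB; apply/measurable_EFinP; apply: measurable_int; eassumption.
under eq_integral do rewrite /= normrM charge_sgn_norm mulr1.
by apply: ge0_subset_integral => //; exact: mnorm.
Qed.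

(** The integrals of the approximating functions over A form a Cauchy sequence in X. *)
Lemma vintegrable_lim f : measurable_fun setT f ->
  (forall e : R, 0 < e -> exists2 g, vintegrable nu g &
     (L1norm nu (fun t => f t - g t)%R <= e%:E)%E) ->
  vintegrable nu f.
Proof.
move=> mf fg.
have fi x : (V x).-integrable setT (EFin \o f).
  have [g [mg gi _] fg1] := fg 1 ltr01.
  have : (V x).-integrable setT (EFin \o (fun t => f t - g t)).
    apply: L1norm_integrable; first exact: measurable_funB.
    by apply: le_lt_trans fg1 _; exact: ltry.
  move=> fgi; have := integrableD measurableT fgi (gi x); apply: eq_integrable => // t _ /=.
  by rewrite -EFinD subrK.
split=> // A mA.
have /choice[g gP] : forall n : nat, exists g, vintegrable nu g /\
    (L1norm nu (fun t => f t - g t)%R <= n.+1%:R^-1%:E)%E.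
  by move=> n; have [|g gi fgn] := fg n.+1%:R^-1; [by []|exists g].
have /choice[v vP] : forall n, exists v : X, forall x : dual X,
    x v = charge_integral (scalarization nu x) A (g n).
  by move=> n; have [[_ _ H] _] := gP n; exact: H.
have dist (x : dual X) (c : R) (y : dual X) :
    0 < c -> ball y -> (forall v, x v = c * y v) -> forall n,
    `|charge_integral (scalarization nu x) A f - x (v n)| <= c * n.+1%:R^-1.
  move=> c0 y1 xy n; have [[mg gi _] fgn] := gP n; rewrite vP -lee_fin.
  apply: le_trans (charge_integral_dist mA (fi x) (gi x)) _.
  apply: le_trans (variation_scaled c0 xy (measurable_funB mf mg)) _.
  rewrite EFinM lee_wpmul2l ?lee_fin ?(ltW c0)//.
  by have [H _] := L1norm_leP (fun t => f t - g n t) (n.+1%:R^-1)%:E; exact: (H fgn y y1).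
have dist1 (x : dual X) : ball x -> forall n,
    `|charge_integral (scalarization nu x) A f - x (v n)| <= n.+1%:R^-1.
  by move=> x1 n; rewrite -[leRHS]mul1r; apply: dist x1 _ n => // w; rewrite mul1r.
have vc : cvg (v @ \oo).
  apply: cauchy_cvg; apply/cauchy_ballP => e e0.
  have e2 : 0 < e / 2 by rewrite divr_gt0.
  have [k _ ke] := near_infty_natSinv_lt (PosNum e2).
  rewrite near_map2; near=> m n; rewrite -ball_normE /ball_/=.
  have km : (k <= m)%N by near: m; exists k.
  have kn : (k <= n)%N by near: n; exists k.
  apply: (@le_lt_trans _ _ (m.+1%:R^-1 + n.+1%:R^-1)); last first.
    by rewrite [e]splitr; apply: ltrD; apply: ke.
  apply: norm_le_dual => x x1; rewrite linearB /=.
  rewrite -(subrKA (charge_integral (scalarization nu x) A f)).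
  by apply: le_trans (ler_normD _ _) _; apply: lerD; [rewrite distrC|]; exact: dist1.
exists (lim (v @ \oo)) => x.
have [c c0 [y y1 xy]] := dual_scaled x.
have cv : (fun n => x (v n)) @ \oo --> x (lim (v @ \oo)).
  by apply: continuous_cvg => //; exact: dual_continuous.
apply: (@cvg_unique _ (@norm_hausdorff _ R^o) _ _ _ _ cv).
apply/cvgrPdist_le => e e0; have ec : 0 < e / c by rewrite divr_gt0.
have [k _ ke] := near_infty_natSinv_lt (PosNum ec).
near=> n; have kn : (k <= n)%N by near: n; exists k.
apply: le_trans (dist x c y c0 y1 xy n) _.
have /ltW := ke n kn; rewrite /= ler_pdivlMr//; by rewrite mulrC.
Unshelve. all: by end_near. Qed.

End L1norm.

(** * Integrability and dense classes of functions *)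

Section integrability.
Context d (T : measurableType d) (R : realType) (X : completeNormedModType R).
Variable nu : vector_measure T X.
Implicit Types f g : T -> R.
Local Notation V x := (variation (scalarization nu x)).
Local Notation ball := (@dual_unit_ball R X).

Lemma vintegrable_indic B : measurable B -> vintegrable nu (\1_B : T -> R).
Proof.
move=> mB; have mf : measurable_fun setT (\1_B : T -> R) by exact: measurable_indic.
have fi x A : measurable A -> (V x).-integrable A (EFin \o (\1_B : T -> R)).
  move=> mA; apply: (@integral_bound_fin _ _ _ _ _ _ 1) => //.
    exact: variation_lty.
  by move=> t; rewrite indicE; case: (t \in B); rewrite /= ?normr1 ?normr0.
split=> // [x|A mA]; first exact: fi.
exists (nu (A `&` B)) => x; rewrite charge_integralE//; last exact: fi.
have := charge_integral_indic (scalarization nu x) (measurableI _ _ mA mB).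
rewrite /= => ->; rewrite setIC Rintegral_mkcondl; apply: eq_Rintegral => t _.
by rewrite patchE indicE; case: (t \in B); rewrite ?mul1r ?mul0r.
Qed.

Lemma vintegrableD f g : vintegrable nu f -> vintegrable nu g ->
  vintegrable nu (fun t => f t + g t).
Proof.
move=> [mf fi fv] [mg gi gv].
have fgi x : (V x).-integrable setT (EFin \o (fun t => f t + g t)).
  by have := integrableD measurableT (fi x) (gi x); apply: eq_integrable => // t _.
split=> // [|A mA]; first exact: measurable_funD.
have [v vP] := fv A mA; have [w wP] := gv A mA; exists (v + w) => x.
have iA h : (V x).-integrable setT (EFin \o h) -> (V x).-integrable A (EFin \o h).
  by move=> hi; exact: integrableS hi.
rewrite linearD /= vP wP !charge_integralE//; [|exact: iA..].
rewrite -RintegralD//; [|exact: integrable_sgn (iA _ _)..].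
by apply: eq_Rintegral => t _; rewrite mulrDl.
Qed.

Lemma vintegrableZ (c : R) f : vintegrable nu f -> vintegrable nu (fun t => c * f t).
Proof.
move=> [mf fi fv].
have cfi x : (V x).-integrable setT (EFin \o (fun t => c * f t)).
  by have := integrableZl measurableT c (fi x); apply: eq_integrable => // t _.
split=> // [|A mA]; first exact: measurable_funM.
have [v vP] := fv A mA; exists (c *: v) => x.
have iA h : (V x).-integrable setT (EFin \o h) -> (V x).-integrable A (EFin \o h).
  by move=> hi; exact: integrableS hi.
rewrite linearZ /= vP !charge_integralE//; [|exact: iA..].
rewrite -[_ *: _]/(_ * _) -RintegralZl//; last exact: integrable_sgn (iA _ _).
by apply: eq_Rintegral => t _; rewrite mulrA.
Qed.

Lemma vintegrable_measurable f : vintegrable nu f -> measurable_fun setT f.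
Proof. by case. Qed.

Definition L1_approx (W : set (T -> R)) f := forall e : R, 0 < e ->
  exists2 w, W w & (L1norm nu (fun t => f t - w t)%R <= e%:E)%E.

Section dense_class.
Variable W : set (T -> R).
Hypothesis mW : forall w, W w -> measurable_fun setT w.
Hypothesis W0 : W (fun=> 0).
Hypothesis WD : forall u v, W u -> W v -> W (fun t => u t + v t).
Hypothesis WZ : forall (q : rat) u, W u -> W (fun t => ratr q * u t).
Hypothesis WI : forall B, measurable B -> L1_approx W (\1_B).

Lemma L1_approx0 : L1_approx W (fun=> 0).
Proof.
move=> e e0; exists (fun=> 0) => //; apply: le_trans (_ : (_ <= 0)%E) _.
  by apply: L1norm0 => t; rewrite subrr.
by rewrite lee_fin ltW.
Qed.

Lemma L1_approxD f g : measurable_fun setT f -> measurable_fun setT g ->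
  L1_approx W f -> L1_approx W g -> L1_approx W (fun t => f t + g t).
Proof.
move=> mf mg fW gW e e0; have e2 : 0 < e / 2 by rewrite divr_gt0.
have [u Wu fu] := fW _ e2; have [v Wv gv] := gW _ e2.
exists (fun t => u t + v t); first exact: WD.
rewrite (_ : (fun t => _) = (fun t => (f t - u t) + (g t - v t))); last first.
  by apply/funext => t; rewrite opprD addrACA.
apply: le_trans (L1normD _ _ _) _; [apply: measurable_funB => //; exact: mW..|].
by rewrite [e]splitr EFinD leeD.
Qed.

Lemma L1_approxZ (q : rat) f : measurable_fun setT f ->
  L1_approx W f -> L1_approx W (fun t => ratr q * f t).
Proof.
move=> mf fW e e0; have q1 : 0 < `|ratr q : R| + 1 by rewrite ltr_wpDl.
have [u Wu fu] := fW _ (divr_gt0 e0 q1).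
exists (fun t => ratr q * u t); first exact: WZ.
rewrite (_ : (fun t => _) = (fun t => ratr q * (f t - u t))); last first.
  by apply/funext => t; rewrite mulrBr.
apply: le_trans (L1normZ_le _ _ _) _; first by apply: measurable_funB => //; exact: mW.
apply: (@le_trans _ _ (`|ratr q : R|%:E * (e / (`|ratr q : R| + 1))%:E)%E).
  by rewrite lee_wpmul2l.
rewrite -EFinM lee_fin mulrCA ler_piMr ?(ltW e0)// ler_pdivrMr// mul1r lerDl//.
Qed.

Lemma L1_approx_trans f : measurable_fun setT f ->
  (forall e : R, 0 < e -> exists2 g, measurable_fun setT g /\ L1_approx W g &
     (L1norm nu (fun t => f t - g t)%R <= e%:E)%E) -> L1_approx W f.
Proof.
move=> mf H e e0; have e2 : 0 < e / 2 by rewrite divr_gt0.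
have [g [mg gW] fg] := H _ e2; have [w Ww gw] := gW _ e2; exists w => //.
rewrite (_ : (fun t => _) = (fun t => (f t - g t) + (g t - w t))); last first.
  by apply/funext => t; rewrite subrKA.
apply: le_trans (L1normD _ _ _) _; [exact: measurable_funB| |].
  by apply: measurable_funB => //; exact: mW.
by rewrite [e]splitr EFinD leeD.
Qed.

(** Bounded functions are uniform limits of rational combinations of indicators. *)
Lemma L1_approx_bounded f (c : R) : measurable_fun setT f ->
  (forall t, `|f t| <= c) -> L1_approx W f.
Proof.
move=> mf fc; apply: L1_approx_trans => // e e0.
have [M M0 HM] := L1norm_bounded nu.
have [k _ ke] := near_infty_natSinv_lt (PosNum (divr_gt0 e0 M0)).
pose q : rat := k.+1%:R^-1; have qE : ratr q = k.+1%:R^-1 :> R by rewrite /q fmorphV rmorph_nat.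
have q0 : 0 < k.+1%:R^-1 :> R by rewrite invr_gt0 ltr0n.
pose a := `|c|; pose n := (Num.truncn `|c|).+1.
have cn : `|c| <= n%:R by rewrite ltW// Num.Theory.truncnS_gt.
pose N := (n.*2 * k.+1)%N.
pose S (i : nat) := [set t | i.+1%:R * k.+1%:R^-1 <= f t + n%:R].
pose sumS m t : R := \sum_(i < m) \1_(S i) t.
pose g t := ratr (- n%:R) * \1_setT t + ratr q * sumS N t.
have mS i : measurable (S i).
  rewrite (_ : S i = (fun t => f t + n%:R) @^-1` `[i.+1%:R * k.+1%:R^-1, +oo[%classic).
    by rewrite -[_ @^-1` _]setTI; apply: measurable_funD.
  by apply/seteqP; split=> t /=; rewrite in_itv/= andbT.
have mI i : measurable_fun setT (\1_(S i) : T -> R) by exact: measurable_indic.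
have msum m : measurable_fun setT (sumS m) by exact: measurable_sum.
have m1 : measurable_fun setT (\1_setT : T -> R) by exact: measurable_indic.
exists g.
  split; first by apply: measurable_funD; apply: measurable_funM.
  apply: L1_approxD; [exact: measurable_funM..| |].
    by apply: L1_approxZ => //; exact: WI.
  apply: L1_approxZ => //; elim: N {g} => [|m IH].
    rewrite (_ : sumS 0%N = (fun=> 0)); first exact: L1_approx0.
    by apply/funext => t; rewrite /sumS big_ord0.
  rewrite (_ : sumS m.+1 = (fun t => sumS m t + \1_(S m) t)).
    by apply: L1_approxD => //; exact: WI.
  by apply/funext => t; rewrite /sumS big_ord_recr.
apply: le_trans (HM k.+1%:R^-1 _ (ltW q0) _ _) _.
- apply: measurable_funB => //; by apply: measurable_funD; apply: measurable_funM.
- move=> t; have := @step_approx R k.+1%:R^-1 (f t + n%:R) N q0.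
  have := fc t; rewrite ler_norml => /andP[f1 f2].
  have cc := ler_norm c.
  move=> H; rewrite /g qE rmorphN rmorph_nat indicE in_setT mulr1.
  rewrite opprD opprK addrA.
  have -> : sumS N t = \sum_(i < N) (i.+1%:R * k.+1%:R^-1 <= f t + n%:R)%R%:R.
    apply: eq_bigr => i _; rewrite indicE; congr (nat_of_bool _)%:R.
    by apply/idP/idP; rewrite inE.
  apply: H; first lra.
  rewrite /N natrM mulfK ?pnatr_eq0// -muln2 natrM; lra.
- by rewrite lee_fin -ler_pdivlMr// ltW//; apply: (ke k) => /=.
Qed.

End dense_class.

Lemma vintegrable_bounded f (c : R) : measurable_fun setT f ->
  (forall t, `|f t| <= c) -> vintegrable nu f.
Proof.
move=> mf fc; apply: vintegrable_lim => //.
apply: (@L1_approx_bounded (vintegrable nu)) => //.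
- by move=> w [].
- have := vintegrable_indic measurable0; congr vintegrable.
  by apply/funext => t; rewrite indic0.
- exact: vintegrableD.
- by move=> q u; exact: vintegrableZ.
- move=> B mB e e0; exists (\1_B); first exact: vintegrable_indic.
  apply: le_trans (_ : (_ <= 0)%E) _; last by rewrite lee_fin ltW.
  by apply: L1norm0 => t; rewrite subrr.
Qed.

(** Cut off to 0, not to n: this is the product of f and an indicator, so that
    f - trunc f n lives where f is large. *)
Definition trunc f n t : R := if `|f t| <= n%:R then f t else 0.

Lemma trunc_indic f n : trunc f n = (fun t => f t * \1_[set t | `|f t| <= n%:R] t).
Proof.
apply/funext => t; rewrite /trunc indicE; case: ifPn => h.
  by rewrite mem_set// mulr1.
by rewrite memNset ?mulr0//=; exact/negP.
Qed.

Lemma measurable_le_norm f n : measurable_fun setT f -> measurable [set t | `|f t| <= n%:R].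
Proof.
move=> mf; rewrite (_ : mkset _ = (fun t => `|f t|) @^-1` `]-oo, n%:R]%classic).
  by rewrite -[_ @^-1` _]setTI; apply: measurableT_comp.
by apply/seteqP; split=> t /=; rewrite in_itv.
Qed.

Lemma measurable_trunc f n : measurable_fun setT f -> measurable_fun setT (trunc f n).
Proof.
move=> mf; rewrite trunc_indic; apply: measurable_funM => //.
exact/measurable_indic/measurable_le_norm.
Qed.

Lemma trunc_bounded f n t : `|trunc f n t| <= n%:R.
Proof. by rewrite /trunc; case: ifP => // _; rewrite normr0. Qed.

Lemma vintegrable_trunc f n : measurable_fun setT f -> vintegrable nu (trunc f n).
Proof.
move=> mf; apply: (@vintegrable_bounded _ n%:R); first exact: measurable_trunc.
exact: trunc_bounded.
Qed.

(** The indefinite integral of f is weakly countably additive; hence, by the theorem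
    of Orlicz and Pettis, it is small on all subsets of the set where f is large,
    and the semivariation is controlled by its values on subsets. *)
Lemma vintegrable_tail f (e : R) : vintegrable nu f -> 0 < e ->
  exists n, (L1norm nu (fun t => f t - trunc f n t)%R <= e%:E)%E.
Proof.
move=> [mf fi fv] e0.
have /choice[m mP] : forall A, exists v : X, measurable A ->
    forall x : dual X, x v = charge_integral (scalarization nu x) A f.
  move=> A; have [mA|] := pselect (measurable A); last by exists 0.
  by have [v vP] := fv A mA; exists v.
have fiA x A : measurable A -> (V x).-integrable A (EFin \o f).
  by move=> mA; exact: integrableS (fi x).
have mE (x : dual X) A : measurable A -> x (m A) =
    \int[V x]_(t in A) (f t * charge_sgn (scalarization nu x) t).
  by move=> mA; rewrite mP// charge_integralE//; exact: fiA.
have wm : weakly_sigma_additive m.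
  move=> x F mF tF; rewrite mE; last exact: bigcupT_measurable.
  rewrite (_ : (fun n => _) = (fun n => \sum_(0 <= i < n)
    \int[V x]_(t in F i) (f t * charge_sgn (scalarization nu x) t))).
    by apply: Rintegral_sigma_additive => //; exact: integrable_sgn (fi x).
  by apply/funext => n; apply: eq_bigr => i _; rewrite mE.
pose A n := ~` [set t | `|f t| <= n%:R].
have mA n : measurable (A n) by apply: measurableC; exact: measurable_le_norm.
have [||n nA] := wsa_tail wm mA _ _ (divr_gt0 e0 (ltr0Sn R 1)).
- move=> n t /= /negP; rewrite -ltNge => h; apply/negP; rewrite -ltNge.
  by apply: lt_trans h; rewrite ltr_nat.
- apply/seteqP; split=> // t /(_ (Num.truncn `|f t|).+1 I) /=; apply.
  by apply: ltW; exact: Num.Theory.truncnS_gt.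
exists n; apply/L1norm_leP => x x1.
pose g t := f t * charge_sgn (scalarization nu x) t.
have gi B : measurable B -> (V x).-integrable B (EFin \o g).
  by move=> mB; apply: integrable_sgn => //; exact: fiA.
have mg : measurable_fun setT g.
  by apply/measurable_EFinP; exact: (measurable_int _ (gi _ measurableT)).
pose P := [set t | 0 <= g t].
have mP' : measurable P.
  rewrite (_ : P = g @^-1` `[0, +oo[%classic); first by rewrite -[_ @^-1` _]setTI; apply: mg.
  by apply/seteqP; split=> t /=; rewrite /P /= in_itv/= andbT.
have m1 : measurable (A n `&` P) by exact: measurableI.
have m2 : measurable (A n `\` P) by exact: measurableD.
have -> : (\int[V x]_t `|f t - trunc f n t|%:E = \int[V x]_(t in A n) `|g t|%:E)%E.
  rewrite [RHS]integral_mkcond; apply: eq_integral => t _.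
  rewrite patchE /trunc /g normrM charge_sgn_norm mulr1; case: ifPn => h.
    by rewrite subrr normr0 memNset//= /A /= h.
  by rewrite subr0 mem_set//= /A /=; exact/negP.
rewrite -(setUIDK (A n) P) ge0_integral_setU//; last 2 first.
- by apply/measurable_funTS/measurable_EFinP; exact: measurableT_comp.
- by apply/disj_setPS => t [[_ ?] [_ ?]].
have bnd B (s : bool) : measurable B -> B `<=` A n ->
    (forall t, B t -> (-1) ^+ s * g t = `|g t|) ->
    (\int[V x]_(t in B) `|g t|%:E <= (e / 2)%:E)%E.
  move=> mB BA gB.
  have -> : (\int[V x]_(t in B) `|g t|%:E = ((-1) ^+ s * x (m B))%:E)%E.
    rewrite mE// -RintegralZl//; last exact: gi.
    rewrite /Rintegral fineK.
      by apply: eq_integral => t /set_mem Bt; rewrite gB.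
    have := integrable_fin_num mB (integrableZl mB ((-1) ^+ s) (gi _ mB)).
    by [].
  rewrite lee_fin; apply: le_trans (ler_norm _) _; rewrite normrM normr_sign mul1r.
  by apply: le_trans (x1 _) (nA _ mB BA).
rewrite [e]splitr EFinD; apply: leeD.
  apply: (bnd _ false) => //.
  by move=> t [_ /= g0]; rewrite expr0 mul1r ger0_norm.
apply: (bnd _ true) => //.
by move=> t [_ /= /negP]; rewrite -ltNge => g0; rewrite expr1 mulN1r ltr0_norm.
Qed.

Lemma vintegrableP f : measurable_fun setT f -> vintegrable nu f <->
  forall e : R, 0 < e -> exists n,
    (L1norm nu (fun t => f t - trunc f n t)%R <= e%:E)%E.
Proof.
move=> mf; split=> [fi e|H]; first exact: vintegrable_tail.
apply: vintegrable_lim => // e e0; have [n fn] := H e e0.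
by exists (trunc f n) => //; exact: vintegrable_trunc.
Qed.

Lemma L1_dense (W : set (T -> R)) f :
  (forall w, W w -> measurable_fun setT w) -> W (fun=> 0) ->
  (forall u v, W u -> W v -> W (fun t => u t + v t)) ->
  (forall (q : rat) u, W u -> W (fun t => ratr q * u t)) ->
  (forall B, measurable B -> L1_approx W (\1_B)) ->
  vintegrable nu f -> L1_approx W f.
Proof.
move=> mW W0 WD WZ WI fi; have [mf _ _] := fi.
apply: L1_approx_trans => // e e0; have [n fn] := vintegrable_tail fi e0.
exists (trunc f n) => //; split; first exact: measurable_trunc.
apply: (@L1_approx_bounded W mW W0 WD WZ WI _ n%:R); first exact: measurable_trunc.
exact: trunc_bounded.
Qed.

End integrability.

(** * Bounded functions in the L2 space of a finite measure *)

Lemma limn_esup_bounds (R : realType) (u : (\bar R)^nat) (a b : \bar R) :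
  (forall n, (a <= u n <= b)%E) -> (a <= limn_esup u <= b)%E.
Proof.
move=> H; rewrite limn_esup_lim; apply/andP; split.
  apply: lime_ge; first exact: is_cvg_esups.
  apply: nearW => n; have /andP[+ _] := H n; move/le_trans; apply.
  by apply: ereal_sup_ubound; exists n => /=.
apply: lime_le; first exact: is_cvg_esups.
apply: nearW => n; apply: ge_ereal_sup => _ [k _ <-].
by have /andP[] := H k.
Qed.

(** If the sum is finite the sequence converges; otherwise the bound is void. Using
    the limit superior avoids exceptional null sets. *)
Lemma limn_esup_increments (R : realType) (u : R^nat) k :
  (`|fine (limn_esup (EFin \o u)) - u k|%:E <=
   \sum_(j <oo) `|u (k + j).+1 - u (k + j)%N|%:E)%E.
Proof.
set S := (X in (_ <= X)%E).
have [|Sfin] := leP +oo%E S; first by rewrite leye_eq => /eqP ->; exact: leey.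
have S0 : (0 <= S)%E by exact: nneseries_ge0.
pose s := fine S; have sE : S = s%:E by rewrite fineK// ge0_fin_numE.
pose v j := u (k + j).+1 - u (k + j)%N.
have part n : \sum_(0 <= j < n) `|v j| <= s.
  rewrite -lee_fin -sE -sumEFin; exact: nneseries_lim_ge.
have vE n : series v n = u (k + n)%N - u k.
  rewrite /series /=; elim: n => [|n IH]; first by rewrite big_geq// addn0 subrr.
  by rewrite big_nat_recr//= IH /v addrC subrKA addnS.
have cv : cvg (series v @ \oo).
  apply: (@normed_cvg R R^o); apply: nondecreasing_is_cvgn.
    by apply: nondecreasing_series => n * /=; exact: normr_ge0.
  by exists s => _ [n _ <-]; exact: part.
have cu : u @ \oo --> lim (series v @ \oo) + u k.
  rewrite -(cvg_shiftn k); apply: cvg_trans (cvgD cv (cvg_cst (u k))).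
  apply: near_eq_cvg; apply: nearW => n /=.
  by rewrite fctE vE subrK addnC.
have cuE : (EFin \o u) @ \oo --> (lim (series v @ \oo) + u k)%:E.
  by apply: cvg_EFin => //; exact: nearW.
have [_ ->] := cvg_limn_einf_sup cuE.
rewrite /= addrK sE lee_fin.
apply: (cvgr_to_le (cvg_norm cv)); apply: nearW => n.
by apply: le_trans (ler_norm_sum _ _ _) (part n).
Qed.

Section bounded_functions.
Context d (T : measurableType d) (R : realType).
Variable la : {finite_measure set T -> \bar R}.
Implicit Types f g u w : T -> R.

Definition bmeas f := measurable_fun setT f /\ exists c, forall t, `|f t| <= c.

Definition itg f : R := \int[la]_t f t.
Local Notation E := itg.

Lemma bmeasD f g : bmeas f -> bmeas g -> bmeas (fun t => f t + g t).
Proof.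
move=> [mf [a fa]] [mg [b gb]]; split; first exact: measurable_funD.
by exists (a + b) => t; apply: le_trans (ler_normD _ _) (lerD (fa t) (gb t)).
Qed.

Lemma bmeasM f g : bmeas f -> bmeas g -> bmeas (fun t => f t * g t).
Proof.
move=> [mf [a fa]] [mg [b gb]]; split; first exact: measurable_funM.
by exists (a * b) => t; rewrite normrM ler_pM.
Qed.

Lemma bmeas_cst c : bmeas (fun=> c).
Proof. by split; [exact: measurable_cst|exists `|c|]. Qed.

Lemma bmeasZ c f : bmeas f -> bmeas (fun t => c * f t).
Proof. by move=> bf; apply: bmeasM => //; exact: bmeas_cst. Qed.

Lemma bmeasN f : bmeas f -> bmeas (fun t => - f t).
Proof.
move=> [mf [a fa]]; split; first exact: measurable_funN.
by exists a => t; rewrite normrN.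
Qed.

Lemma bmeasB f g : bmeas f -> bmeas g -> bmeas (fun t => f t - g t).
Proof. by move=> bf bg; apply: bmeasD => //; exact: bmeasN. Qed.

Lemma bmeas_norm f : bmeas f -> bmeas (fun t => `|f t|).
Proof.
move=> [mf [a fa]]; split; first exact: measurableT_comp.
by exists a => t; rewrite normr_id.
Qed.

Lemma bmeas_indic A : measurable A -> bmeas (\1_A).
Proof.
move=> mA; split; first exact: measurable_indic.
by exists 1 => t; rewrite indicE; case: (_ \in _); rewrite ?normr1 ?normr0.
Qed.

Lemma bmeas_sum (I : Type) (s : seq I) (F : I -> T -> R) :
  (forall i, bmeas (F i)) -> bmeas (fun t => \sum_(i <- s) F i t).
Proof.
move=> bF; elim: s => [|i s IH].
  by under eq_fun do rewrite big_nil; exact: bmeas_cst.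
by under eq_fun do rewrite big_cons; exact: bmeasD.
Qed.

Lemma la_lty : (la setT < +oo)%E.
Proof. by rewrite -ge0_fin_numE// fin_num_measure. Qed.

Lemma bmeas_integrable f : bmeas f -> la.-integrable setT (EFin \o f).
Proof. move=> [mf [c fc]]; apply: integral_bound_fin => //; exact: la_lty. Qed.

Lemma itgD f g : bmeas f -> bmeas g -> E (fun t => f t + g t) = E f + E g.
Proof. by move=> bf bg; rewrite /itg RintegralD//; exact: bmeas_integrable. Qed.

Lemma itgB f g : bmeas f -> bmeas g -> E (fun t => f t - g t) = E f - E g.
Proof. by move=> bf bg; rewrite /itg RintegralB//; exact: bmeas_integrable. Qed.

Lemma itgZ c f : bmeas f -> E (fun t => c * f t) = c * E f.
Proof. by move=> bf; rewrite /itg RintegralZl//; exact: bmeas_integrable. Qed.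

Lemma itg_cst c : E (fun=> c) = c * fine (la setT).
Proof. by rewrite /itg Rintegral_cst. Qed.

Lemma ler_itg f g : bmeas f -> bmeas g -> (forall t, f t <= g t) -> E f <= E g.
Proof. by move=> bf bg fg; apply: le_Rintegral => //; exact: bmeas_integrable. Qed.

Lemma itg_ge0 f : (forall t, 0 <= f t) -> 0 <= E f.
Proof. by move=> f0; apply: Rintegral_ge0. Qed.

Lemma ler_norm_itg f : bmeas f -> `|E f| <= E (fun t => `|f t|).
Proof. by move=> bf; apply: le_normr_Rintegral => //; exact: bmeas_integrable. Qed.

Lemma itg_sum (I : Type) (s : seq I) (F : I -> T -> R) :
  (forall i, bmeas (F i)) -> E (fun t => \sum_(i <- s) F i t) = \sum_(i <- s) E (F i).
Proof.
move=> bF; elim: s => [|i s IH].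
  by under eq_fun do rewrite big_nil; rewrite itg_cst mul0r big_nil.
by under eq_fun do rewrite big_cons; rewrite itgD// ?IH ?big_cons//; exact: bmeas_sum.
Qed.

Lemma itg_EFin f : bmeas f -> (E f)%:E = (\int[la]_t (f t)%:E)%E.
Proof.
by move=> bf; rewrite /itg /Rintegral fineK//; apply: integrable_fin_num => //;
  exact: bmeas_integrable.
Qed.

Let L := fine (la setT).

(** An L2 Cauchy sequence, with a geometric rate, converges in L1: by the inequality
    2 |a| <= 2^n a^2 + 2^-n the increments are summable in L1, and the limit superior
    is a limit in mean. *)
Lemma bounded_L2_complete (phi : (T -> R)^nat) (c : R) :
  (forall n, measurable_fun setT (phi n)) -> (forall n t, `|phi n t| <= c) ->
  (forall n, E (fun t => (phi n.+1 t - phi n t) ^+ 2) <= (4 ^+ n)^-1) ->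
  exists f, [/\ measurable_fun setT f,
    forall t a b, (forall n, a <= phi n t <= b) -> a <= f t <= b &
    forall k, E (fun t => `|f t - phi k t|) <= (1 + L) / 2 ^+ k].
Proof.
move=> mphi phic phi2.
have bphi n : bmeas (phi n) by split=> //; exists c.
pose f t := fine (limn_esup (fun n => (phi n t)%:E)).
have fb t a b : (forall n, a <= phi n t <= b) -> a <= f t <= b.
  move=> H; have /andP[h1 h2] : (a%:E <= limn_esup (fun n => (phi n t)%:E) <= b%:E)%E.
    by apply: limn_esup_bounds => n; rewrite !lee_fin.
  rewrite /f; case: limn_esup h1 h2 => [r| |]//=.
  by rewrite !lee_fin => -> ->.
have mf : measurable_fun setT f.
  apply: measurableT_comp => //; apply: measurable_fun_limn_esup => n.
  exact/measurable_EFinP.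
have bf : bmeas f.
  split=> //; exists c => t; rewrite ler_norml; apply: fb => n.
  by rewrite -ler_norml.
exists f; split=> // k.
have binc n : bmeas (fun t => `|phi n.+1 t - phi n t|) by exact/bmeas_norm/bmeasB.
(* 2 |a| <= 2^n a^2 + 2^-n *)
have inc n : E (fun t => `|phi n.+1 t - phi n t|) <= (1 + L) / 2 ^+ n.+1.
  have n2 : 0 < 2 ^+ n :> R by rewrite exprn_gt0.
  apply: (@le_trans _ _ (E (fun t => 2 ^+ n / 2 * (phi n.+1 t - phi n t) ^+ 2 + (2 ^+ n)^-1 / 2))).
    apply: ler_itg => // [|t].
      apply: bmeasD; last exact: bmeas_cst.
      apply: bmeasZ; under eq_fun do rewrite expr2; apply: bmeasM; exact: bmeasB.
    set x := `|_|; rewrite -real_normK ?num_real// -/x.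
    have -> : 2 ^+ n / 2 * x ^+ 2 + (2 ^+ n)^-1 / 2 =
        x + (2 ^+ n)^-1 / 2 * (2 ^+ n * x - 1) ^+ 2 by field; rewrite gt_eqF.
    by rewrite lerDl mulr_ge0 ?sqr_ge0// divr_ge0 ?invr_ge0 ?(ltW n2).
  have bb : bmeas (fun t => (phi n.+1 t - phi n t) ^+ 2).
    by under eq_fun do rewrite expr2; apply: bmeasM; exact: bmeasB.
  rewrite (itgD (bmeasZ _ bb) (bmeas_cst _)) (itgZ _ bb) itg_cst.
  have -> : (1 + L) / 2 ^+ n.+1 = (2 ^+ n)^-1 / 2 + (2 ^+ n)^-1 / 2 * L.
    by rewrite exprSr; field; rewrite gt_eqF.
  rewrite lerD2r.
  rewrite mulrAC ler_pM2r ?invr_gt0//.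
  apply: (@le_trans _ _ (2 ^+ n * (4 ^+ n)^-1)); first by rewrite ler_pM2l.
  rewrite (_ : 4 = 2 * 2 :> R) ?exprMn; last by rewrite -natrM.
  by rewrite invfM mulrA divff ?mul1r// gt_eqF.
rewrite -lee_fin itg_EFin; last exact/bmeas_norm/bmeasB.
apply: (@le_trans _ _ (\int[la]_t (\sum_(j <oo) `|phi (k + j).+1 t - phi (k + j)%N t|%:E))%E).
  apply: ge0_le_integral => //.
  - by apply/measurable_EFinP; exact: (bmeas_norm (bmeasB bf (bphi k))).1.
  - apply: ge0_emeasurable_sum => // n _; apply/measurable_EFinP; exact: (binc _).1.
  - by move=> t _; exact: (limn_esup_increments (phi^~ t) k).
rewrite integral_nneseries//; last by move=> n; apply/measurable_EFinP; exact: (binc _).1.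
have L0 : 0 <= L by rewrite fine_ge0.
apply: (@le_trans _ _ (\sum_(j <oo) (((1 + L) / 2 ^+ k) / (2 ^ j.+1)%:R)%:E)%E).
  apply: lee_nneseries => [n *|n _]; first by apply: integral_ge0 => *; rewrite lee_fin.
  rewrite -itg_EFin; last exact: binc.
  rewrite lee_fin; apply: le_trans (inc _) _.
  by rewrite -addnS exprD invfM mulrA natrX.
by apply: epsilon_trick0; rewrite divr_ge0 ?addr_ge0// exprn_ge0.
Qed.

End bounded_functions.

(** * Orthogonal projections *)

Section hilbert.
Context d (T : measurableType d) (R : realType).
Variable la : {finite_measure set T -> \bar R}.
Implicit Types f g u w : T -> R.
Local Notation E := (itg la).

Lemma geometric_half_cvg0 (D : R) : (fun k => D / 2 ^+ k) @ \oo --> (0 : R).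
Proof.
have : `|2^-1 : R| < 1 by rewrite ger0_norm// invf_lt1// ltr1n.
move=> /(cvg_geometric D); rewrite (_ : geometric D 2^-1 = (fun k => D / 2 ^+ k))//.
by apply/funext => k; rewrite /geometric /= exprVn.
Qed.

Lemma half_bound_cvg (u : R^nat) (l D : R) :
  (forall k, `|l - u k| <= D / 2 ^+ k) -> u @ \oo --> l.
Proof.
move=> H; apply/cvgrPdist_le => e e0; have /cvgr0Pnorm_le/(_ e e0) := @geometric_half_cvg0 D.
by apply: filterS => k; apply: le_trans; apply: le_trans (H k) (ler_norm _).
Qed.

Lemma cvg_itgM (phi : (T -> R)^nat) f g (C : R) : (forall n, bmeas (phi n)) ->
  bmeas f -> bmeas g -> (forall k, E (fun t => `|f t - phi k t|) <= C / 2 ^+ k) ->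
  (fun k => E (fun t => phi k t * g t)) @ \oo --> E (fun t => f t * g t).
Proof.
move=> bphi bf bg H; have [mg [c gc]] := bg.
apply: (@half_bound_cvg _ _ (`|c| * C)) => k.
have bfg := bmeasM bf bg; have bpg := bmeasM (bphi k) bg.
rewrite -itgB//; apply: le_trans (ler_norm_itg _ (bmeasB bfg bpg)) _.
have bd := bmeas_norm (bmeasB bf (bphi k)).
apply: (@le_trans _ _ (E (fun t => `|c| * `|f t - phi k t|))).
  apply: ler_itg => [||t]; [exact/bmeas_norm/bmeasB|exact: bmeasZ|].
  rewrite -mulrBl normrM mulrC ler_wpM2r//.
  by apply: le_trans (gc t) (ler_norm _).
by rewrite (itgZ _ _ bd) -mulrA ler_wpM2l.
Qed.

Lemma cvg_itg_sqr (phi : (T -> R)^nat) f (C c : R) : (forall n, bmeas (phi n)) ->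
  bmeas f -> (forall n t, `|phi n t| <= c) -> (forall t, `|f t| <= c) ->
  (forall k, E (fun t => `|f t - phi k t|) <= C / 2 ^+ k) ->
  (fun k => E (fun t => phi k t * phi k t)) @ \oo --> E (fun t => f t * f t).
Proof.
move=> bphi bf phic fc H.
apply: (@half_bound_cvg _ _ ((c + c) * C)) => k.
have bff := bmeasM bf bf; have bpp := bmeasM (bphi k) (bphi k).
rewrite -itgB//; apply: le_trans (ler_norm_itg _ (bmeasB bff bpp)) _.
have bd := bmeas_norm (bmeasB bf (bphi k)).
have c0 : 0 <= c by exact: (le_trans (normr_ge0 (f point)) (fc point)).
have c0' : 0 <= c + c by rewrite addr_ge0.
apply: (@le_trans _ _ (E (fun t => (c + c) * `|f t - phi k t|))).
  apply: ler_itg => [||t]; [exact/bmeas_norm/bmeasB|exact: bmeasZ|].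
  rewrite (_ : f t * f t - phi k t * phi k t = (f t + phi k t) * (f t - phi k t)); last by ring.
  by rewrite normrM ler_wpM2r//; apply: le_trans (ler_normD _ _) (lerD (fc t) (phic k t)).
by rewrite (itgZ _ _ bd) -mulrA ler_wpM2l.
Qed.

Definition clip u t : R := Num.max 0 (Num.min 1 (u t)).

Lemma clip01 u t : 0 <= clip u t <= 1.
Proof. by rewrite /clip le_max lexx ge_max ler01 ge_min lexx. Qed.

Lemma clip_id u t : 0 <= u t <= 1 -> clip u t = u t.
Proof. by move=> /andP[u0 u1]; rewrite /clip (min_idPr u1) (max_idPr u0). Qed.

Lemma clip_dist f u t : 0 <= f t <= 1 -> `|f t - clip u t| <= `|f t - u t|.
Proof.
move=> /andP[f0 f1]; rewrite /clip.
case: (lerP 1 (u t)) => u1.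
  by rewrite (max_idPr ler01) !ler0_norm; lra.
case: (lerP 0 (u t)) => u0 //.
by rewrite !ger0_norm; lra.
Qed.

Lemma bmeas_clip u : measurable_fun setT u -> bmeas (clip u).
Proof.
move=> mu; split; last first.
  exists 1 => t; have /andP[h1 h2] := clip01 u t.
  by rewrite ger0_norm.
by apply: measurable_maxr => //; apply: measurable_minr.
Qed.

Lemma itg_sqrD (a b : R) u v : bmeas u -> bmeas v ->
  E (fun t => (a * u t + b * v t) * (a * u t + b * v t)) =
  a * a * E (fun t => u t * u t) + 2 * a * b * E (fun t => u t * v t) +
    b * b * E (fun t => v t * v t).
Proof.
move=> bu bv; have buu := bmeasM bu bu; have buv := bmeasM bu bv; have bvv := bmeasM bv bv.
have z1 := bmeasZ (a * a) buu; have z2 := bmeasZ (2 * a * b) buv.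
have z3 := bmeasZ (b * b) bvv.
rewrite -(itgZ la (a * a) buu) -(itgZ la (2 * a * b) buv) -(itgZ la (b * b) bvv).
rewrite -(itgD la z1 z2) -(itgD la (bmeasD z1 z2) z3).
by congr (E _); apply/funext => t; ring.
Qed.

(** The first variation of a quadratic function of q that is minimal at 0. *)
Lemma quadratic_zero (b c : R) :
  (forall q : rat, 0 <= (ratr q * ratr q) * b - 2 * ratr q * c) -> c = 0.
Proof.
move=> H; have key (s : R) : (s = 1 \/ s = -1) -> 2 * (s * c) <= 0.
  move=> s1; apply/ler_addgt0Pr => e e0; rewrite add0r.
  have [k _ ke] := near_infty_natSinv_lt (PosNum (divr_gt0 e0 (ltr_pwDr ltr01 (normr_ge0 b)))).
  have {ke} := ke k (leqnn _); rewrite /= ltr_pdivlMr ?ltr_pwDr// => /ltW ke.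
  set r := k.+1%:R^-1 in ke; have r0 : 0 < r by rewrite invr_gt0 ltr0n.
  have : exists q : rat, ratr q = s * r :> R.
    case: s1 => ->; [exists k.+1%:R^-1|exists (- k.+1%:R^-1)].
      by rewrite fmorphV rmorph_nat mul1r.
    by rewrite rmorphN fmorphV rmorph_nat mulN1r.
  move=> [q qE]; have := H q; rewrite qE => h.
  have ss : s * s = 1 by case: s1 => ->; lra.
  have : 0 <= r * (r * b - 2 * (s * c)).
    rewrite (_ : r * _ = (s * s) * r * r * b - 2 * r * (s * c)); last by rewrite ss; ring.
    suff -> : s * s * r * r * b - 2 * r * (s * c) =
      s * r * (s * r) * b - 2 * (s * r) * c by []; ring.
  rewrite pmulr_rge0// subr_ge0 => /le_trans; apply.
  apply: le_trans ke; rewrite ler_pM2l//; have := ler_norm b; lra.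
by have := key 1 (or_introl erefl); have := key (-1) (or_intror erefl); lra.
Qed.

(** The distance of f to W in L2. If it is positive, a minimizing sequence in W
    converges by the parallelogram identity, and the difference of f and its limit
    is orthogonal to W. Clipping to [0, 1] brings the elements of W closer to f and
    keeps the sequence bounded, so that the difference is a bounded function. *)
Lemma projection (W : set (T -> R)) f :
  (forall w, W w -> bmeas w) -> W (fun=> 0) ->
  (forall u v, W u -> W v -> W (fun t => u t + v t)) ->
  (forall (q : rat) u, W u -> W (fun t => ratr q * u t)) ->
  (forall u, W u -> W (clip u)) ->
  measurable_fun setT f -> (forall t, 0 <= f t <= 1) ->
  (exists u, [/\ bmeas u,
     forall t, f t = 0 -> (forall w, W w -> w t = 0) -> u t = 0,
     forall w, W w -> E (fun t => u t * w t) = 0 &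
     0 < E (fun t => u t * u t)]) \/
  (forall e : R, 0 < e -> exists2 w, W w & (forall t, 0 <= w t <= 1) /\
     E (fun t => (f t - w t) * (f t - w t)) <= e).
Proof.
move=> bW W0 WD WZ Wclip mf f01.
have bf : bmeas f.
  by split=> //; exists 1 => t; have /andP[f0 f1] := f01 t; rewrite ger0_norm.
pose D w := E (fun t => (f t - w t) * (f t - w t)).
have bfw w : W w -> bmeas (fun t => f t - w t) by move=> /bW; exact: bmeasB.
have D0 w : 0 <= D w by apply: itg_ge0 => t; rewrite -expr2 sqr_ge0.
have Dclip w : W w -> D (clip w) <= D w.
  move=> Ww; apply: ler_itg.
  - by apply: bmeasM; apply: bfw; exact: Wclip.
  - by apply: bmeasM; exact: bfw.
  - move=> t; rewrite -!expr2 -[leLHS]real_normK ?num_real// -[leRHS]real_normK ?num_real//.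
    by rewrite ler_pXn2r ?nnegrE//; exact: clip_dist.
pose A := [set D w | w in W]; pose m := inf A.
have lA : has_lbound A by exists 0 => _ [w _ <-].
have A0 : A !=set0 by exists (D (fun=> 0)), (fun=> 0).
have m0 : 0 <= m by apply: lb_le_inf => // _ [w _ <-].
have mD w : W w -> m <= D w by move=> Ww; apply: ge_inf => //; exists w.
have adh (e : R) : 0 < e -> exists2 w, W w & (forall t, 0 <= w t <= 1) /\ D w <= m + e.
  move=> e0; have [_ [w Ww <-] we] := inf_adherent e0 (conj A0 lA).
  exists (clip w); first exact: Wclip.
  by split=> [t|]; [exact: clip01|exact: le_trans (Dclip _ Ww) (ltW we)].
have [m_gt0|m_le0] := ltP 0 m; last first.
  right=> e e0; have [w Ww [w01 Dw]] := adh e e0; exists w => //; split=> //.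
  by apply: le_trans Dw _; rewrite gerDr.
left.
have del0 n : 0 < (4 ^+ n)^-1 / 4 :> R by rewrite divr_gt0// invr_gt0 exprn_gt0.
have /choice[w wP] : forall n : nat, exists w, [/\ W w, forall t, 0 <= w t <= 1 &
    D w <= m + (4 ^+ n)^-1 / 4].
  by move=> n; have [w Ww [w01 Dw]] := adh _ (del0 n); exists w.
have Ww n : W (w n) by have [] := wP n.
have bw n : bmeas (w n) by exact: bW.
have w1 n t : `|w n t| <= 1.
  by have [_ + _] := wP n => /(_ t) /andP[h1 h2]; rewrite ger0_norm.
(* parallelogram identity, with the midpoint of w n and w n.+1 in W *)
have inc n : E (fun t => (w n.+1 t - w n t) ^+ 2) <= (4 ^+ n)^-1.
  have bn := bfw _ (Ww n); have bn1 := bfw _ (Ww n.+1).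
  have := mD _ (WZ 2^-1 _ (WD _ _ (Ww n) (Ww n.+1))).
  have [_ _ d1] := wP n; have [_ _ d2] := wP n.+1.
  have -> : D (fun t => ratr 2^-1 * (w n t + w n.+1 t)) =
      E (fun t => (2^-1 * (f t - w n t) + 2^-1 * (f t - w n.+1 t)) *
                  (2^-1 * (f t - w n t) + 2^-1 * (f t - w n.+1 t))).
    rewrite fmorphV rmorph_nat; congr (E _); apply/funext => t.
    rewrite (_ : f t - _ = 2^-1 * (f t - w n t) + 2^-1 * (f t - w n.+1 t))//; lra.
  have -> : E (fun t => (w n.+1 t - w n t) ^+ 2) =
      E (fun t => (1 * (f t - w n t) + (-1) * (f t - w n.+1 t)) *
                  (1 * (f t - w n t) + (-1) * (f t - w n.+1 t))).
    by congr (E _); apply/funext => t; ring.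
  rewrite !itg_sqrD// -!/(D _).
  have h4 : (4 ^+ n.+1)^-1 / 4 <= (4 ^+ n)^-1 / 4 :> R.
    by rewrite ler_pM2r// lef_pV2 ?posrE ?exprn_gt0// ler_weXn2l// ler1n.
  move: d1 d2 h4; set p := D (w n); set q := D (w n.+1); set r := E _.
  set e := (4 ^+ n)^-1; set e1 := (4 ^+ n.+1)^-1; lra.
have [s [ms sb sE]] := bounded_L2_complete (fun n => (bw n).1) w1 inc.
have bs : bmeas s.
  by split=> //; exists 1 => t; rewrite ler_norml; apply: sb => n; rewrite -ler_norml.
pose u t := f t - s t; have bu : bmeas u by exact: bmeasB.
have uE k : E (fun t => `|u t - (f t - w k t)|) <= (1 + fine (la setT)) / 2 ^+ k.
  apply: le_trans (sE k); rewrite (_ : (fun t => _) = (fun t => `|s t - w k t|))//.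
  by apply/funext => t; rewrite /u -normrN; congr (`|_|); ring.
have uc t : `|u t| <= 2.
  apply: le_trans (ler_normB _ _) _; have /andP[f0 f1] := f01 t.
  have : `|s t| <= 1 by rewrite ler_norml; apply: sb => n; rewrite -ler_norml.
  rewrite (ger0_norm f0); lra.
have fwc n t : `|f t - w n t| <= 2.
  apply: le_trans (ler_normB _ _) _; have /andP[f0 f1] := f01 t.
  have := w1 n t; rewrite (ger0_norm f0); lra.
have Dcv := cvg_itg_sqr (fun n => bfw _ (Ww n)) bu fwc uc uE.
have Eum : E (fun t => u t * u t) <= m.
  have cv2 : (fun n => m + 4^-1 / 2 ^+ n) @ \oo --> m.
    by rewrite -[X in _ --> X]addr0; apply: cvgD; [exact: cvg_cst|exact: geometric_half_cvg0].
  apply: (ler_cvg_to Dcv cv2).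
  apply: nearW => n; have [_ _ Dw] := wP n; apply: le_trans Dw _.
  rewrite lerD2l mulrC ler_pM2l// lef_pV2 ?posrE ?exprn_gt0//.
  by rewrite lerXn2r ?nnegrE// ler_nat.
have mEu : m <= E (fun t => u t * u t).
  by apply: (cvgr_to_ge Dcv); apply: nearW => n; exact: mD.
exists u; split=> //.
- move=> t ft Wt; rewrite /u ft sub0r; apply/eqP; rewrite oppr_eq0 eq_le.
  by rewrite andbC; apply: sb => n; rewrite Wt// lexx.
- move=> v Wv; apply: (@quadratic_zero (E (fun t => v t * v t))) => q.
  have bv := bW _ Wv.
  have cvv := cvg_itgM (fun n => bfw _ (Ww n)) bu bv uE.
  suff : m <= E (fun t => u t * u t) - 2 * ratr q * E (fun t => u t * v t) +
      ratr q * ratr q * E (fun t => v t * v t).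
    by move: Eum; lra.
  have cv : (fun n => D (w n) - 2 * ratr q * E (fun t => (f t - w n t) * v t) +
      ratr q * ratr q * E (fun t => v t * v t)) @ \oo -->
    E (fun t => u t * u t) - 2 * ratr q * E (fun t => u t * v t) +
      ratr q * ratr q * E (fun t => v t * v t).
    apply: cvgD; last exact: cvg_cst.
    by apply: cvgB => //; apply: cvgM => //; exact: cvg_cst.
  apply: (cvgr_to_ge cv); apply: nearW => n.
  have := mD _ (WD _ _ (Ww n) (WZ q _ Wv)).
  have -> : D (fun t => w n t + ratr q * v t) =
      E (fun t => (1 * (f t - w n t) + (- ratr q) * v t) * (1 * (f t - w n t) + (- ratr q) * v t)).
    by congr (E _); apply/funext => t; ring.
  rewrite itg_sqrD//; last exact: bfw.
  move=> h; apply: le_trans h _; rewrite /D.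
  set a := E _; set b := E _; set c := E _; rewrite le_eqVlt; apply/orP; left; apply/eqP; ring.
- exact: lt_le_trans mEu.
Qed.

End hilbert.

(** * Sign functions orthogonal to a family *)

Section sign.
Context d (T : measurableType d) (R : realType).
Variable la : {finite_measure set T -> \bar R}.
Implicit Types f g u w : T -> R.
Local Notation E := (itg la).

Definition sign_function (e : T -> R) := measurable_fun setT e /\ forall t, e t = 1 \/ e t = -1.

Variables (I : Type) (G : I -> T -> R).
Hypothesis bG : forall i, bmeas (G i).
(** Every set of positive measure carries a nonzero bounded function orthogonal to
    the G i and to any countable family. *)
Hypothesis annihilators : forall A, measurable A -> la A <> 0%E ->
  forall h : nat -> T -> R, (forall n, bmeas (h n)) ->
  exists u, [/\ bmeas u, forall t, ~ A t -> u t = 0, 0 < E (fun t => u t * u t),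
    forall i, E (fun t => u t * G i t) = 0 & forall n, E (fun t => u t * h n t) = 0].

Let K f := [/\ measurable_fun setT f, forall t, `|f t| <= 1 &
  forall i, E (fun t => f t * G i t) = 0].
Let q f := E (fun t => f t * f t).

Let bK f : K f -> bmeas f.
Proof. by move=> [mf f1 _]; split=> //; exists 1. Qed.

Let face (s : seq (T -> R)) f := K f /\
  forall i, (i < size s)%N -> E (fun t => f t * nth (fun=> 0) s i t) = q (nth (fun=> 0) s i).

Let q_le f : K f -> q f <= fine (la setT).
Proof.
move=> Kf; have bf := bK Kf; have [_ f1 _] := Kf.
rewrite -[leRHS]mul1r -itg_cst; apply: ler_itg; [exact: bmeasM|exact: bmeas_cst|].
move=> t; rewrite -expr2 -real_normK ?num_real// expr_le1//.
Qed.

(** Among the functions f in K the sequence phi is chosen so that phi n almost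
    maximizes the L2 norm in the face of those f whose projection on each previous
    phi i is phi i. Then |phi (n+1) - phi n|^2 is the difference of the squares of the
    norms, the sequence converges, and its limit f has maximal norm in the
    intersection of the faces. If |f| were at most 1 - 1 / (j + 1) on a set of
    positive measure, adding to f a small function supported there and orthogonal
    to f, to the phi n and to the G i would stay in that intersection and increase
    the norm. *)
Lemma sign_exists : exists2 e, sign_function e & forall i, E (fun t => e t * G i t) = 0.
Proof.
pose S s := [set q f | f in face s].
have Sub s : has_ubound (S s).
  by exists (fine (la setT)) => _ [f [Kf _] <-]; exact: q_le.
have /choice[nxt nxtP] : forall s, exists f, face s !=set0 ->
    face s f /\ forall g, face s g -> q g <= q f + (4 ^+ size s)^-1.
  move=> s; have [[f0 ff0]|] := pselect (face s !=set0); last by exists (fun=> 0).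
  have d0 : 0 < (4 ^+ size s)^-1 :> R by rewrite invr_gt0 exprn_gt0.
  have [|_ [f ff <-] fs] := @sup_adherent _ (S s) _ d0.
    by split=> //; exists (q f0), f0.
  exists f => _; split=> // g fg; rewrite -lerBlDr; apply/ltW.
  apply: le_lt_trans fs; rewrite lerD2r; apply: ub_le_sup => //; by exists g.
pose s := fix s n := if n is n'.+1 then rcons (s n') (nxt (s n')) else [::].
pose phi n := nxt (s n).
have szs n : size (s n) = n by elim: n => //= n IH; rewrite size_rcons IH.
have snth n i : (i < n)%N -> nth (fun=> 0) (s n) i = phi i.
  elim: n => // n IH; rewrite ltnS leq_eqVlt /= nth_rcons szs.
  by move=> /predU1P[->|ik]; [rewrite ltnn eqxx|rewrite ik IH].
have faceE n f : face (s n) f <->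
    K f /\ forall i, (i < n)%N -> E (fun t => f t * phi i t) = q (phi i).
  rewrite /face szs; split=> -[Kf H]; split=> // i i_n; first by rewrite -(snth n)// H.
  by rewrite snth// H.
have face0 n : face (s n) !=set0.
  elim: n => [|n IH].
    exists (fun=> 0); apply/faceE; split=> //; split.
    - exact: measurable_cst.
    - by move=> t; rewrite normr0.
    - by move=> i; under eq_fun do rewrite mul0r; rewrite itg_cst mul0r.
  have [/faceE[Kn Hn] _] := nxtP _ IH; exists (phi n); apply/faceE; split=> // i.
  by rewrite ltnS leq_eqVlt => /predU1P[->//|]; exact: Hn.
have phiP n : [/\ K (phi n), forall i, (i < n)%N -> E (fun t => phi n t * phi i t) = q (phi i) &
    forall g, face (s n) g -> q g <= q (phi n) + (4 ^+ n)^-1].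
  by have [/faceE[? ?] H] := nxtP _ (face0 n); split=> // g /H; rewrite szs.
have Kphi n : K (phi n) by have [] := phiP n.
have bphi n : bmeas (phi n) by exact: bK.
have phi1 n t : `|phi n t| <= 1 by have [] := Kphi n.
have inc n : E (fun t => (phi n.+1 t - phi n t) ^+ 2) <= (4 ^+ n)^-1.
  have -> : E (fun t => (phi n.+1 t - phi n t) ^+ 2) =
      E (fun t => (1 * phi n.+1 t + (-1) * phi n t) * (1 * phi n.+1 t + (-1) * phi n t)).
    by congr (E _); apply/funext => t; ring.
  rewrite itg_sqrD//; have [_ H1 _] := phiP n.+1; rewrite (H1 n (leqnn _)).
  have [_ _ Hn] := phiP n; have : q (phi n.+1) <= q (phi n) + (4 ^+ n)^-1.
    by apply/Hn/faceE; split=> // i i_n; rewrite H1// ltnW.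
  set x := q (phi n.+1); set y := q (phi n); set a := _^-1; rewrite /q -!/(q _) -/x -/y.
  lra.
have [f [mf fb fE]] := bounded_L2_complete (fun n => (bphi n).1) phi1 inc.
have f1 t : `|f t| <= 1 by rewrite ler_norml; apply: fb => n; rewrite -ler_norml.
have bf : bmeas f by split=> //; exists 1.
have Ecv g : bmeas g -> (fun k => E (fun t => phi k t * g t)) @ \oo --> E (fun t => f t * g t).
  by move=> bg; exact: cvg_itgM fE.
have fG i : E (fun t => f t * G i t) = 0.
  have := Ecv _ (bG i); rewrite (_ : (fun k => _) = (fun=> 0)); last first.
    by apply/funext => k; have [_ _] := Kphi k; exact.
  by move/(cvg_lim (@norm_hausdorff _ R^o)) <-; rewrite lim_cst.
have fphi n : E (fun t => f t * phi n t) = q (phi n).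
  apply: (@cvg_unique _ (@norm_hausdorff _ R^o) _ _ _ _ (Ecv _ (bphi n))).
  apply: cvg_near_cst; exists n.+1 => // k /= nk.
  by have [_ H _] := phiP k; rewrite H.
have qcv := cvg_itg_sqr bphi bf phi1 f1 fE.
have null j : la [set t | `|f t| <= 1 - j.+1%:R^-1] = 0%E.
  set A := mkset _; apply: contrapT => A0.
  have mA : measurable A.
    rewrite (_ : A = (fun t => `|f t|) @^-1` `]-oo, 1 - j.+1%:R^-1]%classic).
      by rewrite -[_ @^-1` _]setTI; apply: measurableT_comp.
    by apply/seteqP; split=> t /=; rewrite in_itv.
  have [u [bu uA u0 uG uh]] := annihilators mA A0 (h := fun n => if n is n'.+1 then phi n' else f)
    (fun n => match n with n'.+1 => bphi n' | 0 => bf end).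
  have [mu [c uc]] := bu.
  have c1 : 0 < `|c| + 1 by rewrite ltr_wpDl.
  (* scaled so that f + a u still has modulus at most 1 on A *)
  pose a := j.+1%:R^-1 / (`|c| + 1); have a0 : 0 < a by rewrite divr_gt0.
  pose g t := 1 * f t + a * u t.
  have bg : bmeas g by apply: bmeasD; exact: bmeasZ.
  have gE h : bmeas h -> E (fun t => g t * h t) =
      E (fun t => f t * h t) + a * E (fun t => u t * h t).
    move=> bh; rewrite -(itgZ la a (bmeasM bu bh)) -itgD; last 2 first.
    - exact: bmeasM.
    - by apply: bmeasZ; exact: bmeasM.
    by congr (E _); apply/funext => t; rewrite /g; ring.
  have Kg : K g.
    split; first exact: bg.1.
      move=> t; have [At|nAt] := pselect (A t); last by rewrite /g uA// mulr0 addr0 mul1r.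
      apply: le_trans (ler_normD _ _) _; rewrite mul1r normrM (gtr0_norm a0).
      have : a * `|u t| <= j.+1%:R^-1.
        rewrite /a mulrAC ler_pdivrMr// ler_pM2l ?invr_gt0//.
        by apply: le_trans (uc t) _; apply: le_trans (ler_norm _) _; rewrite lerDl.
      by move: At; rewrite /A /=; set b := _^-1; lra.
    by move=> i; rewrite gE// fG uG mulr0 addr0.
  have gface n : face (s n) g.
    apply/faceE; split=> // i _; rewrite gE// fphi.
    by have := uh i.+1 => /= ->; rewrite mulr0 addr0.
  have : q g <= q f.
    have cv4 : (fun n => q (phi n) + 1 / 2 ^+ n) @ \oo --> q f.
      by rewrite -[X in _ --> X]addr0; apply: cvgD => //; exact: geometric_half_cvg0.
    apply: (cvgr_to_ge cv4); apply: nearW => n; have [_ _ H] := phiP n.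
    apply: le_trans (H _ (gface n)) _; rewrite lerD2l mul1r lef_pV2 ?posrE ?exprn_gt0//.
    by rewrite lerXn2r ?nnegrE// ler_nat.
  rewrite /q itg_sqrD//; have := uh 0%N => /=; under eq_fun do rewrite mulrC.
  move=> ->; rewrite mulr0 addr0 mul1r; have : 0 < a * a * E (fun t => u t * u t).
    by rewrite !mulr_gt0.
  by set x := _ * _ * _; set y := E _; lra.
pose e t : R := if 0 <= f t then 1 else -1.
have me : measurable_fun setT e.
  rewrite /e; apply: measurable_fun_if => //.
  exact: measurable_fun_ler.
exists e.
  by split=> // t; rewrite /e; case: ifP; [left|right].
move=> i; rewrite -(fG i) /itg /Rintegral; congr fine.
have be : bmeas e by split=> //; exists 1 => t; rewrite /e; case: ifP; rewrite ?normrN normr1.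
apply: ae_eq_integral => //.
- by apply/measurable_EFinP; exact: (bmeasM be (bG i)).1.
- by apply/measurable_EFinP; exact: (bmeasM bf (bG i)).1.
have : la.-negligible (\bigcup_j [set t | `|f t| <= 1 - j.+1%:R^-1]).
  apply: negligible_bigcup => j; exists [set t | `|f t| <= 1 - j.+1%:R^-1]; split=> //; last exact: null.
  rewrite (_ : mkset _ = (fun t => `|f t|) @^-1` `]-oo, 1 - j.+1%:R^-1]%classic).
    by rewrite -[_ @^-1` _]setTI; apply: measurableT_comp.
  by apply/seteqP; split=> t /=; rewrite in_itv.
move=> neg; apply: (negligibleS _ neg) => t /= ne; apply: contrapT => nt; apply: ne => _.
congr (_ * _)%:E; rewrite /e.
have ft : `|f t| = 1.
  apply/eqP; rewrite eq_le f1/=; rewrite leNgt; apply/negP => lt1.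
  have : 0 < 1 - `|f t| by rewrite subr_gt0.
  move=> h; have [k _ ke] := near_infty_natSinv_lt (PosNum h).
  by apply: nt; exists k => //=; have : k.+1%:R^-1 < 1 - `|f t| := ke k (leqnn _);
    rewrite ltrBrDl lerBrDr => /ltW.
case: ifPn ft => [f0|]; first by rewrite ger0_norm.
by rewrite -ltNge => f0; rewrite ltr0_norm// => <-; rewrite opprK.
Qed.

End sign.

(** * Annihilators of small families *)

Section L1norm_small.
Context d (T : measurableType d) (R : realType) (X : completeNormedModType R).
Variable nu : vector_measure T X.

Lemma L1norm_indic_le A (c : R) : measurable A ->
  (forall x, dual_unit_ball x -> (variation (scalarization nu x) A <= c%:E)%E) ->
  (L1norm nu (\1_A) <= c%:E)%E.
Proof.
move=> mA H; apply/L1norm_leP => x x1.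
rewrite (eq_integral (fun t => (\1_A t)%:E)); last first.
  by move=> t _; rewrite indicE; case: (_ \in _); rewrite ?normr1 ?normr0.
by rewrite integral_indic// setIT; exact: H.
Qed.

Lemma L1norm_small : exists2 M : R, 0 < M & forall (f : T -> R) (eta c : R), 0 < eta ->
  measurable_fun setT f -> (forall t, `|f t| <= 1) ->
  (forall x, dual_unit_ball x ->
     (variation (scalarization nu x) [set t | (eta < `|f t|)%R] <= c%:E)%E) ->
  (L1norm nu f <= (eta * M + c)%:E)%E.
Proof.
have [M M0 HM] := L1norm_bounded nu; exists M => // f eta c eta0 mf f1 H.
have mA : measurable [set t | eta < `|f t|].
  rewrite (_ : mkset _ = (fun t => `|f t|) @^-1` `]eta, +oo[%classic).
    by rewrite -[_ @^-1` _]setTI; apply: measurableT_comp.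
  by apply/seteqP; split=> t /=; rewrite in_itv/= andbT.
apply: (@le_trans _ _ (L1norm nu (fun t => eta + \1_[set t | eta < `|f t|] t)%R)).
  apply: L1norm_mono => // [|t]; first by apply: measurable_funD => //; exact: measurable_indic.
  rewrite [leRHS]ger0_norm ?addr_ge0 ?(ltW eta0)// indicE.
  case: (lerP `|f t| eta) => h; first by apply: le_trans h _; rewrite lerDl.
  by rewrite mem_set//=; apply: le_trans (f1 t) _; rewrite lerDr ltW.
apply: le_trans (L1normD _ (measurable_cst eta) (measurable_indic mA)) _.
rewrite EFinD; apply: leeD; last exact: L1norm_indic_le.
by apply: HM => //; [exact: ltW|move=> t; rewrite ger0_norm// ltW].
Qed.

End L1norm_small.

Section annihilator.
Context d (T : measurableType d) (R : realType) (X : completeNormedModType R).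
Variable nu : vector_measure T X.
Variable la : {finite_measure set T -> \bar R}.
Hypothesis la_control : forall e : R, 0 < e -> exists2 del : R, 0 < del &
  forall A, measurable A -> (la A < del%:E)%E ->
    forall x, dual_unit_ball x -> (variation (scalarization nu x) A <= e%:E)%E.

Lemma itg_indic A : measurable A -> itg la (\1_A) = fine (la A).
Proof. by move=> mA; rewrite /itg /Rintegral integral_indic// setIT. Qed.

Lemma chebyshev_la (f : T -> R) (eta : R) : bmeas f -> 0 < eta ->
  ((eta * eta)%:E * la [set t | (eta < `|f t|)%R] <= (itg la (fun t => f t * f t))%:E)%E.
Proof.
move=> bf eta0; set A := mkset _.
have mA : measurable A.
  rewrite (_ : A = (fun t => `|f t|) @^-1` `]eta, +oo[%classic).
    by rewrite -[_ @^-1` _]setTI; apply: measurableT_comp => //; exact: bf.1.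
  by apply/seteqP; split=> t /=; rewrite /A /= in_itv/= andbT.
rewrite -[la A]fineK ?fin_num_measure// -itg_indic// -EFinM lee_fin.
rewrite -(itgZ _ _ (bmeas_indic R mA)); apply: ler_itg.
- by apply: bmeasZ; exact: bmeas_indic.
- exact: bmeasM.
move=> t; rewrite indicE -[f t * f t]expr2 -[leRHS]real_normK ?num_real// expr2.
have [At|nAt] := pselect (A t); last by rewrite memNset ?mulr0 ?mulr_ge0.
by rewrite mem_set// mulr1; apply: ler_pM; rewrite ?(ltW eta0)// ltW.
Qed.

Section restriction.
Variables (A : set T) (mA : measurable A) (A0 : A !=set0).
Local Notation S := (msub mA A0).
Local Notation nuA := (vrestr mA A0 nu).

Lemma measurable_msub_val : measurable_fun [set: S] (@msub_val _ _ _ mA A0).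
Proof.
move=> _ B mB; rewrite setTI /measurable /= /msub_measurable /=.
rewrite (_ : _ @` _ = A `&` B); first exact: measurableI.
apply/seteqP; split=> [_ [b Bb <-]|t [At Bt]].
  by split=> //; exact/set_mem/valP.
by exists (SigSub (mem_set At)).
Qed.

(** The norm for the restriction of nu is estimated through the values of nu on
    subsets only, so that Hahn decompositions on the subspace need not be related to
    those on T. *)
Lemma L1norm_vrestr_small (e : R) : 0 < e -> exists2 del : R, 0 < del &
  forall f, bmeas f -> (forall t, `|f t| <= 1) ->
    itg la (fun t => f t * f t) < del ->
    (L1norm nuA (f \o @msub_val _ _ _ mA A0) <= e%:E)%E.
Proof.
move=> e0; have [M M0 HM] := L1norm_small nuA.
pose eta := e / 2 / M; have eta0 : 0 < eta by rewrite !divr_gt0.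
have e4 : 0 < e / 4 by rewrite divr_gt0.
have [del del0 Hdel] := la_control e4.
exists (eta * eta * del); first by apply: mulr_gt0 => //; exact: mulr_gt0.
move=> f bf f1 fdel.
have -> : e = eta * M + (e / 4 + e / 4) by rewrite /eta divfK ?gt_eqF//; lra.
have mfv : measurable_fun setT (f \o @msub_val _ _ _ mA A0).
  by apply: measurableT_comp; [exact: bf.1|exact: measurable_msub_val].
apply: HM => //; first by move=> t; exact: f1.
set C := mkset _; set D := [set t | eta < `|f t|].
have mset (h : R) U (g : U -> R) : [set t | h < `|g t|] = (fun t => `|g t|) @^-1` `]h, +oo[%classic.
  by apply/seteqP; split=> t /=; rewrite in_itv/= andbT.
have mD : measurable D.
  rewrite /D mset -[_ @^-1` _]setTI; apply: measurableT_comp => //; exact: bf.1.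
have mC : measurable C.
  by rewrite /C mset -[_ @^-1` _]setTI; apply: measurableT_comp.
have laD : (la D < del%:E)%E.
  have := chebyshev_la bf eta0; rewrite -/D => h.
  have : ((eta * eta)%:E * la D < (eta * eta * del)%:E)%E.
    by apply: le_lt_trans h _; rewrite lte_fin.
  by rewrite [ltRHS]EFinM lte_pmul2l// lte_fin mulr_gt0.
apply: scalarization_variation_le => // B mB BC; rewrite /=.
have BD : @msub_val _ _ _ mA A0 @` B `<=` D by move=> _ [b Bb <-]; exact: BC.
apply: norm_le_variation => // x x1; apply: le_trans (Hdel D mD laD x x1).
by apply: le_measure => //; rewrite inE.
Qed.

End restriction.

Variable K : Type.
Hypothesis K_dens : forall A (mA : measurable A) (A0 : A !=set0), la A <> 0%E ->
  [set: K] #<= dens (L1 (vrestr mA A0 nu)).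

(** W is the set of functions generated over the rationals by the restrictions to A of
    the functions to be annihilated, and closed under clipping. If no annihilator
    exists, the indicators of all measurable subsets of A are limits of elements of W
    in L2(la), hence in L1(nu_A), since clipped elements and indicators are bounded
    and la controls nu. Then W is dense in L1(nu_A), but it has too few elements. *)
Lemma exists_annihilator (I : Type) (G : I -> T -> R) :
  ~ ([set: K] #<= [set: GenTree.tree (nat + I)]) -> (forall i, bmeas (G i)) ->
  forall A, measurable A -> la A <> 0%E ->
  forall h : nat -> T -> R, (forall n, bmeas (h n)) ->
  exists u, [/\ bmeas u, forall t, ~ A t -> u t = 0, 0 < itg la (fun t => u t * u t),
    forall i, itg la (fun t => u t * G i t) = 0 & forall n, itg la (fun t => u t * h n t) = 0].
Proof.
move=> Ksmall bG A mA laA h bh; apply: contrapT => nu_.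
have A0 : A !=set0 by apply/set0P/eqP => A0; apply: laA; rewrite A0 measure0.
pose g (j : nat + I) : T -> R^o := fun t =>
  match j with inl n => h n t | inr i => G i t end * \1_A t.
pose W : set (T -> R^o) := rat_closure (@clip _ T R) g.
have bA := @bmeas_indic _ _ R A mA.
have bW w : W w -> bmeas w.
  apply: rat_closure_ind.
  - exact: bmeas_cst.
  - by case=> [n|i]; apply: bmeasM.
  - by move=> u v; exact: bmeasD.
  - by move=> u [mu _]; exact: bmeas_clip.
  - by move=> c u; exact: bmeasZ.
have W0A w t : W w -> ~ A t -> w t = 0.
  move=> + nAt; apply: (rat_closure_ind (P := fun w => w t = 0)) => //.
  - by case=> [n|i]; rewrite /g indicE memNset// mulr0.
  - by move=> u v u0 v0; rewrite fctE u0 v0 addr0.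
  - by move=> u u0; rewrite clip_id u0// lexx ler01.
  - by move=> c u u0; rewrite -[LHS]/(c * u t) u0 mulr0.
have WD u v : W u -> W v -> W (fun t => u t + v t) by exact: rat_closureD.
have WZ (q : rat) u : W u -> W (fun t => ratr q * u t) by exact: rat_closureZ.
have WC u : W u -> W (clip u) by exact: rat_closure_op.
have W00 : W (fun=> 0) by exact: rat_closure0.
have appr B : measurable B -> B `<=` A -> forall e : R, 0 < e ->
    exists2 w, W w & (forall t, 0 <= w t <= 1) /\
      itg la (fun t => (\1_B t - w t) * (\1_B t - w t)) <= e.
  move=> mB BA; have B01 t : 0 <= (\1_B t : R) <= 1.
    by rewrite indicE; case: (_ \in _); rewrite /= ?lexx ?ler01.
  have [[u [bu uz uW u0]]|//] := projection la bW W00 WD WZ WC (measurable_indic mB) B01.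
  exfalso; apply: nu_; exists u.
  have uA t : ~ A t -> u t = 0.
    move=> nAt; apply: uz => [|w Ww]; last exact: W0A.
    by rewrite indicE memNset// => /BA.
  (* u vanishes off A, so that orthogonality to a function and to its restriction to A
     are the same. *)
  have uI (k : T -> R) : itg la (fun t => u t * k t) = itg la (fun t => u t * (k t * \1_A t)).
    congr (itg _ _); apply/funext => t; have [At|nAt] := pselect (A t).
      by rewrite indicE mem_set// mulr1.
    by rewrite uA// !mul0r.
  split=> // [i|n]; rewrite uI; apply: uW.
    exact: (rat_closure_gen _ g (inr i)).
  exact: (rat_closure_gen _ g (inl n)).
pose val := @msub_val _ _ _ mA A0; pose nuA := vrestr mA A0 nu.
have mval : measurable_fun setT val by exact: measurable_msub_val.
pose W' := [set w \o val | w in W].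
have mW' w : W' w -> measurable_fun setT w.
  by move=> [v /bW[mv _] <-]; exact: measurableT_comp.
have W'i w : W w -> vintegrable nuA (w \o val).
  move=> /bW[mv [c vc]]; apply: (@vintegrable_bounded _ _ _ _ _ _ c).
    exact: measurableT_comp.
  by move=> t; exact: vc.
have indW' B : measurable B -> L1_approx nuA W' (\1_B).
  move=> mB e e0; have [del del0 Hdel] := L1norm_vrestr_small mA A0 e0.
  have [||w Ww [w01 wd]] := appr (val @` B) mB _ (del / 2).
  - by move=> _ [b _ <-]; exact/set_mem/valP.
  - by rewrite divr_gt0.
  exists (w \o val); first by exists w.
  rewrite (_ : (fun t => _) = (fun t => \1_(val @` B) t - w t) \o val); last first.
    apply/funext => t /=; rewrite !indicE; congr ((nat_of_bool _)%:R - _).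
    apply/idP/idP; rewrite !inE => Bt; first by exists t.
    by case: Bt => b Bb /val_inj <-.
  apply: Hdel.
  - by apply: bmeasB; [exact: bmeas_indic|exact: bW].
  - move=> t; have /andP[w0 w1] := w01 t; rewrite ler_norml indicE.
    by case: (_ \in _) => /=; apply/andP; split; lra.
  - by apply: le_lt_trans wd _; lra.
pose D : set (L1 nuA) := [set x | exists f : L1fun nuA, W' f /\ x = (\pi_(L1 nuA) f)%qT].
have dD : dense D.
  move=> O [x Ox] oO; have : nbhs x O by exact: open_nbhs_nbhs.
  move=> /nbhs_ballP[e /= e0 eO].
  pose f := repr x; have fx : x = (\pi_(L1 nuA) f)%qT by rewrite reprK.
  have e2 : 0 < e / 2 by rewrite divr_gt0.
  have [|||w W'w fw] := L1_dense mW' _ _ _ indW' (L1fun_integrable f) e2.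
  - by exists (fun=> 0).
  - by move=> _ _ [u Wu <-] [v Wv <-]; exists (fun t => u t + v t) => //; exact: WD.
  - by move=> q _ [u Wu <-]; exists (fun t => ratr q * u t) => //; exact: WZ.
  have wi : `[< vintegrable nuA w >] by apply/asboolP; case: W'w => v Wv <-; exact: W'i.
  exists (\pi_(L1 nuA) (L1Fun wi))%qT; split; last by exists (L1Fun wi).
  apply: eO; rewrite fx /ball /= L1_ballE.
  by apply: le_lt_trans fw _; rewrite lte_fin; lra.
have [dK Dmin] := densP (L1 nuA).
apply: Ksmall; apply: card_le_trans (K_dens mA A0 laA) _.
apply: card_le_trans (Dmin _ dD) _.
have /choice[F FP] : forall t : GenTree.tree (nat + I), exists x : L1 nuA,
    forall f : L1fun nuA, (f : msub mA A0 -> R) = rat_term (@clip _ T R) g t \o val ->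
      x = (\pi_(L1 nuA) f)%qT.
  move=> t; have wi : `[< vintegrable nuA (rat_term (@clip _ T R) g t \o val) >].
    by apply/asboolP/W'i; exists t.
  exists (\pi_(L1 nuA) (L1Fun wi))%qT => f fE; congr (\pi_(L1 nuA) _)%qT.
  by apply/val_inj.
apply: card_le_trans (card_image_le F setT).
apply: subset_card_le => x [f [[_ [t _ <-] ft] ->]].
by exists t => //; exact: FP.
Qed.

End annihilator.

(** * Bessel's inequality, densities and equality of L1 spaces *)

Section bessel.
Context d (T : measurableType d) (R : realType).
Variable la : {finite_measure set T -> \bar R}.
Local Notation E := (itg la).

(** The normalization of Bessel's inequality is replaced by a bound on the functions u k:
    expanding the square of g - t sum_k a_k u_k, integrated, at a suitable t bounds the
    finite sums of the a_k^2. *)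
Lemma bessel_finite (K : Type) (u : K -> T -> R) (c : R) (g : T -> R) (e : R) :
  (forall k, bmeas (u k)) -> (forall k t, `|u k t| <= c) ->
  (forall k l, k <> l -> E (fun t => u k t * u l t) = 0) ->
  bmeas g -> 0 < e -> finite_set [set k | e < `|E (fun t => u k t * g t)|].
Proof.
elim/Pchoice: K u => K u bu uc ortho bg e0; apply: contrapT => inf.
pose a k := E (fun t => u k t * g t).
have bv (s : seq K) : bmeas (fun t => \sum_(k <- s) a k * u k t).
  by apply: bmeas_sum => k; exact: bmeasZ.
pose C := c * c * fine (la setT) + 1.
have cc0 : 0 <= c * c by rewrite -expr2 sqr_ge0.
have C0 : 0 < C by rewrite ltr_wpDl// mulr_ge0// fine_ge0.
have uC k : E (fun t => u k t * u k t) <= C.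
  apply: (@le_trans _ _ (E (fun=> c * c))); last by rewrite itg_cst lerDl.
  apply: ler_itg; [exact: bmeasM|exact: bmeas_cst|move=> t].
  by rewrite -[leLHS]ger0_norm -?expr2 ?sqr_ge0// expr2 normrM ler_pM.
have cross s k : k \notin s -> E (fun t => u k t * \sum_(l <- s) a l * u l t) = 0.
  move=> ks; transitivity (\sum_(l <- s) a l * E (fun t => u k t * u l t)).
    transitivity (E (fun t => \sum_(l <- s) a l * (u k t * u l t))).
      by congr (E _); apply/funext => t; rewrite mulr_sumr; apply: eq_bigr => l _; ring.
    rewrite itg_sum => [|l]; last by apply/bmeasZ/bmeasM.
    by apply: eq_bigr => l _; rewrite itgZ//; exact: bmeasM.
  rewrite big_seq big1// => l ls; rewrite ortho ?mulr0// => kl.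
  by move: ks; rewrite kl ls.
have Ev s : uniq s -> E (fun t => (\sum_(k <- s) a k * u k t) * (\sum_(k <- s) a k * u k t))
    <= C * \sum_(k <- s) a k * a k.
  elim: s => [_|k s IH /= /andP[ks us]].
    by under eq_fun do rewrite big_nil mul0r; rewrite itg_cst big_nil mul0r mulr0.
  rewrite (_ : (fun t => _) = (fun t => (a k * u k t + 1 * \sum_(l <- s) a l * u l t) *
      (a k * u k t + 1 * \sum_(l <- s) a l * u l t))); last first.
    by apply/funext => t; rewrite !big_cons mul1r.
  rewrite itg_sqrD// cross// mulr0 addr0 big_cons mulrDr !mul1r.
  by apply: lerD (IH us); rewrite mulrC ler_wpM2r// -expr2 sqr_ge0.
have main s : uniq s -> \sum_(k <- s) a k * a k <= C * E (fun t => g t * g t).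
  move=> us; set S := \sum_(k <- s) _.
  have : 0 <= E (fun t => (1 * g t + (- C^-1) * \sum_(k <- s) a k * u k t) *
      (1 * g t + (- C^-1) * \sum_(k <- s) a k * u k t)).
    by apply: itg_ge0 => t; rewrite -expr2 sqr_ge0.
  rewrite itg_sqrD//.
  have -> : E (fun t => g t * \sum_(k <- s) a k * u k t) = S.
    transitivity (E (fun t => \sum_(k <- s) a k * (u k t * g t))).
      by congr (E _); apply/funext => t; rewrite mulr_sumr; apply: eq_bigr => l _; ring.
    rewrite itg_sum => [|l]; last by apply/bmeasZ/bmeasM.
    by apply: eq_bigr => l _; rewrite itgZ//; exact: bmeasM.
  have h := Ev s us; have Ci : 0 < C^-1 by rewrite invr_gt0.
  have : - C^-1 * - C^-1 * E (fun t => (\sum_(k <- s) a k * u k t) * (\sum_(k <- s) a k * u k t)) <= C^-1 * S.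
    apply: (@le_trans _ _ (- C^-1 * - C^-1 * (C * S))).
      by rewrite ler_wpM2l// mulrNN mulr_ge0// ltW.
    by rewrite mulrNN mulrA -(mulrA _ _ C) mulVf ?gt_eqF// mulr1.
  set x := - C^-1 * - C^-1 * _; set y := E _ => h1 h2.
  rewrite -ler_pdivrMl//; move: h1 h2; rewrite !mul1r mulr1 mulrN mulNr; lra.
pose B := C * E (fun t => g t * g t).
have e2 : 0 < e * e by rewrite mulr_gt0.
have [s sub sn] := infinite_set_fset (Num.truncn (B / (e * e))).+1 inf.
have := main (finmap.enum_fset s) (finmap.fset_uniq s); rewrite leNgt => /negP; apply.
apply: (@lt_le_trans _ _ (\sum_(k <- finmap.enum_fset s) e * e)).
  rewrite big_const_seq count_predT iter_addr_0 -[_ *+ _]mulr_natl -/B -ltr_pdivrMr//.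
  apply: lt_le_trans (Num.Theory.truncnS_gt _) _.
  by rewrite ler_nat; apply: leq_trans sn _.
rewrite big_seq [leRHS]big_seq; apply: ler_sum => k ks.
have /= /ltW ek := sub k ks.
rewrite -[a k * a k]expr2 -[leRHS]real_normK ?num_real// expr2.
by rewrite ler_pM// ltW.
Qed.

Lemma finite_measure_density (V : {measure set T -> \bar R}) :
  (V setT < +oo)%E -> (forall A, measurable A -> la A = 0%E -> V A = 0%E) ->
  exists h : T -> R, [/\ measurable_fun setT h, forall t, 0 <= h t,
    la.-integrable setT (EFin \o h) &
    forall A, measurable A -> V A = (\int[la]_(t in A) (h t)%:E)%E].
Proof.
move=> Vfin Vla.
pose V' : {finite_measure set T -> \bar R} := mfrestr measurableT Vfin.
have V'E A : V' A = V A by rewrite /V' /= /mfrestr /mrestr setIT.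
have Vdom : V' `<< la by apply/null_content_dominatesP => A mA lA; rewrite V'E; exact: Vla.
have [f [f0 ffin fi fV]] := radon_nikodym_sigma_finite Vdom.
have fE : EFin \o (fine \o f) = f by apply/funext => t /=; rewrite fineK.
exists (fine \o f); split.
- by apply/measurable_EFinP; rewrite fE; exact: (measurable_int _ fi).
- by move=> t; rewrite /= fine_ge0.
- by rewrite fE.
- move=> A mA; rewrite -V'E fV//.
  by apply: eq_integral => t _; rewrite /= fineK.
Qed.

End bessel.

Section L1norm_more.
Context d (T : measurableType d) (R : realType) (X : completeNormedModType R).
Variable nu : vector_measure T X.
Local Notation V x := (variation (scalarization nu x)).

Lemma vnullP A : vnull nu A <-> measurable A /\ (L1norm nu (\1_A) <= 0)%E.
Proof.
split=> [[mA A0]|[mA A0]]; split=> //.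
  apply: L1norm_indic_le => // x x1; rewrite variation_null// => B mB BA.
  by rewrite -[LHS]/((x (nu B) : R)%:E) A0// linear0.
move=> B mB BA; apply/eqP; rewrite -normr_le0; apply: norm_le_variation => // x x1.
have [/(_ A0 x x1)] := L1norm_leP nu (\1_A) 0%E.
rewrite (eq_integral (fun t => (\1_A t)%:E)); last first.
  by move=> t _; rewrite indicE; case: (_ \in _); rewrite ?normr1 ?normr0.
rewrite integral_indic// setIT => H _; apply: le_trans H.
by apply: le_measure; rewrite ?inE.
Qed.

Lemma bounded_L1norm_lty (f : T -> R) (c : R) : measurable_fun setT f ->
  (forall t, `|f t| <= c) -> (L1norm nu f < +oo)%E.
Proof.
move=> mf fc; have [M M0 HM] := L1norm_bounded nu.
apply: le_lt_trans (HM `|c| f _ mf _) (ltry _) => // t.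
by apply: le_trans (fc t) (ler_norm _).
Qed.

Lemma vintegrable_L1norm_lty f : vintegrable nu f -> (L1norm nu f < +oo)%E.
Proof.
move=> fi; have mf := vintegrable_measurable fi.
have [n fn] := vintegrable_tail fi ltr01.
have mt := measurable_trunc n mf.
apply: (@le_lt_trans _ _ (L1norm nu (fun t => (f t - trunc f n t) + trunc f n t)%R)).
  by under [X in (_ <= L1norm nu X)%E]eq_fun do rewrite subrK.
apply: le_lt_trans (L1normD _ _ _) _ => //; first exact: measurable_funB.
apply: lte_add_pinfty; first by apply: le_lt_trans fn _; exact: ltry.
by apply: (@bounded_L1norm_lty _ n%:R) => // t; exact: trunc_bounded.
Qed.

Lemma L1norm_trunc_le f (c : \bar R) : measurable_fun setT f ->
  (forall n, (L1norm nu (trunc f n) <= c)%E) -> (L1norm nu f <= c)%E.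
Proof.
move=> mf H; apply/L1norm_leP => x x1.
pose A n := [set t | `|f t| <= n%:R].
have mA n : measurable (A n) by exact: measurable_le_norm.
have mn : measurable_fun setT (fun t => `|f t|%:E).
  by apply/measurable_EFinP; exact: measurableT_comp.
have UA : \bigcup_n A n = setT.
  apply/seteqP; split=> // t _; exists (Num.truncn `|f t|).+1 => //=.
  by apply: ltW; exact: Num.Theory.truncnS_gt.
have cv : (\int[V x]_(t in A n) `|f t|%:E)%E @[n --> \oo] --> (\int[V x]_t `|f t|%:E)%E.
  rewrite -UA; apply: ge0_nondecreasing_set_cvg_integral => //.
  - by apply/nondecreasing_seqP => n; apply/subsetPset => t /= /le_trans; apply; rewrite ler_nat.
  - by move=> n; exact: measurable_funTS.
apply: (cvge_to_le cv); apply: nearW => n.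
rewrite integral_mkcond (eq_integral (fun t => `|trunc f n t|%:E)); last first.
  move=> t _; rewrite patchE /trunc; case: (boolP (`|f t| <= n%:R)) => h.
    by rewrite mem_set.
  by rewrite memNset ?normr0//=; exact/negP.
by have [+ _] := L1norm_leP nu (trunc f n) c; apply.
Qed.

End L1norm_more.

(** A set is null if its indicator has norm zero (vnullP), and f is integrable if its
    truncations converge to f in norm (vintegrableP). *)
Lemma eq_same_L1 d (T : measurableType d) (R : realType)
    (X Y : completeNormedModType R) (nu : vector_measure T X) (nu' : vector_measure T Y) :
  (forall f, measurable_fun setT f -> L1norm nu f = L1norm nu' f) -> same_L1 nu nu'.
Proof.
move=> H; split.
- apply/seteqP; split=> A /vnullP[mA A0]; apply/vnullP; split=> //.
    by rewrite -H//; exact: measurable_indic.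
  by rewrite H//; exact: measurable_indic.
- move=> f mf; rewrite !vintegrableP//; split=> h e e0; have [n fn] := h e e0; exists n.
    by rewrite -H//; apply: measurable_funB => //; exact: measurable_trunc.
  by rewrite H//; apply: measurable_funB => //; exact: measurable_trunc.
- by move=> f fi; apply: H; exact: vintegrable_measurable fi.
Qed.

(** * Norming families of functionals *)

Section norming.
Context d (T : measurableType d) (R : realType) (X : completeNormedModType R).
Variable nu : vector_measure T X.
Local Notation V x := (variation (scalarization nu x)).

Lemma L1norm_almost_attained f : vintegrable nu f ->
  exists2 x, dual_unit_ball x & (L1norm nu f <= \int[V x]_t `|f t|%:E + 1)%E.
Proof.
move=> fi; apply: contrapT => H.
have fty := vintegrable_L1norm_lty fi; have f0 := L1norm_ge0 nu f.
have fin : L1norm nu f \is a fin_num by rewrite ge0_fin_numE.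
have : (L1norm nu f <= L1norm nu f - 1)%E.
  apply/L1norm_leP => x x1; rewrite leNgt; apply/negP => xf; apply: H; exists x => //.
  by rewrite -leeBlDr// ltW.
by rewrite -(fineK fin) -EFinB lee_fin; lra.
Qed.

(** One functional for each element g of the dense subset, attaining the norm of g up
    to 1. The error disappears by homogeneity of the norm: to estimate the norm of f
    one applies this to an element g at distance at most 1 from a large multiple of f. *)
Lemma norming_family (K : Type) : [set: K] #= dens (L1 nu) ->
  exists x : K -> dual X, (forall k, dual_unit_ball (x k)) /\
    forall (f : T -> R) (c : R), vintegrable nu f ->
      (forall k, (\int[V (x k)]_t `|f t|%:E <= c%:E)%E) -> (L1norm nu f <= c%:E)%E.
Proof.
move=> /card_eqPle[_ dK].
have [dd _] := densP (L1 nu).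
have : exists b : K -> L1 nu, forall y, dens (L1 nu) y -> exists k, b k = y.
  have [k0 _] : exists k : K, True.
    have [y [_ dy]] : (setT `&` dens (L1 nu)) !=set0.
      apply: dd => //; last exact: openT.
      have vi : `[< vintegrable nu (fun=> 0) >].
        by apply/asboolP; apply: (@vintegrable_bounded _ _ _ _ _ _ 0) => // t; rewrite normr0.
      by exists (\pi_(L1 nu) (L1Fun vi))%qT.
    have /card_leP[F] := dK.
    by exists (sval (F (SigSub (mem_set dy)))).
  have [F _ Finj] := card_le_set_inj k0 dK.
  have /choice[b bP] : forall k, exists y,
      (exists2 z, dens (L1 nu) z & F z = k) -> dens (L1 nu) y /\ F y = k.
    move=> k; have [[z dz zk]|no] := pselect (exists2 z, dens (L1 nu) z & F z = k).
      by exists z.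
    have vi : `[< vintegrable nu (fun=> 0) >].
      by apply/asboolP; apply: (@vintegrable_bounded _ _ _ _ _ _ 0) => // t; rewrite normr0.
    by exists (\pi_(L1 nu) (L1Fun vi))%qT.
  exists b => y dy; exists (F y).
  have [dby Fby] := bP (F y) (ex_intro2 _ _ y dy erefl).
  by apply: Finj; rewrite ?inE.
move=> [b bP].
have /choice[x xP] : forall k, exists x, dual_unit_ball x /\
    (L1norm nu (repr (b k)) <= \int[V x]_t `|repr (b k) t|%:E + 1)%E.
  by move=> k; have [x] := L1norm_almost_attained (L1fun_integrable (repr (b k))); exists x.
exists x; split=> [k|f c fi H]; first by have [] := xP k.
have mf := vintegrable_measurable fi.
have fty := vintegrable_L1norm_lty fi; have f0 := L1norm_ge0 nu f.
have fin : L1norm nu f \is a fin_num by rewrite ge0_fin_numE.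
set l := fine (L1norm nu f); have lE : L1norm nu f = l%:E by rewrite fineK.
rewrite lE lee_fin; apply/ler_addgt0Pr => e e0.
have [m _ me] := near_infty_natSinv_lt (PosNum (divr_gt0 e0 (ltr0Sn R 2))).
have {}me : m.+1%:R^-1 < e / 3 := me m (leqnn _).
have m0 : 0 < m.+1%:R :> R by [].
(* the multiple of f that makes the error 3 negligible *)
have mfi := vintegrableZ m.+1%:R fi.
have vi : `[< vintegrable nu (fun t => m.+1%:R * f t) >] by apply/asboolP.
pose y := (\pi_(L1 nu) (L1Fun vi))%qT.
have [z [yz dz]] : (ball y (1 : R))^° `&` dens (L1 nu) !=set0.
  by apply: dd; [exists y; exact: nbhsx_ballx|exact: open_interior].
have [k bk] := bP z dz; have [xk1 xkz] := xP k; rewrite bk in xkz.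
set g := repr z in xkz; have gi := L1fun_integrable g; have mg := vintegrable_measurable gi.
have mmf : measurable_fun setT (fun t => m.+1%:R * f t) by exact: measurable_funM.
have fg : (L1norm nu (fun t => m.+1%:R * f t - g t)%R <= 1)%E.
  have := interior_subset yz; rewrite -[z]reprK -/g /y /ball /= L1_ballE.
  exact: ltW.
have mn (h : T -> R) : measurable_fun setT h -> measurable_fun setT (fun t => `|h t|%:E).
  by move=> mh; apply/measurable_EFinP; exact: measurableT_comp.
have gk : (\int[V (x k)]_t `|g t|%:E <= (m.+1%:R * c + 1)%:E)%E.
  apply: (@le_trans _ _ (\int[V (x k)]_t (m.+1%:R%:E * `|f t|%:E + `|m.+1%:R * f t - g t|%:E)%E)%E).
    apply: ge0_le_integral => //; first exact: mn.
      apply: emeasurable_funD; last by apply: mn; exact: measurable_funB.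
      by apply: measurable_funeM; exact: mn.
    move=> t _; rewrite -EFinM -EFinD lee_fin -{1}[m.+1%:R]ger0_norm// -normrM.
    rewrite -{1}(subKr (m.+1%:R * f t) (g t)); exact: ler_normB.
  rewrite ge0_integralD//; last 2 first.
  - by apply: measurable_funeM; exact: mn.
  - by apply: mn; exact: measurable_funB.
  rewrite ge0_integralZl//; last exact: mn.
  rewrite EFinD EFinM; apply: leeD; first exact: lee_wpmul2l.
  by have [/(_ fg (x k) xk1)] := L1norm_leP nu (fun t => m.+1%:R * f t - g t) 1%E.
have gl : (L1norm nu g <= (m.+1%:R * c + 2)%:E)%E.
  apply: le_trans xkz _; rewrite (_ : m.+1%:R * c + 2 = m.+1%:R * c + 1 + 1); last by ring.
  by rewrite [leRHS]EFinD leeD.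
have ml : (L1norm nu (fun t => m.+1%:R * f t)%R <= (m.+1%:R * c + 3)%:E)%E.
  apply: (@le_trans _ _ (L1norm nu (fun t => (m.+1%:R * f t - g t) + g t)%R)).
    by under [X in (_ <= L1norm nu X)%E]eq_fun do rewrite subrK.
  apply: le_trans (L1normD _ (measurable_funB mmf mg) mg) _.
  rewrite (_ : m.+1%:R * c + 3 = 1 + (m.+1%:R * c + 2)); last by ring.
  by rewrite [leRHS]EFinD leeD.
have : (L1norm nu f <= `|m.+1%:R^-1|%:E * L1norm nu (fun t => m.+1%:R * f t)%R)%E.
  apply: le_trans (L1normZ_le _ _ mmf).
  by under [X in (_ <= L1norm nu X)%E]eq_fun do rewrite mulrA mulVf// mul1r.
move=> /le_trans/(_ (lee_wpmul2l _ ml)); rewrite lee_fin => /(_ (normr_ge0 _)).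
rewrite lE -EFinM lee_fin ger0_norm// mulrDr mulrA mulVf// mul1r => /le_trans; apply.
by rewrite lerD2l; move: me; set r := _^-1; lra.
Qed.

End norming.

(** * The measure with values in c0 *)

Section c0_eval.
Context {R : realType} {K : Type}.

Lemma c0_eval (k : K) : exists2 y : dual (c0 R K), dual_unit_ball y &
  forall v : c0 R K, y v = v k.
Proof.
have lin : linear ((fun v : c0 R K => v k) : c0 R K -> R^o) by [].
pose f : {linear c0 R K -> R^o} := HB.pack_for {linear c0 R K -> R^o}
  ((fun v : c0 R K => v k) : c0 R K -> R^o)
  (GRing.isLinear.Build R (c0 R K) R^o *:%R (fun v : c0 R K => v k) lin).
have fle v : f v <= `|v|.
  exact: le_trans (ler_norm _) (le_c0_norm v k).
by have [y y1 yf] := norm_dominated_dual fle; exists y.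
Qed.

Lemma c0_sum (F : nat -> c0 R K) n k :
  (\sum_(0 <= i < n) F i : c0 R K) k = \sum_(0 <= i < n) F i k.
Proof.
elim: n => [|n IH]; first by rewrite !big_geq.
by rewrite !big_nat_recr//= -IH.
Qed.

End c0_eval.

Section c0_measure.
Context d (T : measurableType d) (R : realType) (X : completeNormedModType R).
Variable nu : vector_measure T X.
Variable la : {finite_measure set T -> \bar R}.
Hypothesis la_control : forall e : R, 0 < e -> exists2 del : R, 0 < del &
  forall A, measurable A -> (la A < del%:E)%E ->
    forall x, dual_unit_ball x -> (variation (scalarization nu x) A <= e%:E)%E.
Variables (K : Type) (x : K -> dual X) (h e : K -> T -> R).
Local Notation V k := (variation (scalarization nu (x k))).
Hypothesis x1 : forall k, dual_unit_ball (x k).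
Hypothesis mh : forall k, measurable_fun setT (h k).
Hypothesis h0 : forall k t, 0 <= h k t.
Hypothesis hi : forall k, la.-integrable setT (EFin \o h k).
Hypothesis hV : forall k A, measurable A -> V k A = (\int[la]_(t in A) (h k t)%:E)%E.
Hypothesis se : forall k, sign_function (e k).
Hypothesis ortho : forall n k l, k <> l ->
  itg la (fun t => (trunc (h k) n t * e k t) * (trunc (h l) n t * e l t)) = 0.

Let a k A := \int[la]_(t in A) (h k t * e k t).

Let e1 k t : `|e k t| = 1.
Proof. by have [_ H] := se k; case: (H t) => ->; rewrite ?normrN normr1. Qed.

Let hei k A : measurable A -> la.-integrable A (EFin \o (fun t => h k t * e k t)).
Proof.
move=> mA; apply: (@integrableS _ _ _ _ setT) => //.
apply: le_integrable (hi k) => //.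
  by apply/measurable_EFinP; apply: measurable_funM => //; have [] := se k.
by move=> t _; rewrite /= lee_fin normrM e1 mulr1.
Qed.

Let a_le k A : measurable A -> (`|a k A|%:E <= V k A)%E.
Proof.
move=> mA; have he := hei k mA; rewrite hV// EFin_normr_Rintegral//.
apply: le_trans (le_abse_integral _ mA (measurable_int _ he)) _.
apply: ge0_le_integral => //.
- by apply: measurableT_comp => //; exact: (measurable_int _ he).
- by apply/measurable_EFinP; exact: measurable_funS (mh k).
- by move=> t _; rewrite lee_fin normrM e1 mulr1 ger0_norm.
Qed.

Let aU k A B : measurable A -> measurable B -> A `&` B = set0 ->
  a k (A `|` B) = a k A + a k B.
Proof.
move=> mA mB AB; rewrite /a Rintegral_setU//; last by apply/disj_setPS; rewrite AB.
by apply: hei; exact: measurableU.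
Qed.

(** Up to eps / 2 the function h k may be cut off at a height n independent of k: as
    V k (T) is bounded in k, the sets where h k is larger than n have uniformly small
    la-measure, hence uniformly small V k. After that, Bessel's inequality applies. *)
Let a_finite A (eps : R) : measurable A -> 0 < eps ->
  finite_set [set k | eps < `|a k A|].
Proof.
move=> mA eps0; have eps2 : 0 < eps / 2 by rewrite divr_gt0.
have [del del0 Hdel] := la_control eps2.
have [M M0 HM] := semivariation_bounded nu.
(* Chebyshev: n la (B k) <= V k (B k) <= M < n del *)
pose n := (Num.truncn (M / del)).+1.
have nM : M < n%:R * del by rewrite -ltr_pdivrMr//; exact: Num.Theory.truncnS_gt.
pose u k t := trunc (h k) n t * e k t.
pose B k := ~` [set t | `|h k t| <= n%:R].
have mB k : measurable (B k) by apply: measurableC; exact: measurable_le_norm.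
have laB k : (la (B k) < del%:E)%E.
  rewrite ltNge; apply/negP => dB.
  have : (n%:R%:E * la (B k) <= V k (B k))%E.
    rewrite hV// -integral_cst//; apply: ge0_le_integral => //.
    - by move=> t _; rewrite lee_fin.
    - by apply/measurable_EFinP; exact: measurable_funS (mh k).
    - move=> t /= /negP; rewrite -ltNge ger0_norm// => /ltW; by rewrite lee_fin.
  move=> /le_trans/(_ (HM _ (x1 k) _ (mB k))).
  have : (n%:R%:E * del%:E <= n%:R%:E * la (B k))%E by rewrite lee_wpmul2l.
  by move=> /le_trans/[apply]; rewrite -EFinM lee_fin leNgt nM.
have bu k : bmeas (u k).
  split; last by exists n%:R => t; rewrite normrM e1 mulr1; exact: trunc_bounded.
  by apply: measurable_funM; [exact: measurable_trunc|have [] := se k].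
have uc k t : `|u k t| <= n%:R by rewrite normrM e1 mulr1; exact: trunc_bounded.
have uo k l : k <> l -> itg la (fun t => u k t * u l t) = 0 by exact: ortho.
apply: (sub_finite_set _ (bessel_finite bu uc uo (bmeas_indic R mA) eps2)).
move=> k /= ek.
have -> : itg la (fun t => u k t * \1_A t) = a k (A `\` B k).
  rewrite /a /itg [RHS]Rintegral_mkcond; apply: eq_Rintegral => t _.
  rewrite patchE /u /trunc indicE in_setD.
  case: (boolP (`|h k t| <= n%:R)) => ht.
    rewrite (memNset (_ : ~ B k t)) ?andbT; last by move=> /(_ ht).
    by case: (t \in A); rewrite ?mulr1 ?mulr0.
  rewrite mul0r mul0r (mem_set (_ : B k t)) ?andbF//.
  by move=> ht'; rewrite ht' in ht.
have aB : `|a k (A `&` B k)| <= eps / 2.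
  rewrite -lee_fin; apply: le_trans (a_le _ (measurableI _ _ mA (mB k))) _.
  apply: le_trans (Hdel _ (mB k) (laB k) _ (x1 k)).
  by apply: le_measure; rewrite ?inE//; exact: measurableI.
move: ek; rewrite -{1}(setUIDK A (B k)) aU//; last 3 first.
- exact: measurableI.
- exact: measurableD.
- by apply/seteqP; split=> // t [[_ ?] [_ ?]].
by move=> /lt_le_trans/(_ (ler_normD _ _)) h'; lra.
Qed.

Let a_c0 A : measurable A -> (fun k => a k A) \in c0_pred.
Proof.
move=> mA; rewrite inE; split; last by move=> eps; exact: a_finite.
have [M M0 HM] := semivariation_bounded nu; exists M => k; rewrite -lee_fin.
by apply: le_trans (a_le k mA) (HM _ (x1 k) _ mA).
Qed.

Definition c0_fun_of A : c0 R K :=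
  if pselect (measurable A) is left mA then C0 (a_c0 mA) else 0.

Lemma c0_fun_ofE A k : measurable A -> c0_fun_of A k = a k A.
Proof. by move=> mA; rewrite /c0_fun_of; case: pselect. Qed.

(** The k-th coordinates of the tails are bounded by the variations V k of the tails,
    which tend to zero uniformly in k. *)
Lemma c0_fun_of_sigma_additive (F : (set T)^nat) :
  (forall n, measurable (F n)) -> trivIset setT F ->
  (fun n => \sum_(0 <= i < n) c0_fun_of (F i)) @ \oo --> c0_fun_of (\bigcup_n F n).
Proof.
move=> mF tF; pose B n := \bigcup_(i in [set i | (n <= i)%N]) F i.
have mB n : measurable (B n) by apply: bigcup_measurable.
have B0 : B 0%N = \bigcup_n F n by congr bigcup; apply/seteqP; split.
have BS n : B n = F n `|` B n.+1.
  apply/seteqP; split=> [t [i /= ni Fi]|t [Fn|[i /= ni Fi]]].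
  - by move: ni; rewrite leq_eqVlt => /predU1P[->|ni]; [left|right; exists i].
  - by exists n => /=.
  - by exists i => //=; exact: ltnW.
have FB n : F n `&` B n.+1 = set0.
  apply/seteqP; split=> // t [Fn [i /= ni Fi]].
  have E' := tF n i I I (ex_intro _ t (conj Fn Fi)).
  by move: ni; rewrite E' ltnn.
have sumE n k : a k (\bigcup_n F n) = \sum_(0 <= i < n) a k (F i) + a k (B n).
  elim: n => [|n IH]; first by rewrite big_geq// add0r B0.
  by rewrite IH BS aU// big_nat_recr//= addrA.
apply/cvgrPdist_le => eps eps0.
have [||n Hn] := semivariation_tail nu mB _ _ eps0.
- by move=> n t; rewrite (BS n); right.
- apply/seteqP; split=> // t Bt; have [i _ Fi] := Bt 0%N I.
  have [j /= ij Fj] := Bt i.+1 I; have E' := tF i j I I (ex_intro _ t (conj Fi Fj)).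
  by move: ij; rewrite E' ltnn.
exists n => // m /= nm; apply: c0_norm_le; first exact: ltW.
move=> k; rewrite -[X in `|X|]/(c0_fun_of (\bigcup_n F n) k -
   (\sum_(0 <= i < m) c0_fun_of (F i) : c0 R K) k).
rewrite c0_sum c0_fun_ofE; last exact: bigcupT_measurable.
under eq_bigr do rewrite c0_fun_ofE//.
rewrite (sumE m) addrAC subrr add0r -lee_fin.
apply: le_trans (a_le _ (mB m)) _; apply: le_trans (Hn _ (x1 k)).
apply: le_measure; rewrite ?inE// => t [i /= mi Fi].
by exists i => //=; exact: leq_trans mi.
Qed.

Definition c0_measure : vector_measure T (c0 R K) :=
  VectorMeasure c0_fun_of_sigma_additive.

(** The sign e k does not change the variation of the measure with density h k. *)
Lemma variation_c0_measure k (y : dual (c0 R K)) : (forall v, y v = v k) ->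
  forall A, measurable A -> variation (scalarization c0_measure y) A = V k A.
Proof.
move=> yk A mA.
have sE B : measurable B -> scalarization c0_measure y B = (a k B)%:E.
  by move=> mB; rewrite /scalarization yk /= c0_fun_ofE.
apply/eqP; rewrite eq_le; apply/andP; split.
  apply: variation_min => // B mB.
  suff : (`|scalarization c0_measure y B| <= V k B)%E by [].
  by rewrite sE//; exact: a_le.
pose P := [set t | 0 <= e k t].
have mP : measurable P.
  rewrite (_ : P = e k @^-1` `[0, +oo[%classic).
    by rewrite -[_ @^-1` _]setTI; apply: (se k).1.
  by apply/seteqP; split=> t /=; rewrite /P /= in_itv/= andbT.
have m1 : measurable (A `&` P) by exact: measurableI.
have m2 : measurable (A `\` P) by exact: measurableD.
have disj : (A `&` P) `&` (A `\` P) = set0.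
  by apply/seteqP; split=> // t [[_ ?] [_ ?]].
rewrite -[in X in (X <= _)%E](setUIDK A P) -[in X in (_ <= X)%E](setUIDK A P) !measureU//.
have part B (s : bool) : measurable B -> (forall t, B t -> e k t = (-1) ^+ s) ->
    (V k B <= variation (scalarization c0_measure y) B)%E.
  move=> mB Bs; apply: le_trans (le_variation (scalarization c0_measure y) mB).
  suff : (V k B <= `|scalarization c0_measure y B|)%E by [].
  have hB : la.-integrable B (EFin \o h k) by exact: integrableS (hi k).
  have -> : scalarization c0_measure y B = ((-1) ^+ s * \int[la]_(t in B) h k t)%:E.
    rewrite sE// /a -RintegralZl//; congr EFin; apply: eq_Rintegral => t /set_mem Bt.
    by rewrite (Bs t Bt) mulrC.
  rewrite hV//= normrM normr_sign mul1r EFin_normr_Rintegral//.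
  exact: lee_abs.
apply: leeD.
  apply: (part _ false) => // t [_ /= Pt]; rewrite expr0.
  by have [_ /(_ t)[//|et]] := se k; move: Pt; rewrite /P /= et ler0N1.
apply: (part _ true) => // t [_ /= Pt]; rewrite expr1.
by have [_ /(_ t)[et|//]] := se k; exfalso; apply: Pt; rewrite /P /= et.
Qed.

Hypothesis norming : forall (f : T -> R) (c : R), vintegrable nu f ->
  (forall k, (\int[V k]_t `|f t|%:E <= c%:E)%E) -> (L1norm nu f <= c%:E)%E.

Lemma integral_c0_eval k (y : dual (c0 R K)) (f : T -> R) : (forall v, y v = v k) ->
  (\int[variation (scalarization c0_measure y)]_t `|f t|%:E =
   \int[V k]_t `|f t|%:E)%E.
Proof.
by move=> yk; apply: eq_measure_integral => A mA _; exact: variation_c0_measure.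
Qed.

(** For the inequality that is not given by evaluations, let y be in the unit ball of
    the dual of c0, and let s be the density of y nu' with respect to its variation.
    Then int |f| d|y nu'| = y (v) for the vector v = int |f| s dnu', whose coordinates are
    bounded by the integrals int |f| d|x_k nu|. *)
Lemma L1norm_c0_bounded (f : T -> R) (b : R) : measurable_fun setT f ->
  (forall t, `|f t| <= b) -> L1norm nu f = L1norm c0_measure f.
Proof.
move=> mf fb; apply/eqP; rewrite eq_le; apply/andP; split.
  have fty := bounded_L1norm_lty c0_measure mf fb.
  have fin : L1norm c0_measure f \is a fin_num by rewrite ge0_fin_numE// L1norm_ge0.
  rewrite -(fineK fin); apply: norming; first exact: vintegrable_bounded fb.
  move=> k; have [y y1 yk] := @c0_eval R K k.
  rewrite -(integral_c0_eval _ yk) fineK//.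
  by have [+ _] := L1norm_leP c0_measure f (L1norm c0_measure f); exact.
have fty := bounded_L1norm_lty nu mf fb.
have fin : L1norm nu f \is a fin_num by rewrite ge0_fin_numE// L1norm_ge0.
have c0' : 0 <= fine (L1norm nu f) by rewrite fine_ge0// L1norm_ge0.
have Hk k : (\int[V k]_t `|f t|%:E <= (fine (L1norm nu f))%:E)%E.
  by rewrite fineK//; have [+ _] := L1norm_leP nu f (L1norm nu f); exact.
rewrite -(fineK fin); apply/L1norm_leP => y y1.
pose s := charge_sgn (scalarization c0_measure y).
have ms : measurable_fun setT s by exact: measurable_charge_sgn.
(* v is the integral of |f| s with respect to the measure with values in c0 *)
pose g t := `|f t| * s t.
have gn t : `|g t| = `|f t| by rewrite normrM charge_sgn_norm mulr1 normr_id.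
have mg : measurable_fun setT g by apply: measurable_funM => //; exact: measurableT_comp.
have gb t : `|g t| <= b by rewrite gn.
have [_ gi gv] := vintegrable_bounded c0_measure mg gb.
have [v vP] := gv setT measurableT.
have fi : (variation (scalarization c0_measure y)).-integrable setT (EFin \o (fun t => `|f t|)).
  apply: (@integral_bound_fin _ _ _ _ _ _ b) => //.
  - exact: variation_lty.
  - exact: measurableT_comp.
  - by move=> t; rewrite normr_id.
have yv : (y v)%:E = (\int[variation (scalarization c0_measure y)]_t `|f t|%:E)%E.
  rewrite vP charge_integralE// /Rintegral fineK.
    by apply: eq_integral => t _; rewrite /g -mulrA charge_sgn_sqr mulr1.
  by apply: integrable_fin_num => //; exact: (integrable_sgn measurableT (gi y)).
rewrite -yv lee_fin; apply: le_trans (ler_norm _) _; apply: le_trans (y1 v) _.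
apply: c0_norm_le => // k; have [z z1 zk] := @c0_eval R K k.
rewrite -zk vP charge_integralE// -lee_fin; apply: le_trans (Hk k).
have gs := integrable_sgn measurableT (gi z).
rewrite EFin_normr_Rintegral//.
apply: le_trans (le_abse_integral _ measurableT (measurable_int _ gs)) _.
rewrite -(integral_c0_eval _ zk); apply: ge0_le_integral => //.
- by apply: measurableT_comp => //; exact: (measurable_int _ gs).
- by apply/measurable_EFinP; exact: measurableT_comp.
- by move=> t _; rewrite /= lee_fin normrM charge_sgn_norm mulr1 gn.
Qed.

(** Both norms are suprema over the truncations, where they agree. *)
Lemma c0_measure_same_L1 : same_L1 nu c0_measure.
Proof.
apply: eq_same_L1 => f mf; apply/eqP; rewrite eq_le; apply/andP; split.
  apply: L1norm_trunc_le => // n.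
  rewrite (L1norm_c0_bounded (measurable_trunc n mf) (trunc_bounded f n)).
  apply: L1norm_mono => //; first exact: measurable_trunc.
  by move=> t; rewrite /trunc; case: ifP => // _; rewrite normr0.
apply: L1norm_trunc_le => // n.
rewrite -(L1norm_c0_bounded (measurable_trunc n mf) (trunc_bounded f n)).
apply: L1norm_mono => //; first exact: measurable_trunc.
by move=> t; rewrite /trunc; case: ifP => // _; rewrite normr0.
Qed.

End c0_measure.

Theorem theorem1p2 (R : realType) (d : measure_display) (T : measurableType d)
    (X : completeNormedModType R) (nu : vector_measure T X) :
  vhomogeneous nu ->
  ~ separable (L1 nu) ->
  forall K : Type, [set: K] #= dens (L1 nu) ->
  exists nu' : vector_measure T (c0 R K), same_L1 nu nu'.
Proof.
move=> [_ hom] nsep K Kd.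
have Kunc : ~ countable [set: K].
  move=> Kc; apply: nsep; exists (dens (L1 nu)); last by have [] := densP (L1 nu).
  by apply: sub_countable Kc; rewrite card_eq_sym in Kd; have /card_eqPle[] := Kd.
have [la [la0 lac]] := control_measure nu.
have [x [x1 xn]] := norming_family Kd.
have Kdens A (mA : measurable A) (A0 : A !=set0) : la A <> 0%E ->
    [set: K] #<= dens (L1 (vrestr mA A0 nu)).
  move=> laA; have nA : ~ vnull nu A by move=> /la0.
  rewrite (Prop_irrelevance A0 (not_vnull_nonempty nA)).
  have /card_eqPle[h1 _] := hom A mA nA; apply: card_le_trans h1.
  by have /card_eqPle[] := Kd.
have /choice[h hP] : forall k, exists h : T -> R, [/\ measurable_fun setT h, forall t, 0 <= h t,
    la.-integrable setT (EFin \o h) &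
    forall A, measurable A ->
      variation (scalarization nu (x k)) A = (\int[la]_(t in A) (h t)%:E)%E].
  move=> k; apply: finite_measure_density; first exact: variation_lty.
  move=> A mA lA; apply/eqP; rewrite eq_le measure_ge0 andbT.
  apply/lee_addgt0Pr => eps eps0; rewrite add0e.
  have [del del0 H] := lac eps eps0; apply: H => //.
  by rewrite lA lte_fin.
have [lt [wf tot small]] := small_well_order K.
have s1 : sign_function (fun _ : T => 1 : R) by split=> [|t]; [exact: measurable_cst|left].
pose F k n (e : T -> R) t := trunc (h k) n t * e t.
have bF k n e : sign_function e -> bmeas (F k n e).
  move=> [me e1]; apply: bmeasM; last first.
    by split=> //; exists 1 => t; case: (e1 t) => ->; rewrite ?normrN normr1.
  split; first by apply: measurable_trunc; have [] := hP k.
  by exists n%:R; exact: trunc_bounded.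
have [e0 e0P] : exists e : K -> {e : T -> R | sign_function e}, forall k l, lt l k -> forall n,
    itg la (fun t => sval (e k) t * (trunc (h k) n t * F l n (sval (e l)) t)) = 0.
  apply: (@wf_choice K _ lt (fun k f v => forall l, lt l k -> forall n,
    itg la (fun t => sval v t * (trunc (h k) n t * F l n (sval (f l)) t)) = 0)
    (exist _ _ s1) wf).
    by move=> k f g v fg H l lk n; rewrite -fg//; exact: H.
  move=> k f; pose J := {l : K | lt l k}.
  (* the functions that e k must be orthogonal to: one for each l below k and each
     height n *)
  pose G (i : J * nat) t := trunc (h k) i.2 t * F (sval i.1) i.2 (sval (f (sval i.1))) t.
  have bG i : bmeas (G i).
    apply: bmeasM; last exact/bF/(svalP (f (sval i.1))).
    split; first by apply: measurable_trunc; have [] := hP k.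
    by exists i.2%:R; exact: trunc_bounded.
  have Jsmall : ~ ([set: K] #<= [set: GenTree.tree (nat + J * nat)]).
    move=> KT; apply: (small k).
    have /card_leT_inj[g gI] : [set: K] #<= [set: J].
      by apply: card_tree_small KT => //; exists id.
    have sI : injective (fun l => sval (g l)).
      move=> l m E'; apply: gI; case: (g l) (g m) E' => [i li] [j lj] /= ij.
      exact: eq_exist.
    rewrite -(card_le_eql (inj_card_eq (in2W sI : {in setT &, injective (fun l => sval (g l))}))).
    by apply: subset_card_le => _ [l _ <-]; exact: (svalP (g l)).
  have [e se eG] := sign_exists bG (exists_annihilator lac Kdens Jsmall bG).
  by exists (exist _ e se) => l lk n; exact: (eG (exist _ l lk, n)).
have ortho n k l : k <> l -> itg la (fun t => (trunc (h k) n t * sval (e0 k) t) *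
    (trunc (h l) n t * sval (e0 l) t)) = 0.
  move=> /tot[kl|lk].
    rewrite -(e0P l k kl n); congr (itg _ _); apply/funext => t; rewrite /F; ring.
  rewrite -(e0P k l lk n); congr (itg _ _); apply/funext => t; rewrite /F; ring.
have mh k : measurable_fun setT (h k) by have [] := hP k.
have h0 k t : 0 <= h k t by have [_ + _ _] := hP k; apply.
have hi k : la.-integrable setT (EFin \o h k) by have [] := hP k.
have hV k A : measurable A -> variation (scalarization nu (x k)) A =
    (\int[la]_(t in A) (h k t)%:E)%E by have [_ _ _ H] := hP k; exact: H.
have se k : sign_function (sval (e0 k)) by exact: svalP.
exists (c0_measure lac x1 mh h0 hi hV se ortho).
exact: (c0_measure_same_L1 lac x1 mh h0 hi hV se ortho xn).
Qed.
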